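(* Let $\mathcal{X}$ and $\mathcal{Y}$ be locally finite countably generated coarse spaces, $\{C_i^X\}_{i\in I}$ a family of faithful coarse $\mathcal{X}$-modules, $\{C_i^Y\}_{i\in I}$ a family of faithful coarse $\mathcal{Y}$-modules, and, for every $i\in I$, let $\phi_i\colon\operatorname{End}_{\mathcal{A}(\mathcal{X})}(C_i^X)\to\operatorname{End}_{\mathcal{A}(\mathcal{Y})}(C_i^Y)$ be a $*$-isomorphism between the algebras of approximable operators of $C_i^X$ and $C_i^Y$. The following are equivalent: (1) the induced coarse equivalences $f_i\colon\mathcal{X}\to\mathcal{Y}$ coincide up to closeness; (2) there exists a full and faithful $*$-functor $F\colon\mathcal{A}(\mathcal{X})\to\mathcal{A}(\mathcal{Y})$ such that the isomorphisms $F\colon\operatorname{End}_{\mathcal{A}(\mathcal{X})}(C_i^X)\to\operatorname{End}_{\mathcal{A}(\mathcal{Y})}(C_i^Y)$ coincide with $\phi_i$.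
   Context: Coarse spaces. A coarse structure on a set $X$ is a family $\mathcal{E}^X$ of subsets of $X\times X$ (entourages) containing the diagonal and closed under subsets, finite unions, transposes and compositions. It is countably generated if it is the smallest coarse structure containing some countable family of subsets. $A\subset X$ is $E$-bounded if $A\times A\subset E$, bounded if it is $E$-bounded for some $E\in\mathcal{E}^X$. With $E[A]=\{x\mid\exists a\in A:(x,a)\in E\}$, $A\prec B$ means $A\subset E[B]$ for some $E\in\mathcal{E}^X$; $A\asymp B$ (asymptotically equivalent) means $A\prec B$ and $B\prec A$. $Y\times X$ carries the product coarse structure generated by $\mathcal{E}^Y\times\mathcal{E}^X$. A coarse space is locally finite if all its bounded subsets are finite. Maps. $f\colon X\to Y$ is coarse if $(f\times f)(E)\in\mathcal{E}^Y$ for all $E\in\mathcal{E}^X$; coarse maps $f,g$ are close ($f\sim g$) if $(f\times g)(E)\in\mathcal{E}^Y$ for all $E\in\mathcal{E}^X$; a coarse map $f$ is a coarse equivalence if there is a coarse map $g\colon Y\to X$ with $f\circ g\sim\mathrm{id}_Y$ and $g\circ f\sim\mathrm{id}_X$. Modules. For a locally finite coarse space $\mathcal{X}=(X,\mathcal{E}^X)$, a coarse $\mathcal{X}$-module $C$ is a Hilbert space $H_C$ with a (unital) representation $A\mapsto\mathbb{1}_A^C$ of the Boolean algebra $\mathcal{P}(X)$ by projections on $H_C$ such that for some gauge (symmetric entourage containing the diagonal) $E$ the span of $\{\mathbb{1}^C_AH_C\mid A\ E\text{-bounded}\}$ is dense; equivalently $\sum_{x}\mathbb{1}^C_{\{x\}}=1$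 strongly. Its rank is the Hilbert dimension of $H_C$. $C$ is faithful if $\{x\in X\mid\mathbb{1}^C_{\{x\}}\ne0\}\asymp X$. The support of a bounded operator $t\colon H_C\to H_D$ between $\mathcal{X}$-modules is $\{(y,x)\mid\mathbb{1}^D_{\{y\}}t\mathbb{1}^C_{\{x\}}\neq0\}$; $t$ has controlled propagation if its support is an entourage; $t$ is approximable if it is a norm limit of controlled propagation operators. Categories. For an infinite cardinal $\kappa$, $\mathcal{A}_\kappa(\mathcal{X})$ is the $C^*$-category of coarse $\mathcal{X}$-modules of rank at most $\kappa$ with approximable operators as morphisms; $\mathcal{A}_\infty(\mathcal{X})$ is the same without rank restriction. $\mathcal{A}(\cdot)$ denotes either $\mathcal{A}_\kappa(\cdot)$ for one fixed infinite $\kappa$, or $\mathcal{A}_\infty(\cdot)$, the same choice throughout. $\operatorname{End}_{\mathcal{A}(\mathcal{X})}(C)$ is the algebra of approximable operators on $C$; this notation presupposes that the modules $C_i^X$, $C_i^Y$ are objects of $\mathcal{A}(\mathcal{X})$, $\mathcal{A}(\mathcal{Y})$. $*$-functors are $\mathbb{C}$-linear on morphisms and preserve adjoints. Condition (2) includes $F(C_i^X)=C_i^Y$. Induced coarse equivalence (known facts). Every $*$-isomorphism $\phi\colon\operatorname{End}_{\mathcal{A}(\mathcal{X})}(C_X)\to\operatorname{End}_{\mathcal{A}(\mathcal{Y})}(C_Y)$ between algebras of approximable operators of faithful modules equals $\operatorname{Ad}_U$ for a unitary $U\colon H_{C_X}\to H_{C_Y}$. For $\delta>0$, $E\in\mathcal{E}^X$,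 $E'\in\mathcal{E}^Y$ put $f^U_{\delta,E',E}=\bigcup\{B\times A\mid B\subset Y\ E'\text{-bounded},\ A\subset X\ E\text{-bounded},\ \|\mathbb{1}_B^{C_Y}U\mathbb{1}_A^{C_X}\|>\delta\}\subset Y\times X$. When $\mathcal{X},\mathcal{Y}$ are countably generated, for every $\delta\in(0,1)$ there exist sufficiently large $E'\in\mathcal{E}^Y$, $E\in\mathcal{E}^X$ such that $f^U_{\delta,E',E}$ is asymptotically equivalent to the graph $\{(f(x),x)\mid x\in X\}$ of a coarse equivalence $f\colon\mathcal{X}\to\mathcal{Y}$; the closeness class of $f$ does not depend on the choice of $U,\delta,E',E$. This $f$ is the coarse equivalence induced by $\phi$; $f_i$ denotes the one induced by $\phi_i$.
   Formalization: The index set I is assumed nonempty, and whenever C_i^X = C_j^X it is assumed that C_i^Y = C_j^Y and φ_i = φ_j; without these assumptions the implication (1)⇒(2) is false. *)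

(* Defs.v *)
From HB Require Import structures.
From mathcomp Require Import all_boot all_order all_algebra.
From mathcomp Require Import complex sesquilinear.
From mathcomp Require Import all_classical all_reals all_analysis.

Set Implicit Arguments.
Unset Strict Implicit.
Unset Printing Implicit Defensive.

Import Order.TTheory GRing.Theory Num.Theory.
Import numFieldNormedType.Exports.

Local Open Scope classical_set_scope.
Local Open Scope ring_scope.
Local Open Scope complex_scope.

Record is_coarse_structure (X : Type) (E : set (set (X * X))) : Prop := {
  coarse_diagonal : E [set xy | xy.1 = xy.2];
  coarse_subset : forall A B, A `<=` B -> E B -> E A;
  coarse_union : forall A B, E A -> E B -> E (A `|` B);
  coarse_transpose : forall A, E A -> E (A^-1)%relation;
  coarse_compose : forall A B, E A -> E B -> E (A \; B)%relation }.

Record coarseSpace := CoarseSpace {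
  coarse_carrier :> Type;
  controlled : set (set (coarse_carrier * coarse_carrier));
  controlledP : is_coarse_structure controlled }.

Definition generated_coarse (X : Type) (F : set (set (X * X))) :
    set (set (X * X)) :=
  [set E | forall S, is_coarse_structure S -> F `<=` S -> S E].

Lemma generated_coarseP (X : Type) (F : set (set (X * X))) :
  is_coarse_structure (generated_coarse F).
Proof.
split.
- by move=> S SP _; exact: coarse_diagonal SP.
- by move=> A B AB EB S SP FS; apply: (coarse_subset SP AB); exact: EB.
- by move=> A B EA EB S SP FS; exact: (coarse_union SP (EA S SP FS) (EB S SP FS)).
- by move=> A EA S SP FS; exact: (coarse_transpose SP (EA S SP FS)).
- by move=> A B EA EB S SP FS; exact: (coarse_compose SP (EA S SP FS) (EB S SP FS)).
Qed.

Definition countably_generated (X : coarseSpace) : Prop :=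
  exists F : set (set (X * X)),
    countable F /\ @controlled X = generated_coarse F.

Definition product_coarse (Y X : coarseSpace) : coarseSpace :=
  CoarseSpace (generated_coarseP
    [set D : set ((Y * X) * (Y * X)) | exists E' E,
       [/\ controlled E', controlled E &
           D = [set pq | E' (pq.1.1, pq.2.1) /\ E (pq.1.2, pq.2.2)]]]).

Definition E_bounded (X : coarseSpace) (E : set (X * X)) (A : set X) : Prop :=
  A `*` A `<=` E.

Definition coarse_bounded (X : coarseSpace) (A : set X) : Prop :=
  exists2 E, controlled E & E_bounded E A.

Definition locally_finite (X : coarseSpace) : Prop :=
  forall A : set X, coarse_bounded A -> finite_set A.

Record lfCoarseSpace := LfCoarseSpace {
  lf_space :> coarseSpace;
  lf_spaceP : locally_finite lf_space }.

Definition thickening (X : coarseSpace) (E : set (X * X)) (A : set X) : set X :=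
  [set x | exists2 a, A a & E (x, a)].

Definition coarse_prec (X : coarseSpace) (A B : set X) : Prop :=
  exists2 E, controlled E & A `<=` thickening E B.

Definition asymptotic (X : coarseSpace) (A B : set X) : Prop :=
  coarse_prec A B /\ coarse_prec B A.

Definition coarse_gauge (X : coarseSpace) (E : set (X * X)) : Prop :=
  [/\ controlled E, (E^-1)%relation = E & [set xy | xy.1 = xy.2] `<=` E].

Definition coarse_map (X Y : coarseSpace) (f : X -> Y) : Prop :=
  forall E, controlled E -> controlled [set (f xy.1, f xy.2) | xy in E].

Definition coarse_close (X Y : coarseSpace) (f g : X -> Y) : Prop :=
  forall E, controlled E -> controlled [set (f xy.1, g xy.2) | xy in E].

Definition coarse_equivalence (X Y : coarseSpace) (f : X -> Y) : Prop :=
  coarse_map f /\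
  exists g : Y -> X,
    [/\ coarse_map g, coarse_close (f \o g) id & coarse_close (g \o f) id].

(* The form is linear in its first argument and conjugate-linear in the
   second one. *)
Record hilbertType (R : realType) := HilbertType {
  hilbert_carrier :> completeNormedModType R[i];
  inner : {dot hilbert_carrier for Num.conj};
  innerE : forall x : hilbert_carrier, `|x| ^+ 2 = inner x x }.

(* The norm of a normed module over R[i] takes values in R[i]. *)
Definition hnorm (R : realType) (H : hilbertType R) (x : H) : R := complex.Re `|x|.

Definition bounded_op (R : realType) (H K : hilbertType R) (t : H -> K) : Prop :=
  linear t /\ exists M : R, forall x, hnorm (t x) <= M * hnorm x.

(* Meaningful for bounded operators only: for others the supremum is the default
   value 0. *)
Definition opnorm (R : realType) (H K : hilbertType R) (t : H -> K) : R :=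
  sup [set hnorm (t x) | x in [set x | hnorm x <= 1]].

Definition adjoint_pair (R : realType) (H K : hilbertType R)
    (t : H -> K) (s : K -> H) : Prop :=
  forall x y, inner K (t x) y = inner H x (s y).

Definition is_projection (R : realType) (H : hilbertType R) (p : H -> H) : Prop :=
  [/\ bounded_op p, p \o p = p & adjoint_pair p p].

Definition lin_span (R : realType) (H : hilbertType R) (S : set H) : set H :=
  [set v | exists n (c : 'I_n -> R[i]) (w : 'I_n -> H),
     (forall i, S (w i)) /\ v = \sum_i c i *: w i].

Definition orthonormal_basis (R : realType) (H : hilbertType R) (B : set H) : Prop :=
  [/\ forall v, B v -> inner H v v = 1,
      forall v w, B v -> B w -> v <> w -> inner H v w = 0
    & closure (lin_span B) = setT].

(* [U] is a unitary with adjoint (= inverse) [V]. *)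
Definition unitary_pair (R : realType) (H K : hilbertType R)
    (U : H -> K) (V : K -> H) : Prop :=
  [/\ bounded_op U, bounded_op V, adjoint_pair U V, cancel U V & cancel V U].

Section OperatorTheory.
Context {R : realType}.
Implicit Types H K L : hilbertType R.

Lemma hnormE H (x : H) : `|x| = (hnorm x)%:C.
Proof.
have : 0 <= `|x| by exact: normr_ge0.
by rewrite /hnorm lecE; case: `|x| => a b /= /andP[/eqP -> _].
Qed.

Lemma hnorm_ge0 H (x : H) : 0 <= hnorm x.
Proof. by have := normr_ge0 x; rewrite hnormE lecR. Qed.

Lemma hnorm0 H : hnorm (0 : H) = 0.
Proof. by rewrite /hnorm normr0. Qed.

Lemma hnorm_eq0 H (x : H) : hnorm x = 0 -> x = 0.
Proof. by move=> x0; apply/eqP; rewrite -normr_eq0 hnormE x0. Qed.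

Lemma hnormD H (x y : H) : hnorm (x + y) <= hnorm x + hnorm y.
Proof. by have := ler_normD x y; rewrite !hnormE -rmorphD lecR. Qed.

Lemma hnormZ H (a : R[i]) (x : H) : hnorm (a *: x) = complex.Re `|a| * hnorm x.
Proof.
rewrite {1}/hnorm normrZ hnormE.
have : 0 <= `|a| by exact: normr_ge0.
by rewrite lecE; case: `|a| => b c /= /andP[/eqP -> _]; rewrite mul0r subr0.
Qed.

Lemma Re_norm_ge0 (a : R[i]) : 0 <= complex.Re `|a|.
Proof. by have : 0 <= `|a| by []; rewrite lecE => /andP[]. Qed.

Lemma linear_op0 H K (t : H -> K) : linear t -> t 0 = 0.
Proof.
by move=> lt; have := lt (-1) 0 0; rewrite scaler0 addr0 scaleN1r addNr.
Qed.

Lemma linear_opZ H K (t : H -> K) : linear t -> forall a x, t (a *: x) = a *: t x.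
Proof. by move=> lt a x; have := lt a x 0; rewrite (linear_op0 lt) !addr0. Qed.

Lemma linear_opD H K (t : H -> K) : linear t -> forall x y, t (x + y) = t x + t y.
Proof. by move=> lt x y; have := lt 1 x y; rewrite !scale1r. Qed.

Lemma linear_op_sum H K (t : H -> K) : linear t ->
  forall n (w : 'I_n -> H), t (\sum_i w i) = \sum_i t (w i).
Proof.
move=> lt n w.
exact: (big_morph t (linear_opD lt) (linear_op0 lt)).
Qed.

Lemma opnorm_ub H K (t : H -> K) : bounded_op t ->
  has_ubound [set hnorm (t x) | x in [set x | hnorm x <= 1]].
Proof.
move=> [lt [M Mt]]; exists `|M| => _ [x /= x1 <-].
apply: (le_trans (Mt x)); apply: (le_trans (ler_wpM2r (hnorm_ge0 x) (ler_norm M))).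
by rewrite -[leRHS]mulr1 ler_wpM2l.
Qed.

Lemma opnorm_ge0 H K (t : H -> K) : bounded_op t -> 0 <= opnorm t.
Proof.
move=> tb; apply: (le_trans (hnorm_ge0 (t 0))); apply: ub_le_sup.
  exact: opnorm_ub.
by exists 0 => //=; rewrite hnorm0 ler01.
Qed.

Lemma opnormP H K (t : H -> K) : bounded_op t ->
  forall x, hnorm (t x) <= opnorm t * hnorm x.
Proof.
move=> tb x; have [x0|x0] := eqVneq (hnorm x) 0.
  by rewrite (hnorm_eq0 x0) (linear_op0 tb.1) !hnorm0 mulr0.
have xgt0 : 0 < hnorm x by rewrite lt_def x0 hnorm_ge0.
rewrite -ler_pdivrMr//; apply: ub_le_sup; first exact: opnorm_ub.
have nrm : complex.Re `|((hnorm x)^-1)%:C : R[i]| = (hnorm x)^-1.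
  by rewrite ger0_norm//= ?lecR ?invr_ge0 ?hnorm_ge0.
exists (((hnorm x)^-1)%:C *: x).
  by rewrite /= hnormZ nrm mulVf.
by rewrite (linear_opZ tb.1) hnormZ nrm mulrC.
Qed.

Lemma opnorm_le H K (t : H -> K) (M : R) : 0 <= M ->
  (forall x, hnorm (t x) <= M * hnorm x) -> opnorm t <= M.
Proof.
move=> M0 tM; apply: ge_sup.
  by exists (hnorm (t 0)), 0 => //=; rewrite hnorm0 ler01.
move=> _ [x /= x1 <-]; apply: (le_trans (tM x)).
by rewrite -[leRHS]mulr1 ler_wpM2l.
Qed.

Lemma bounded_op_id H : bounded_op (@id H).
Proof. by split=> [a x y //|]; exists 1 => x; rewrite mul1r. Qed.

Lemma bounded_op0 H K : bounded_op (fun=> 0 : K) (H := H).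
Proof.
split=> [a x y|]; first by rewrite scaler0 addr0.
by exists 0 => x; rewrite hnorm0 mul0r.
Qed.

Lemma bounded_op_comp H K L (s : K -> L) (t : H -> K) :
  bounded_op s -> bounded_op t -> bounded_op (s \o t).
Proof.
move=> sb tb; split=> [a x y|]; first by rewrite /= tb.1 sb.1.
exists (opnorm s * opnorm t) => x /=; apply: (le_trans (opnormP sb _)).
by rewrite -mulrA ler_wpM2l ?opnorm_ge0// opnormP.
Qed.

Lemma bounded_opZD H K (a : R[i]) (s t : H -> K) :
  bounded_op s -> bounded_op t -> bounded_op (fun x => a *: s x + t x).
Proof.
move=> sb tb; split=> [b x y|].
  rewrite sb.1 tb.1 !scalerDr !scalerA [a * b]mulrC -!addrA; congr (_ + _).
  by rewrite addrCA.
exists (complex.Re `|a| * opnorm s + opnorm t) => x; apply: (le_trans (hnormD _ _)).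
rewrite mulrDl lerD ?opnormP// hnormZ -mulrA ler_wpM2l ?Re_norm_ge0//.
exact: opnormP.
Qed.

Lemma bounded_opB H K (s t : H -> K) :
  bounded_op s -> bounded_op t -> bounded_op (s \- t).
Proof.
move=> sb tb; have := bounded_opZD (-1) tb sb; congr bounded_op.
by apply/funext => x /=; rewrite scaleN1r addrC.
Qed.

Lemma lin_span_closed_zero H K (S : set H) (t : H -> K) : bounded_op t ->
  closure (lin_span S) = setT -> (forall v, S v -> t v = 0) -> forall v, t v = 0.
Proof.
move=> tb dS tS v; apply: hnorm_eq0; apply/eqP; rewrite eq_le hnorm_ge0 andbT.
apply/ler_addgt0Pl => e e0; rewrite addr0.
have M0 : 0 < opnorm t + 1 by rewrite ltr_wpDl ?opnorm_ge0.
have : closure (lin_span S) v by rewrite dS.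
have eM : 0 < (e / (opnorm t + 1))%:C :> R[i] by rewrite ltcR divr_gt0.
move=> /(_ _ (nbhsx_ballx v _ eM)) [w [[n [c [u [Su wE]]]]]].
rewrite -ball_normE /= hnormE ltcR => vw.
have tw0 : t w = 0.
  rewrite wE (linear_op_sum tb.1) big1// => i _.
  by rewrite (linear_opZ tb.1) tS// scaler0.
have -> : t v = t (v - w).
  rewrite (linear_opD tb.1) -scaleN1r (linear_opZ tb.1) tw0 scaler0 addr0 //.
apply: (le_trans (opnormP tb _)).
apply: (@le_trans _ _ ((opnorm t + 1) * hnorm (v - w))).
  by rewrite ler_wpM2r ?hnorm_ge0// lerDl.
by rewrite mulrC -ler_pdivlMr// ltW.
Qed.

End OperatorTheory.

Record coarseModule (R : realType) (X : lfCoarseSpace) := CoarseModule {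
  cm_space :> hilbertType R;
  cm_proj : set X -> cm_space -> cm_space;
  cm_proj_projection : forall A, is_projection (cm_proj A);
  cm_projT : cm_proj setT = id;
  cm_projI : forall A B, cm_proj (A `&` B) = cm_proj A \o cm_proj B;
  cm_projC : forall A, cm_proj (~` A) = (fun v => v - cm_proj A v);
  cm_nondegenerate : exists2 E, coarse_gauge E &
    closure (lin_span [set v | exists2 A, E_bounded E A & range (cm_proj A) v])
      = setT }.

Arguments cm_proj {R X} c A v.

Definition faithful_module (R : realType) (X : lfCoarseSpace)
    (C : coarseModule R X) : Prop :=
  asymptotic [set x : X | cm_proj C [set x] <> (fun=> 0)] setT.

Definition op_support (R : realType) (X : lfCoarseSpace) (C D : coarseModule R X)
    (t : C -> D) : set (X * X) :=
  [set yx | cm_proj D [set yx.1] \o t \o cm_proj C [set yx.2] <> (fun=> 0)].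

Definition controlled_propagation (R : realType) (X : lfCoarseSpace)
    (C D : coarseModule R X) (t : C -> D) : Prop :=
  controlled (op_support t).

Definition approximable (R : realType) (X : lfCoarseSpace)
    (C D : coarseModule R X) (t : C -> D) : Prop :=
  bounded_op t /\
  forall e : R, 0 < e -> exists s : C -> D,
    [/\ bounded_op s, controlled_propagation s & opnorm (t \- s) < e].

(* The choice between A_kappa and A_infty; the infinite cardinal kappa is
   represented by an infinite type of that cardinality. *)
Inductive rankBound :=
  | RankLe (kappa : Type) of infinite_set [set: kappa]
  | RankAny.

(* The rank is the cardinality of any orthonormal basis. *)
Definition has_rank (R : realType) (k : rankBound) (H : hilbertType R) : Prop :=
  match k with
  | RankLe kappa _ =>
      exists B : set H, orthonormal_basis B /\ (B #<= [set: kappa])%card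
  | RankAny => True
  end.

Record moduleObj (R : realType) (k : rankBound) (X : lfCoarseSpace) := ModuleObj {
  obj_module :> coarseModule R X;
  obj_rank : has_rank k obj_module }.
Section ModuleTheory.
Context {R : realType} {X : lfCoarseSpace}.
Implicit Types C D E : coarseModule R X.

Lemma cm_proj_bounded C (A : set X) : bounded_op (cm_proj C A).
Proof. by have [] := cm_proj_projection C A. Qed.

Lemma cm_proj0 C : cm_proj C set0 = (fun=> 0).
Proof. by rewrite -setCT cm_projC cm_projT; apply/funext => v; rewrite subrr. Qed.

Lemma cm_projM C (A B : set X) v :
  cm_proj C A (cm_proj C B v) = cm_proj C (A `&` B) v.
Proof. by rewrite cm_projI. Qed.

Lemma cm_projCE C (A : set X) v : cm_proj C (~` A) v = v - cm_proj C A v.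
Proof. by rewrite cm_projC. Qed.

Lemma cm_projD1 C (A : set X) (a : X) v : A a ->
  cm_proj C A v = cm_proj C [set a] v + cm_proj C (A `\ a) v.
Proof.
move=> Aa; rewrite setDE setIC -cm_projM cm_projCE cm_projM.
have -> : [set a] `&` A = [set a] by apply/setIidPl => _ ->.
by rewrite addrC subrK.
Qed.

Lemma finite_proj_zero C (K : hilbertType R) (t : C -> K) (A : set X) :
  linear t -> finite_set A ->
  (forall a, A a -> forall v, t (cm_proj C [set a] v) = 0) ->
  forall v, t (cm_proj C A v) = 0.
Proof.
move=> lt /(@finite_seqP {classic X})[s As].
have {As} : A `<=` [set` s] by rewrite As.
elim: s A => [|a s IH] A As tA v.
  have -> : A = set0 by rewrite -subset0 => x /As.
  by rewrite cm_proj0 (linear_op0 lt).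
have [Aa|nAa] := pselect (A a).
  rewrite (cm_projD1 _ Aa) (linear_opD lt) tA// add0r; apply: IH.
    by move=> x [Ax xa]; have := As x Ax; rewrite /= inE => /orP[/eqP|].
  by move=> b [Ab _]; exact: tA.
apply: IH => // x Ax; have := As x Ax; rewrite /= inE => /orP[/eqP xa|//].
by rewrite xa in Ax.
Qed.

Lemma proj_pointwise_zero C (K : hilbertType R) (t : C -> K) (A : set X) :
  bounded_op t ->
  (forall a, A a -> forall v, t (cm_proj C [set a] v) = 0) ->
  forall v, t (cm_proj C A v) = 0.
Proof.
move=> tb tA.
have [E [cE _ _] dE] := cm_nondegenerate C.
apply: (lin_span_closed_zero (bounded_op_comp tb (cm_proj_bounded C A)) dE).
move=> _ [B EB [w _ <-]] /=.
rewrite cm_projM.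
apply: finite_proj_zero; first exact: tb.1.
  apply: sub_finite_set (@subIsetr _ A B) _.
  by apply: lf_spaceP; exists E.
by move=> a [Aa _]; exact: tA.
Qed.

Lemma proj_zero C (v : C) : (forall a : X, cm_proj C [set a] v = 0) -> v = 0.
Proof.
move=> av; have [E [cE _ _] dE] := cm_nondegenerate C.
have fin0 (B : set X) : finite_set B -> cm_proj C B v = 0.
  move=> /(@finite_seqP {classic X})[s Bs].
  have {Bs} : B `<=` [set` s] by rewrite Bs.
  elim: s B => [|a s IH] B Bs.
    have -> : B = set0 by rewrite -subset0 => x /Bs.
    by rewrite cm_proj0.
  have [Ba|nBa] := pselect (B a).
    rewrite (cm_projD1 _ Ba) av add0r; apply: IH => x [Bx xa].
    by have := Bs x Bx; rewrite /= inE => /orP[/eqP|].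
  apply: IH => // x Bx; have := Bs x Bx; rewrite /= inE => /orP[/eqP xa|//].
  by rewrite xa in Bx.
have span0 w : lin_span [set v | exists2 A, E_bounded E A & range (cm_proj C A) v] w ->
    inner C v w = 0.
  move=> [n [c [u [Su ->]]]]; rewrite linear_sumr big1// => i _.
  have [B EB [w' _ <-]] := Su i.
  have [_ _ adjB] := cm_proj_projection C B.
  rewrite linearZr_LR /= -adjB fin0 ?linear0l ?mulr0//.
  by apply: lf_spaceP; exists E.
apply: hnorm_eq0; apply/eqP; rewrite eq_le hnorm_ge0 andbT.
apply/ler_addgt0Pl => e e0; rewrite addr0.
have : closure (lin_span [set v | exists2 A, E_bounded E A &
    range (cm_proj C A) v]) v by rewrite dE.
have eM : 0 < e%:C :> R[i] by rewrite ltcR.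
move=> /(_ _ (nbhsx_ballx v _ eM)) [w [/span0 vw0]].
rewrite -ball_normE /= hnormE ltcR => vw; apply: le_trans (ltW vw).
suff : `|v| <= `|v - w| by rewrite !hnormE lecR.
rewrite -(@ler_pXn2r _ 2)// ?nnegrE// !innerE linearBl /= !linearBr /=.
have wv0 : inner C w v = 0.
  by rewrite hermC /= vw0 rmorph0 mulr0.
by rewrite vw0 wv0 subr0 sub0r opprK lerDl -innerE exprn_ge0.
Qed.

Lemma supportPn C D (t : C -> D) (y x : X) :
  ~ op_support t (y, x) <-> forall v, cm_proj D [set y] (t (cm_proj C [set x] v)) = 0.
Proof.
split=> [/contrapT|] e; last by apply; apply/funext.
by move=> v; move: e => /(congr1 (@^~ v)).
Qed.

Lemma support_comp C D E (s : D -> E) (t : C -> D) :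
  bounded_op s -> bounded_op t ->
  op_support (s \o t) `<=` (op_support t \; op_support s)%relation.
Proof.
move=> sb tb [z x]; apply: contraPP => nst; apply/supportPn => v /=.
set w := t (cm_proj C [set x] v).
pose Y0 := [set y | op_support s (z, y)].
have s'b : bounded_op (cm_proj E [set z] \o s).
  exact: bounded_op_comp (cm_proj_bounded _ _) sb.
have w0 : cm_proj D Y0 w = 0.
  apply: proj_zero => y; rewrite cm_projM.
  have [sy|nsy] := pselect (Y0 y).
    have -> : [set y] `&` Y0 = [set y] by apply/setIidPl => _ ->.
    by apply: (iffLR (supportPn t y x)) => ty; apply: nst; exists y.
  have -> : [set y] `&` Y0 = set0.
    by rewrite -subset0 => _ [-> ]; exact: nsy.
  by rewrite cm_proj0.
have -> : w = cm_proj D (~` Y0) w by rewrite cm_projCE w0 subr0.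
apply: (proj_pointwise_zero s'b) => y nsy u /=.
exact: (iffLR (supportPn s z y)).
Qed.

Lemma support_id C : op_support (@id C) `<=` [set xy | xy.1 = xy.2].
Proof.
move=> [y x]; apply: contraPP => /= yx; apply/supportPn => v /=.
rewrite cm_projM (_ : _ `&` _ = set0) ?cm_proj0//.
by rewrite -subset0 => _ [-> ].
Qed.

Lemma supportZD C D (a : R[i]) (s t : C -> D) :
  op_support (fun x => a *: s x + t x) `<=` op_support s `|` op_support t.
Proof.
move=> [y x]; apply: contraPP => /not_orP[/supportPn s0 /supportPn t0].
apply/supportPn => v /=; have lp := (cm_proj_bounded D [set y]).1.
by rewrite lp s0 t0 scaler0 addr0.
Qed.

Lemma approximable_id C : approximable (@id C).
Proof.
split=> [|e e0]; first exact: bounded_op_id.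
exists id; split; first exact: bounded_op_id.
  apply: (coarse_subset (controlledP X) (@support_id C)).
  exact: coarse_diagonal (controlledP X).
apply: le_lt_trans e0; apply: opnorm_le => // x.
by rewrite /= subrr hnorm0 mul0r.
Qed.

Lemma approximable0 C D : approximable (fun=> 0 : D) (C := C).
Proof.
split=> [|e e0]; first exact: bounded_op0.
exists (fun=> 0); split; first exact: bounded_op0.
  apply: (coarse_subset (controlledP X) _ (coarse_diagonal (controlledP X))).
  move=> [y x]; apply: contraPP => _; apply/supportPn => v /=.
  exact: (linear_op0 (cm_proj_bounded _ _).1).
apply: le_lt_trans e0; apply: opnorm_le => // x.
by rewrite /= subrr hnorm0 mul0r.
Qed.

Lemma approximableZD C D (a : R[i]) (s t : C -> D) :
  approximable s -> approximable t -> approximable (fun x => a *: s x + t x).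
Proof.
move=> [sb sa] [tb ta]; split=> [|e e0]; first exact: bounded_opZD.
have a0 : 0 < complex.Re `|a| + 1 by rewrite ltr_wpDl ?Re_norm_ge0.
have [|s' [s'b s'c s's]] := sa (e / 2 / (complex.Re `|a| + 1)).
  by rewrite !divr_gt0.
have [|t' [t'b t'c t't]] := ta (e / 2); first by rewrite divr_gt0.
exists (fun x => a *: s' x + t' x); split; first exact: bounded_opZD.
  apply: (coarse_subset (controlledP X) (@supportZD _ _ a s' t')).
  exact: (coarse_union (controlledP X)).
have sB := bounded_opB sb s'b; have tB := bounded_opB tb t'b.
apply: (@le_lt_trans _ _ (complex.Re `|a| * opnorm (s \- s') + opnorm (t \- t'))).
  apply: opnorm_le => [|x].
    by rewrite addr_ge0 ?mulr_ge0 ?opnorm_ge0 ?Re_norm_ge0.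
  rewrite /= opprD addrACA -scalerBr; apply: (le_trans (hnormD _ _)).
  rewrite hnormZ mulrDl -mulrA lerD ?(opnormP tB)// ler_wpM2l ?Re_norm_ge0//.
  exact: (opnormP sB).
rewrite [ltRHS](splitr e) ler_ltD//.
move: s's; rewrite ltr_pdivlMr// => /ltW; apply: le_trans.
by rewrite mulrC ler_wpM2l ?opnorm_ge0// lerDl.
Qed.

Lemma approximable_comp C D E (s : D -> E) (t : C -> D) :
  approximable s -> approximable t -> approximable (s \o t).
Proof.
move=> [sb sa] [tb ta]; split=> [|e e0]; first exact: bounded_op_comp.
have s0 : 0 < opnorm s + 1 by rewrite ltr_wpDl ?opnorm_ge0.
have [|t' [t'b t'c t't]] := ta (e / 2 / (opnorm s + 1)); first by rewrite !divr_gt0.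
have t0 : 0 < opnorm t' + 1 by rewrite ltr_wpDl ?opnorm_ge0.
have [|s' [s'b s'c s's]] := sa (e / 2 / (opnorm t' + 1)); first by rewrite !divr_gt0.
exists (s' \o t'); split; first exact: bounded_op_comp.
  apply: (coarse_subset (controlledP X) (support_comp s'b t'b)).
  exact: (coarse_compose (controlledP X) t'c s'c).
have sB := bounded_opB sb s'b; have tB := bounded_opB tb t'b.
apply: (@le_lt_trans _ _ (opnorm s * opnorm (t \- t') +
    opnorm (s \- s') * opnorm t')).
  apply: opnorm_le => [|x].
    by rewrite addr_ge0 ?mulr_ge0 ?opnorm_ge0.
  have -> : ((s \o t) \- (s' \o t')) x = s ((t \- t') x) + (s \- s') (t' x).
    rewrite /= addrA; congr (_ - _).
    by rewrite -(linear_opD sb.1) subrK.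
  apply: (le_trans (hnormD _ _)); rewrite mulrDl lerD//.
    apply: (le_trans (opnormP sb _)).
    by rewrite -mulrA ler_wpM2l ?opnorm_ge0// opnormP.
  apply: (le_trans (opnormP sB _)).
  by rewrite -mulrA ler_wpM2l ?opnorm_ge0// opnormP.
rewrite [ltRHS](splitr e) ler_ltD//.
  move: t't; rewrite ltr_pdivlMr// => /ltW; apply: le_trans.
  by rewrite mulrC ler_wpM2l ?opnorm_ge0// lerDl.
move: s's; rewrite ltr_pdivlMr//; apply: le_lt_trans.
by rewrite ler_wpM2l ?opnorm_ge0// lerDl.
Qed.

End ModuleTheory.

Section Morphisms.
Context {R : realType} {X : lfCoarseSpace}.

Definition approx_pred (C D : coarseModule R X) : {pred C -> D} :=
  fun t => `[< approximable t >].

Record approxOp (C D : coarseModule R X) := ApproxOp {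
  approx_fun :> C -> D;
  approx_funP : approx_fun \in @approx_pred C D }.

Lemma approx_pred_submod (C D : coarseModule R X) :
  GRing.submod_closed (@approx_pred C D).
Proof.
split=> [|a s t /asboolP sa /asboolP ta]; apply/asboolP.
  exact: approximable0.
exact: approximableZD.
Qed.

HB.instance Definition _ (C D : coarseModule R X) :=
  GRing.isSubmodClosed.Build R[i] (C -> D) (@approx_pred C D)
    (approx_pred_submod C D).

HB.instance Definition _ (C D : coarseModule R X) :=
  [isSub for @approx_fun C D].
HB.instance Definition _ (C D : coarseModule R X) :=
  [Choice of approxOp C D by <:].
HB.instance Definition _ (C D : coarseModule R X) :=
  [SubChoice_isSubLmodule of approxOp C D by <:].

Definition approx_id (C : coarseModule R X) : approxOp C C :=
  ApproxOp (introT (asboolP _) (approximable_id C)).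

Definition approx_comp (C D E : coarseModule R X)
    (s : approxOp D E) (t : approxOp C D) : approxOp C E :=
  ApproxOp (introT (asboolP _) (approximable_comp
    (elimT (asboolP _) (approx_funP s)) (elimT (asboolP _) (approx_funP t)))).

End Morphisms.

(* Preservation of adjoints is stated for pairs of mutually adjoint morphisms:
   the adjoint of an operator is unique, and that of an approximable operator is
   approximable. *)
Record starFunctor (R : realType) (k : rankBound) (X Y : lfCoarseSpace) :=
  StarFunctor {
  functor_obj : moduleObj R k X -> moduleObj R k Y;
  functor_mor : forall C D : moduleObj R k X,
    {linear approxOp C D -> approxOp (functor_obj C) (functor_obj D)};
  functor_id : forall C, functor_mor C C (approx_id C) = approx_id (functor_obj C);
  functor_comp : forall (C D E : moduleObj R k X)
      (s : approxOp D E) (t : approxOp C D),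
    functor_mor C E (approx_comp s t) = approx_comp (functor_mor D E s) (functor_mor C D t);
  functor_adj : forall (C D : moduleObj R k X)
      (t : approxOp C D) (s : approxOp D C),
    adjoint_pair t s -> adjoint_pair (functor_mor C D t) (functor_mor D C s) }.

Definition functor_full (R : realType) (k : rankBound) (X Y : lfCoarseSpace)
    (F : starFunctor R k X Y) : Prop :=
  forall (C D : moduleObj R k X) (s : approxOp (functor_obj F C) (functor_obj F D)),
    exists t : approxOp C D, functor_mor F C D t = s.

Definition functor_faithful (R : realType) (k : rankBound) (X Y : lfCoarseSpace)
    (F : starFunctor R k X Y) : Prop :=
  forall C D : moduleObj R k X, injective (functor_mor F C D).

Record is_star_isomorphism (R : realType) (X Y : lfCoarseSpace)
    (C : coarseModule R X) (D : coarseModule R Y)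
    (phi : approxOp C C -> approxOp D D) : Prop := {
  star_iso_bijective : bijective phi;
  star_iso_linear : linear phi;
  star_iso_mul : forall s t, phi (approx_comp s t) = approx_comp (phi s) (phi t);
  star_iso_adj : forall s t : approxOp C C,
    adjoint_pair s t -> adjoint_pair (phi s) (phi t) }.

Definition end_cast (R : realType) (k : rankBound) (X : lfCoarseSpace)
    (C D : moduleObj R k X) (e : C = D) : approxOp C C -> approxOp D D :=
  match e in _ = D' return approxOp C C -> approxOp D' D' with
  | erefl => id
  end.

Definition approx_relation (R : realType) (X Y : lfCoarseSpace)
    (C : coarseModule R X) (D : coarseModule R Y) (U : C -> D)
    (delta : R) (E' : set (Y * Y)) (E : set (X * X)) : set (Y * X) :=
  [set yx | exists B A, [/\ E_bounded E' B, E_bounded E A,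
      delta < opnorm (cm_proj D B \o U \o cm_proj C A) & (B `*` A) yx]].

Definition fun_graph (X Y : Type) (f : X -> Y) : set (Y * X) :=
  [set yx | yx.1 = f yx.2].

(* [f] is a representative of the class of coarse equivalences induced by
   [phi]. That class does not depend on U, delta, E' and E, so that
   one choice of them suffices. *)
Definition induces (R : realType) (X Y : lfCoarseSpace)
    (C : coarseModule R X) (D : coarseModule R Y)
    (phi : approxOp C C -> approxOp D D) (f : X -> Y) : Prop :=
  coarse_equivalence f /\
  exists (U : C -> D) (V : D -> C),
    [/\ unitary_pair U V,
        forall t, phi t = U \o t \o V :> (D -> D)
      & exists (delta : R) (E' : set (Y * Y)) (E : set (X * X)),
        [/\ 0 < delta < 1, controlled E', controlled E
          & @asymptotic (product_coarse Y X)
              (approx_relation U delta E' E) (fun_graph f)]].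

(* Main.v *)
(** A *-isomorphism between algebras of approximable operators is spatial, and conjugation by
    the unitary [U] concentrates the image of each fibre near a single point, uniformly, which
    gives the coarse map. The uniformity comes from a Baire category argument: a bounded family
    [T A] of approximable operators, indexed by all subsets [A] of a set and additive and weakly
    continuous in [A], is approximable with propagation independent of [A].

    For (1) => (2), let [f] be one of the coarse equivalences. A unitary [U : C -> D] that moves
    the fibre over [x] close to [f x] is itself approximable as an operator from the pushforward
    of [C] along [f] to [D]. Sending every module outside the family to its pushforward, and
    conjugating morphisms by these unitaries, yields the functor.

    For (2) => (1), let [U], [U'] implement [F] on the endomorphisms of [A], [B]. The image under
    [F] of a rank one operator [u |-> <u, v> w] is, up to a phase, [u |-> <u, U v> (U' w)]. If the
    coarse maps of [A] and [B] were not close, a sequence of unit vectors [v n], [w n] over nearby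
    points with far apart images would assemble into one operator of controlled propagation whose
    image under [F] is not approximable. *)

From HB Require Import structures.
Require Import Defs.
From mathcomp Require Import all_boot all_order all_algebra.
From mathcomp Require Import complex.
From mathcomp Require Import all_classical all_reals all_analysis.
From mathcomp Require Import ring lra.

Set Implicit Arguments.
Unset Strict Implicit.
Unset Printing Implicit Defensive.

Import Order.TTheory GRing.Theory Num.Theory.
Import numFieldNormedType.Exports.
Import Defs.

Local Open Scope classical_set_scope.
Local Open Scope ring_scope.
Local Open Scope complex_scope.

(** * Real inner products, Riesz representation and adjoints *)

Section Hilbert.
Context {R : realType}.
Implicit Types H K L : hilbertType R.

(** The obstacle is that approximability gives every operator its own entourage. Families indexed by
    all subsets escape this because the subsets form a compact space. Two such families are used:
    conjugated projections, and partial sums of rank one operators along orthonormal sequences.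
    Infinite sums are weak limits along ultrafilters; having support in a fixed entourage, and being
    within a fixed norm distance of such operators, survives weak limits. Geometry is read off from
    rank one operators: if the one given by [p] and [q] is within [e] of support in [E], the norms
    of [p] and [q] on [E]-separated sets have product at most [e]. For the functor, localisation of
    [U] fibre by fibre does not control the infinite sum over fibres. Averaging over random signs
    rewrites that sum through conjugated projections of whole sets, for which uniformity is known.
    The spaces may be coarsely disconnected: a single pair of points need not be an entourage. This
    is why base points are chosen per component and why finite exceptional sets of pairs need an
    argument. *)

Definition rin H (x y : H) : R := complex.Re (inner H x y).

Lemma rinC H (x y : H) : rin x y = rin y x.
Proof.
by rewrite /rin (hermC (inner H) x y) /= expr0 mul1r; case: (inner H y x).
Qed.

Lemma rinDl H (x y z : H) : rin (x + y) z = rin x z + rin y z.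
Proof. by rewrite /rin linearDl raddfD. Qed.

Lemma rinDr H (x y z : H) : rin x (y + z) = rin x y + rin x z.
Proof. by rewrite /rin linearDr raddfD. Qed.

Lemma rinNl H (x y : H) : rin (- x) y = - rin x y.
Proof. by rewrite /rin linearNl raddfN. Qed.

Lemma rinNr H (x y : H) : rin x (- y) = - rin x y.
Proof. by rewrite /rin linearNr raddfN. Qed.

Lemma rinBl H (x y z : H) : rin (x - y) z = rin x z - rin y z.
Proof. by rewrite rinDl rinNl. Qed.

Lemma rinBr H (x y z : H) : rin x (y - z) = rin x y - rin x z.
Proof. by rewrite rinDr rinNr. Qed.

Lemma rin0l H (x : H) : rin 0 x = 0.
Proof. by rewrite /rin linear0l. Qed.

Lemma rin0r H (x : H) : rin x 0 = 0.
Proof. by rewrite rinC rin0l. Qed.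

Lemma innerZl H (a : R[i]) (x y : H) : inner H (a *: x) y = a * inner H x y.
Proof. exact: linearZl_LR. Qed.

Lemma innerZr H (a : R[i]) (x y : H) : inner H x (a *: y) = Num.conj a * inner H x y.
Proof. exact: linearZr_LR. Qed.

Lemma innerDl H (x y z : H) : inner H (x + y) z = inner H x z + inner H y z.
Proof. exact: linearDl. Qed.

Lemma innerBl H (x y z : H) : inner H (x - y) z = inner H x z - inner H y z.
Proof. exact: linearBl. Qed.

Lemma inner_suml H n (x : 'I_n -> H) (z : H) :
  inner H (\sum_i x i) z = \sum_i inner H (x i) z.
Proof. exact: linear_sumlz. Qed.

Lemma innerC H (x y : H) : inner H y x = Num.conj (inner H x y).
Proof. by rewrite (hermC (inner H) y x) /= expr0 mul1r. Qed.

Lemma rinZ_adj H (a : R[i]) (x y : H) : rin (a *: x) y = rin x (Num.conj a *: y).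
Proof. by rewrite /rin innerZl innerZr conjCK. Qed.

Lemma rinZl H (r : R) (x y : H) : rin (r%:C *: x) y = r * rin x y.
Proof. by rewrite /rin innerZl; case: (inner H x y) => a b /=; rewrite mul0r subr0. Qed.

Lemma rinZr H (r : R) (x y : H) : rin x (r%:C *: y) = r * rin x y.
Proof. by rewrite rinC rinZl rinC. Qed.

(** Order estimates and limits are carried out for the real form; testing it on complex multiples of
    [x] recovers the complex form. *)
Lemma inner_rin H (x y : H) : inner H x y = rin x y +i* rin ((- 'i) *: x) y.
Proof.
rewrite /rin innerZl; case: (inner H x y) => a b /=.
by congr (_ +i* _); rewrite oppr0 mul0r mulN1r opprK add0r.
Qed.

Lemma hnorm_sq H (x : H) : hnorm x ^+ 2 = rin x x.
Proof. by rewrite /rin -innerE hnormE -rmorphXn. Qed.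

Lemma hnormN H (x : H) : hnorm (- x) = hnorm x.
Proof. by rewrite /hnorm normrN. Qed.

Lemma hnormBC H (x y : H) : hnorm (x - y) = hnorm (y - x).
Proof. by rewrite -hnormN opprB. Qed.

Lemma hnormB H (x y : H) : hnorm (x - y) <= hnorm x + hnorm y.
Proof. by rewrite -(hnormN y); exact: hnormD. Qed.

Lemma hnorm_leB H (x y : H) : hnorm x <= hnorm y + hnorm (x - y).
Proof. by apply: le_trans (hnormD _ _); rewrite addrC subrK. Qed.

Lemma hnormZr H (r : R) (x : H) : hnorm (r%:C *: x) = `|r| * hnorm x.
Proof. by rewrite hnormZ normc_def /= expr0n addr0 sqrtr_sqr. Qed.

Lemma hnormD_sq H (x y : H) :
  hnorm (x + y) ^+ 2 = hnorm x ^+ 2 + 2 * rin x y + hnorm y ^+ 2.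
Proof. by rewrite !hnorm_sq !(rinDl, rinDr) (rinC y x); lra. Qed.

Lemma hnormB_sq H (x y : H) :
  hnorm (x - y) ^+ 2 = hnorm x ^+ 2 - 2 * rin x y + hnorm y ^+ 2.
Proof. by rewrite hnormD_sq hnormN rinNr; lra. Qed.

Lemma ler_hnorm_sq H K (x : H) (y : K) :
  (hnorm x <= hnorm y) = (hnorm x ^+ 2 <= hnorm y ^+ 2).
Proof. by rewrite ler_pXn2r// nnegrE hnorm_ge0. Qed.

Lemma rin_le H (x y : H) : rin x y <= hnorm x * hnorm y.
Proof.
have [x0|x0] := eqVneq (hnorm x) 0.
  by rewrite (hnorm_eq0 x0) rin0l hnorm0 mul0r.
have [y0|y0] := eqVneq (hnorm y) 0.
  by rewrite (hnorm_eq0 y0) rin0r hnorm0 mulr0.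
have xp : 0 < hnorm x by rewrite lt_def x0 hnorm_ge0.
have yp : 0 < hnorm y by rewrite lt_def y0 hnorm_ge0.
have := sqr_ge0 (hnorm ((hnorm y)%:C *: x - (hnorm x)%:C *: y)).
rewrite hnormB_sq !hnormZr rinZl rinZr !ger0_norm ?hnorm_ge0// => h.
have xy : 0 < hnorm x * hnorm y by rewrite mulr_gt0.
rewrite -(ler_pM2l xy); nra.
Qed.

Lemma rin_norm_le H (x y : H) : `|rin x y| <= hnorm x * hnorm y.
Proof.
rewrite ler_norml rin_le andbT lerNl -rinNl.
by rewrite -(hnormN x); exact: rin_le.
Qed.

Definition cabs (a : R[i]) : R := complex.Re `|a|.

Lemma cabsE (a : R[i]) : `|a| = (cabs a)%:C.
Proof. by rewrite /cabs normc_def. Qed.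

Lemma cabs_ge0 a : 0 <= cabs a. Proof. exact: Re_norm_ge0. Qed.

Lemma cabs_sq a : (cabs a ^+ 2)%:C = a * Num.conj a.
Proof. by rewrite rmorphXn /= -cabsE normCK. Qed.

Lemma conj_real (r : R) : Num.conj (r%:C : R[i]) = r%:C.
Proof. by change (conjc (r%:C : R[i]) = r%:C); rewrite /= oppr0. Qed.

Lemma cabs0 : cabs 0 = 0. Proof. by rewrite /cabs normr0. Qed.
Lemma inner_cabs_le H (x y : H) : cabs (inner H x y) <= hnorm x * hnorm y.
Proof.
set z := inner H x y.
have [->|z0] := eqVneq (cabs z) 0; first by rewrite mulr_ge0 ?hnorm_ge0.
have zp : 0 < cabs z by rewrite lt_def z0 cabs_ge0.
rewrite -(ler_pM2l zp) -expr2.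
have -> : cabs z ^+ 2 = rin x (z *: y).
  by rewrite /rin innerZr mulrC -cabs_sq.
by apply: (le_trans (rin_le _ _)); rewrite hnormZ -/(cabs z) mulrCA.
Qed.

Lemma rin_ext H (x y : H) : (forall z, rin x z = rin y z) -> x = y.
Proof.
move=> xy; apply/eqP; rewrite -subr_eq0; apply/eqP/hnorm_eq0/eqP.
by rewrite -sqrf_eq0 hnorm_sq rinBl xy subrr.
Qed.

Lemma rin_inner H K (x y : H) (z w : K) :
  (forall a : R[i], rin (a *: x) y = rin (a *: z) w) -> inner H x y = inner K z w.
Proof.
by move=> e; rewrite !inner_rin; have := e 1; have := e (- 'i); rewrite !scale1r => -> ->.
Qed.

Lemma hcauchy_cvg H (u : nat -> H) :
  (forall e : R, 0 < e -> exists N, forall m n, (N <= m)%N -> (N <= n)%N ->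
     hnorm (u m - u n) <= e) ->
  exists z, forall e : R, 0 < e -> exists N, forall n, (N <= n)%N ->
    hnorm (z - u n) <= e.
Proof.
move=> uC; have : cauchy (u @ \oo).
  apply/cauchy_ballP => e e0.
  have eE : e = (complex.Re e)%:C.
    by move: e0; case: e => a b; rewrite ltcE /= => /andP[/eqP -> _].
  have e'0 : 0 < complex.Re e by move: e0; rewrite eE ltcR.
  have [|N uN] := uC (complex.Re e / 2); first by rewrite divr_gt0.
  exists (u @` [set n | (N <= n)%N], u @` [set n | (N <= n)%N]).
    by split; exists N => // n /= Nn; exists n.
  move=> [_ _] [[m /= Nm <-] [n /= Nn <-]] /=.
  rewrite -ball_normE /= hnormE eE ltcR (le_lt_trans (uN m n Nm Nn))//.
  by rewrite ltr_pdivrMr// ltr_pMr// ltr1n.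
move=> /cauchy_cvgP uc; exists (lim (u @ \oo)) => e e0.
have eC : 0 < e%:C :> R[i] by rewrite ltcR.
have /cvgrPdist_lt /(_ _ eC) [N _ uN] := uc.
by exists N => n Nn; have := uN n Nn; rewrite /= hnormE ltcR => /ltW.
Qed.

Lemma hnorm_parallelogram H (x y : H) :
  hnorm (x - y) ^+ 2 = 2 * hnorm x ^+ 2 + 2 * hnorm y ^+ 2 - hnorm (x + y) ^+ 2.
Proof. by rewrite hnormB_sq hnormD_sq; lra. Qed.

Lemma ler_small (x y : R) : (forall e : R, 0 < e -> x <= y + e) -> x <= y.
Proof. by move=> xy; apply/ler_addgt0Pr. Qed.

(* The representing vector minimises [|w|^2 - 2 l w]. *)
Lemma riesz_representation H (l : H -> R) (M : R) :
  (forall x y, l (x + y) = l x + l y) ->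
  (forall (r : R) x, l (r%:C *: x) = r * l x) ->
  (forall x, `|l x| <= M * hnorm x) ->
  exists z, forall w, rin z w = l w.
Proof.
move=> lD lZ lM.
pose J w := hnorm w ^+ 2 - 2 * l w.
have Jlb w : - M ^+ 2 <= J w.
  have := lM w; rewrite ler_norml => /andP[_ h].
  have := sqr_ge0 (hnorm w - M); rewrite /J; nra.
pose S := range J.
have infS : has_inf S.
  split; first by exists (J 0), 0.
  by exists (- M ^+ 2) => _ [w _ <-].
pose m := inf S.
have mJ w : m <= J w by apply: ge_inf; [exact: infS.2|exists w].
have near_m (n : nat) : exists w, J w <= m + n.+1%:R^-1.
  have n0 : 0 < n.+1%:R^-1 :> R by rewrite invr_gt0 ltr0n.
  have [_ [w _ <-] /ltW wm] := inf_adherent n0 infS.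
  by exists w.
have [u um] := choice near_m.
(* Parallelogram law: near minimisers are close, since their midpoint cannot fall below [m]. *)
have dist a b (e : R) : J a <= m + e -> J b <= m + e -> hnorm (a - b) ^+ 2 <= 4 * e.
  move=> ae be; rewrite hnorm_parallelogram.
  have := mJ ((2^-1)%:C *: (a + b)).
  move: ae be; rewrite /J hnormZr exprMn real_normK ?num_real// lZ lD => ae be.
  by rewrite -subr_ge0 => h; nra.
have [|z uz] := @hcauchy_cvg H u.
  move=> e e0; have ee : 0 < e ^+ 2 / 4 by rewrite divr_gt0// exprn_gt0.
  pose N := (Num.truncn (e ^+ 2 / 4)^-1).+1.
  have hN k : (N <= k)%N -> k.+1%:R^-1 <= e ^+ 2 / 4 :> R.
    move=> Nk; rewrite -[leRHS]invrK lef_pV2 ?posrE ?ltr0n ?invr_gt0//.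
    apply: (@le_trans _ _ N%:R); last by rewrite ler_nat (leq_trans Nk).
    exact/ltW/truncnS_gt.
  exists N => i j Ni Nj; rewrite -(@ler_pXn2r _ 2) ?nnegrE ?hnorm_ge0 ?(ltW e0)//.
  have -> : e ^+ 2 = 4 * (e ^+ 2 / 4) by rewrite mulrC divfK.
  by apply: dist; apply: (le_trans (um _)); rewrite lerD2l; exact: hN.
exists z => w.
(* Minimality of [z] against [z + t w]. A quadratic in [t] that is nonnegative everywhere and
   vanishes at 0 has no linear term. *)
have key (t : R) : 0 <= t ^+ 2 * hnorm w ^+ 2 + 2 * (t * (rin z w - l w)).
  apply: ler_small => e e0; set q := _ + 2 * _.
  have Jz : J z <= m + e.
    pose B := 2 * hnorm z + 2 * `|M| + 1.
    have B0 : 0 < B by rewrite /B ltr_wpDl// addr_ge0// mulr_ge0// hnorm_ge0.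
    pose d := Num.min 1 (e / 2 / B).
    have d0 : 0 < d by rewrite lt_min ltr01 !divr_gt0.
    have [N1 hN1] := uz d d0.
    pose N := maxn N1 (Num.truncn (e / 2)^-1).+1.
    have [d1 d2] : d <= 1 /\ d * B <= e / 2.
      by split; [rewrite ge_min lexx | rewrite -ler_pdivlMr// ge_min lexx orbT].
    have zu := hN1 N (leq_maxl _ _).
    have uN := um N.
    have iN : N.+1%:R^-1 <= e / 2.
      rewrite -[leRHS]invrK lef_pV2 ?posrE ?ltr0n ?invr_gt0 ?divr_gt0//.
      apply: (@le_trans _ _ (Num.truncn (e / 2)^-1).+1%:R).
        exact/ltW/truncnS_gt.
      by rewrite ler_nat (leq_trans (leq_maxr N1 _)).
    have lzu : `|l (z - u N)| <= `|M| * d.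
      apply: (le_trans (lM _)); apply: (@le_trans _ _ (`|M| * hnorm (z - u N))).
        by rewrite ler_wpM2r ?hnorm_ge0 ?ler_norm.
      by rewrite ler_wpM2l.
    have ll : l z = l (u N) + l (z - u N) by rewrite -lD addrC subrK.
    have hzu : hnorm z ^+ 2 = hnorm (u N) ^+ 2 + 2 * rin z (z - u N) - hnorm (z - u N) ^+ 2.
      by rewrite hnormB_sq rinBr -hnorm_sq; lra.
    have rzu : rin z (z - u N) <= hnorm z * d.
      by apply: (le_trans (rin_le _ _)); rewrite ler_wpM2l// hnorm_ge0.
    have := sqr_ge0 (hnorm (z - u N)).
    move: lzu; rewrite ler_norml => /andP[lzu _].
    move: d2 uN lzu rzu iN; rewrite /J /B ll hzu !mulrDr mulr1 !(mulrCA d).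
    rewrite (mulrC (hnorm z)) (mulrC `|M|); move: d0; clearbody m d.
    move: (d * hnorm z) (d * `|M|) (hnorm (u N) ^+ 2) (l (u N)) (N.+1%:R^-1)
      (l (z - u N)) (rin z (z - u N)) (hnorm (z - u N) ^+ 2).
    by clear => *; lra.
  have := mJ (z + t%:C *: w); move: Jz.
  rewrite /J hnormD_sq hnormZr exprMn real_normK ?num_real// rinZr lD lZ /q; lra.
pose h := rin z w - l w; apply/eqP; rewrite -subr_eq0 -/h.
have [w0|w0] := eqVneq (hnorm w) 0.
  have := key 1; have := key (-1); rewrite w0 -/h => a b.
  by rewrite eq_le; apply/andP; split; lra.
have w2 : 0 < hnorm w ^+ 2 by rewrite exprn_gt0// lt_def w0 hnorm_ge0.
(* The minimiser of the quadratic in [key]. *)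
have := key (- h / hnorm w ^+ 2); rewrite -/h.
have -> : (- h / hnorm w ^+ 2) ^+ 2 * hnorm w ^+ 2 + 2 * (- h / hnorm w ^+ 2 * h)
   = - (h ^+ 2 / hnorm w ^+ 2).
  by field.
rewrite oppr_ge0 pmulr_lle0 ?invr_gt0// => h2.
by rewrite -sqrf_eq0 eq_le h2 sqr_ge0.
Qed.

Lemma bounded_opZ H K (t : H -> K) : bounded_op t -> forall a x, t (a *: x) = a *: t x.
Proof. by move=> tb; exact: linear_opZ tb.1. Qed.

Lemma bounded_opN H K (t : H -> K) : bounded_op t -> forall x, t (- x) = - t x.
Proof. by move=> tb x; rewrite -scaleN1r (bounded_opZ tb) scaleN1r. Qed.

Lemma bounded_opBE H K (t : H -> K) : bounded_op t -> forall x y, t (x - y) = t x - t y.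
Proof. by move=> tb x y; rewrite (linear_opD tb.1) (bounded_opN tb). Qed.

(** Riesz represents each [B x]. Moving complex scalars across [B] with a conjugate is what makes
    the representing vector complex linear in [x]. The one-sided bound is enough because [y] may be
    replaced by [- y]. *)
Lemma sesquilinear_op H K (B : H -> K -> R) (M : R) : 0 <= M ->
  (forall x y z, B (x + y) z = B x z + B y z) ->
  (forall x y z, B x (y + z) = B x y + B x z) ->
  (forall a x y, B (a *: x) y = B x (Num.conj a *: y)) ->
  (forall (r : R) x y, B x (r%:C *: y) = r * B x y) ->
  (forall x y, B x y <= M * hnorm x * hnorm y) ->
  exists t : H -> K, [/\ bounded_op t, forall x, hnorm (t x) <= M * hnorm x
    & forall x y, rin (t x) y = B x y].
Proof.
move=> M0 BDl BDr Badj BZ BM.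
have BN x y : B x (- y) = - B x y.
  have -> : - y = (-1)%:C *: y by rewrite rmorphN1 scaleN1r.
  by rewrite BZ mulN1r.
have /choice [t tB] : forall x, exists z, forall w, rin z w = B x w.
  move=> x; apply: (@riesz_representation K (B x) (M * hnorm x)) => // y.
  by rewrite ler_norml BM andbT lerNl -BN -(hnormN y).
have tM x : hnorm (t x) <= M * hnorm x.
  have [tx0|tx0] := eqVneq (hnorm (t x)) 0.
    by rewrite tx0 mulr_ge0 ?hnorm_ge0.
  rewrite -(@ler_pM2r _ (hnorm (t x))) ?lt_def ?tx0 ?hnorm_ge0//.
  by rewrite -expr2 hnorm_sq tB.
exists t; split => //; split; last by exists M.
move=> a x y; apply: rin_ext => z.
by rewrite tB BDl Badj rinDl rinZ_adj !tB.
Qed.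

Lemma adjoint_rin H K (t : H -> K) (s : K -> H) : bounded_op t ->
  (forall x y, rin (t x) y = rin x (s y)) -> adjoint_pair t s.
Proof.
by move=> tb ts x y; apply: rin_inner => a; rewrite -(bounded_opZ tb) ts.
Qed.

(** The last clause lets every bound for [t], not only [opnorm t], pass to the adjoint;
    approximation errors are transported this way. *)
Lemma adjoint_exists H K (t : H -> K) : bounded_op t ->
  exists s : K -> H, [/\ bounded_op s, adjoint_pair t s
    & forall M, 0 <= M -> (forall x, hnorm (t x) <= M * hnorm x) ->
        forall y, hnorm (s y) <= M * hnorm y].
Proof.
move=> tb; have [s [sb _ ts]] := @sesquilinear_op K H (fun y x => rin (t x) y) (opnorm t)
  (opnorm_ge0 tb)
  (fun _ _ _ => rinDr _ _ _)
  (fun y z w => etrans (congr1 (fun v => rin v y) (linear_opD tb.1 z w)) (rinDl _ _ _))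
  (fun a y x => etrans (etrans (rinC _ _) (etrans (rinZ_adj _ _ _) (rinC _ _)))
     (esym (congr1 (fun v => rin v y) (bounded_opZ tb _ _))))
  (fun r y x => etrans (congr1 (fun v => rin v y) (bounded_opZ tb _ _)) (rinZl _ _ _))
  (fun y x => le_trans (rin_le _ _)
     (le_trans (ler_wpM2r (hnorm_ge0 y) (opnormP tb x))
       (eq_ind_r (fun v => v <= _) (lexx _) (mulrAC _ _ _)))).
exists s; split => //; first by apply: adjoint_rin => // x y; rewrite -ts rinC.
move=> M M0 tM y.
have [sy0|sy0] := eqVneq (hnorm (s y)) 0.
  by rewrite sy0 mulr_ge0 ?hnorm_ge0.
rewrite -(@ler_pM2r _ (hnorm (s y))) ?lt_def ?sy0 ?hnorm_ge0//.
rewrite -expr2 hnorm_sq ts; apply: (le_trans (rin_le _ _)).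
by rewrite mulrAC ler_wpM2r ?hnorm_ge0.
Qed.

Lemma adjoint_rinE H K (t : H -> K) (s : K -> H) : adjoint_pair t s ->
  forall x y, rin (t x) y = rin x (s y).
Proof. by move=> ts x y; rewrite /rin ts. Qed.

Lemma adjoint_sym H K (t : H -> K) (s : K -> H) : adjoint_pair t s -> adjoint_pair s t.
Proof. by move=> ts x y; rewrite innerC -ts -innerC. Qed.

Lemma adjoint_unique H K (t : H -> K) (s s' : K -> H) :
  adjoint_pair t s -> adjoint_pair t s' -> s = s'.
Proof.
move=> ts ts'; apply/funext => y; apply: rin_ext => z.
by rewrite rinC -(adjoint_rinE ts) rinC -(rinC z) -(adjoint_rinE ts') rinC.
Qed.

Lemma adjoint_comp H K L (t : H -> K) (t' : K -> H) (s : K -> L) (s' : L -> K) :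
  adjoint_pair t t' -> adjoint_pair s s' -> adjoint_pair (s \o t) (t' \o s').
Proof. by move=> tt' ss' x y /=; rewrite ss' tt'. Qed.

End Hilbert.

(** * Weak limits along ultrafilters *)

Section WeakLimits.
Context {R : realType}.
Implicit Types H K L : hilbertType R.

Lemma ultra_cvg (T : Type) (G : set_system T) (f : T -> R) (M : R) :
  UltraFilter G -> (forall k, `|f k| <= M) -> exists l : R, f @ G --> l.
Proof.
move=> GU fM.
have [|l [_ fl]] := @segment_compact R (- M) M (f @ G) _.
  apply: (@filterS _ G _ setT _ _ filterT) => k _ /=.
  by rewrite in_itv /= -ler_norml.
exists l => A /= lA; have [//|nA] := in_ultra_setVsetC (f @^-1` A) GU.
have [x [/= nAx Ax]] := fl (~` A) A nA lA.
by [].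
Qed.

Lemma cvg_le (T : Type) (G : set_system T) (f : T -> R) (l c : R) :
  ProperFilter G -> f @ G --> l -> (forall k, f k <= c) -> l <= c.
Proof.
move=> GP fl fc; rewrite leNgt; apply/negP => cl.
have lc : 0 < l - c by rewrite subr_gt0.
move/cvgrPdist_lt: fl => /(_ _ lc) /filter_ex [k /= lk].
have := fc k; have := ler_norm (l - f k); move: lk.
by clear => *; lra.
Qed.

(** Bounded real numbers always converge along an ultrafilter, so the forms of the [s k] have a
    limit form, and [sesquilinear_op] turns it into an operator. No convergence of the family has to
    be proved. *)
Lemma weak_limit (T : Type) (G : set_system T) H K (s : T -> H -> K) (M : R) :
  UltraFilter G -> 0 <= M -> (forall k, linear (s k)) ->
  (forall k x, hnorm (s k x) <= M * hnorm x) ->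
  exists t : H -> K, [/\ bounded_op t, forall x, hnorm (t x) <= M * hnorm x
    & forall x y, (fun k => rin (s k x) y) @ G --> rin (t x) y].
Proof.
move=> GU M0 sl sM.
have bnd x y k : `|rin (s k x) y| <= M * hnorm x * hnorm y.
  by apply: (le_trans (rin_norm_le _ _)); rewrite ler_wpM2r ?hnorm_ge0.
have /choice [B0 BP] : forall xy : H * K, exists l : R,
    (fun k => rin (s k xy.1) xy.2) @ G --> l.
  by move=> [x y]; exact: (ultra_cvg _ (bnd x y)).
pose B x y := B0 (x, y).
have {BP} BP x y : (fun k => rin (s k x) y) @ G --> B x y by exact: (BP (x, y)).
have uniq (f : T -> R) (a b : R) : f @ G --> a -> f @ G --> b -> a = b.
  by move=> fa fb; exact: (@cvg_unique _ (@Rhausdorff R) (f @ G) _ _ _ fa fb).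
have [] := @sesquilinear_op R H K B M M0.
- move=> x y z; apply: uniq (cvgD (BP x z) (BP y z)).
  apply: cvg_trans (BP (x + y) z); apply: near_eq_cvg.
  by apply: filterE => k; rewrite (linear_opD (sl k)) rinDl.
- move=> x y z; apply: uniq (cvgD (BP x y) (BP x z)).
  apply: cvg_trans (BP x (y + z)); apply: near_eq_cvg.
  by apply: filterE => k; rewrite rinDr.
- move=> a x y; apply: uniq (BP (a *: x) y) _.
  apply: cvg_trans (BP x (Num.conj a *: y)); apply: near_eq_cvg.
  by apply: filterE => k /=; rewrite (linear_opZ (sl k)) rinZ_adj.
- move=> r x y; apply: uniq (BP x (r%:C *: y)) _.
  apply: cvg_trans (cvgM (cvg_cst r) (BP x y)); apply: near_eq_cvg.
  by apply: filterE => k /=; rewrite rinZr.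
- by move=> x y; apply: (cvg_le _ (BP x y)) => k; rewrite (le_trans (ler_norm _)).
by move=> t [tb tM tB]; exists t; split => // x y; rewrite tB.
Qed.

Lemma hnorm_le_rin H (x : H) (M : R) : 0 <= M ->
  (forall y, rin x y <= M * hnorm y) -> hnorm x <= M.
Proof.
move=> M0 xM; have [->//|x0] := eqVneq (hnorm x) 0.
by rewrite -(@ler_pM2r _ (hnorm x)) ?lt_def ?x0 ?hnorm_ge0// -expr2 hnorm_sq.
Qed.

End WeakLimits.

(** * Approximation with explicit error and entourage *)

Section Approximation.
Context {R : realType} {X : lfCoarseSpace}.
Implicit Types C D : coarseModule R X.

(** Error and entourage are both exposed, so that one entourage can be demanded for a whole family.
    The error is stated pointwise to avoid suprema. *)
Definition approx_at C D (t : C -> D) (e : R) (E : set (X * X)) : Prop :=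
  exists s : C -> D, [/\ bounded_op s, op_support s `<=` E
    & forall v, hnorm (t v - s v) <= e * hnorm v].

Lemma approximableP C D (t : C -> D) : approximable t <->
  bounded_op t /\ forall e, 0 < e -> exists2 E, controlled E & approx_at t e E.
Proof.
split=> [[tb ta]|[tb ta]]; split => // e e0.
  have [s [sb sc se]] := ta e e0.
  exists (op_support s) => //; exists s; split => // v.
  apply: (le_trans (opnormP (bounded_opB tb sb) v)).
  by rewrite ler_wpM2r ?hnorm_ge0 ?ltW.
have [|E Ec [s [sb sE se]]] := ta (e / 2); first by rewrite divr_gt0.
exists s; split => //; first exact: (coarse_subset (controlledP X) sE Ec).
apply: (@le_lt_trans _ _ (e / 2)).
  by apply: opnorm_le; rewrite ?divr_ge0 ?(ltW e0).
by rewrite ltr_pdivrMr// ltr_pMr// ltr1n.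
Qed.

Lemma approx_atS C D (t : C -> D) e e' (E E' : set (X * X)) :
  e <= e' -> E `<=` E' -> approx_at t e E -> approx_at t e' E'.
Proof.
move=> ee EE [s [sb sE se]]; exists s; split => //; first exact: subset_trans EE.
by move=> v; apply: (le_trans (se v)); rewrite ler_wpM2r ?hnorm_ge0.
Qed.

Lemma approx_atD C D (s t : C -> D) e e' (E E' : set (X * X)) :
  approx_at s e E -> approx_at t e' E' ->
  approx_at (fun v => s v + t v) (e + e') (E `|` E').
Proof.
move=> [s' [sb sE se]] [t' [tb tE te]]; exists (fun v => s' v + t' v); split.
- have := bounded_opZD 1 sb tb; congr bounded_op.
  by apply/funext => v; rewrite scale1r.
- have := @supportZD R X C D 1 s' t'.
  rewrite (_ : (fun x => 1 *: s' x + t' x) = (fun v => s' v + t' v)); last first.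
    by apply/funext => v; rewrite scale1r.
  by move=> h z /h [/sE|/tE]; [left|right].
- move=> v; rewrite opprD addrACA mulrDl.
  by apply: (le_trans (hnormD _ _)); rewrite lerD.
Qed.

Lemma approx_atN C D (t : C -> D) e (E : set (X * X)) :
  approx_at t e E -> approx_at (fun v => - t v) e E.
Proof.
move=> [t' [tb tE te]]; exists (fun v => - t' v); split.
- have := bounded_opZD (-1) tb (@bounded_op0 R C D); congr bounded_op.
  by apply/funext => v; rewrite scaleN1r addr0.
- move=> [y x] ts; apply: tE; apply: contrapT => /supportPn t0; apply: ts.
  apply/funext => v /=; rewrite (bounded_opN (cm_proj_bounded _ _)) t0 oppr0//.
- by move=> v; rewrite -opprD hnormN.
Qed.

Lemma cm_proj_adj C (A : set X) : adjoint_pair (cm_proj C A) (cm_proj C A).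
Proof. by have [] := cm_proj_projection C A. Qed.

Lemma cm_proj_rin C (A : set X) v w : rin (cm_proj C A v) w = rin v (cm_proj C A w).
Proof. exact: (adjoint_rinE (@cm_proj_adj C A)). Qed.

(** The approximants are bounded by [M + e], hence have a weak limit. Vanishing matrix entries and
    the norm inequality, tested against vectors, both pass to it. *)
Lemma approx_at_closed (T : Type) (G : set_system T) C D (t : C -> D)
    (tk : T -> C -> D) (M e : R) (E : set (X * X)) :
  UltraFilter G -> 0 <= M -> 0 <= e -> bounded_op t ->
  (forall k x, hnorm (tk k x) <= M * hnorm x) ->
  (forall x y, (fun k => rin (tk k x) y) @ G --> rin (t x) y) ->
  (forall k, approx_at (tk k) e E) -> approx_at t e E.
Proof.
move=> GU M0 e0 tb tM tl /choice [s sP].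
have [|k|k x|s' [sb sM sl]] := @weak_limit R T G C D s (M + e) GU.
- by rewrite addr_ge0.
- by case: (sP k) => -[].
- case: (sP k) => _ _ se; apply: (le_trans (hnorm_leB _ (tk k x))).
  by rewrite mulrDl lerD// hnormBC.
exists s'; split => //.
  move=> [y x] ss'; apply: contrapT => nE; apply: ss'; apply/funext => v.
  apply: rin_ext => w /=; rewrite cm_proj_rin rin0l.
  apply: (@cvg_unique _ (@Rhausdorff R) _ _ _ _ (sl _ _)).
  suff -> : (fun k => rin (s k (cm_proj C [set x] v)) (cm_proj D [set y] w)) = (fun=> 0).
    exact: cvg_cst.
  apply/funext => k.
  case: (sP k) => _ sE _; rewrite -cm_proj_rin.
  have /supportPn -> : ~ op_support (s k) (y, x) by move/sE.
  by rewrite rin0l.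
move=> v; apply: hnorm_le_rin; first by rewrite mulr_ge0 ?hnorm_ge0.
move=> w; rewrite rinBl; apply: (cvg_le _ (cvgB (tl v w) (sl v w))) => k.
change (rin (tk k v) w - rin (s k v) w <= e * hnorm v * hnorm w).
rewrite -rinBl; apply: (le_trans (rin_le _ _)); rewrite ler_wpM2r ?hnorm_ge0//.
by case: (sP k).
Qed.

End Approximation.

(** * Cofinal sequences and finite unions of entourages *)

Section CoarseToolkit.
Context {X : coarseSpace}.

(** Each stage adds squares, transposes and the generator carrying the current number, so the
    subsets of the stages form a coarse structure containing all generators. Every later diagonal
    argument runs along this sequence. *)
Lemma controlled_cofinal : countably_generated X ->
  exists E : nat -> set (X * X), [/\ forall n, controlled (E n),
    forall m n, (m <= n)%N -> E m `<=` E n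
    & forall D, controlled D -> exists n, D `<=` E n].
Proof.
move=> [F [/countable_injP [g gI] XF]].
pose P := controlledP X.
pose Fn n := [set z : X * X | exists D, [/\ F D, g D = n & D z]].
have Fc D : F D -> controlled D by move=> FD; rewrite XF => S SP; exact.
have Fnc n : controlled (Fn n).
  have [[D [FD gD]]|nD] := pselect (exists D, F D /\ g D = n).
    apply: (coarse_subset P) (Fc D FD) => z [D' [FD' gD' D'z]].
    by rewrite -(gI D' D) ?inE// gD gD'.
  apply: (coarse_subset P) (coarse_diagonal P) => z [D [FD gD _]].
  by case: nD; exists D.
pose step (n : nat) (E : set (X * X)) :=
  (E `|` (E \; E)%relation) `|` ((E^-1)%relation `|` Fn n).
pose E := fix E n := if n is m.+1 then step m (E m) else [set xy | xy.1 = xy.2].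
have Ec n : controlled (E n).
  elim: n => [|n En] /=; first exact: coarse_diagonal P.
  apply: (coarse_union P); apply: (coarse_union P) => //.
    exact: (coarse_compose P).
  exact: (coarse_transpose P).
have E1 n : E n `<=` E n.+1 by move=> z; left; left.
have Em m n : (m <= n)%N -> E m `<=` E n.
  elim: n => [|n IH]; first by rewrite leqn0 => /eqP ->.
  rewrite leq_eqVlt => /orP[/eqP -> //|mn].
  exact: subset_trans (IH mn) (E1 n).
exists E; split => // D; rewrite XF => /(_ [set D | exists n, D `<=` E n]); apply.
  split => [|A B AB [n Bn]|A B [m Am] [n Bn]|A [n An]|A B [m Am] [n Bn]].
  - by exists 0%N.
  - by exists n; exact: subset_trans AB Bn.
  - exists (maxn m n) => z [/Am|/Bn]; apply: Em; [exact: leq_maxl|exact: leq_maxr].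
  - by exists n.+1 => z /An Ez; right; left.
  - exists (maxn m n).+1 => z [y Ay By]; left; right; exists y.
      by apply: Em (Bn _ Ay); exact: leq_maxr.
    by apply: Em (Am _ By); exact: leq_maxl.
move=> D' FD'; exists (g D').+1 => z Dz; right; right; exists D'; split => //.
Qed.

Lemma finite_set_ind (J : Type) (P : set J -> Prop) :
  P set0 -> (forall j A, P A -> P (j |` A)) -> forall A, finite_set A -> P A.
Proof.
move=> P0 PS A /(@finite_seqP {classic J}) [s ->].
elim: s => [|j s IH]; first by rewrite set_nil.
have -> : [set` (j :: s)] = j |` [set` s].
  by apply/seteqP; split => i /=; rewrite inE;
    [move=> /orP[/eqP|]; [left|right]|move=> [->|->]; rewrite ?eqxx ?orbT].
exact: PS.
Qed.

Lemma controlled_finite_union (J : Type) (A : set J) (F : J -> set (X * X)) :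
  finite_set A -> (forall j, A j -> controlled (F j)) ->
  controlled [set z | exists2 j, A j & F j z].
Proof.
move=> Af; move: A Af F; apply: (@finite_set_ind J (fun A => forall F : J -> set (X * X),
  (forall j, A j -> controlled (F j)) -> controlled [set z | exists2 j, A j & F j z])).
  move=> F _; apply: (coarse_subset (controlledP X)) (coarse_diagonal (controlledP X)).
  by move=> z [].
move=> j B IH F FB.
apply: (coarse_subset (controlledP X)); last first.
  apply: (coarse_union (controlledP X) (FB j _) (IH F _)); first by left.
  by move=> i Bi; apply: FB; right.
by move=> z [i [->|Bi] Fz]; [left|right; exists i].
Qed.

End CoarseToolkit.

(** * Projections and finitely supported vectors *)

Section Modules.
Context {R : realType} {X : lfCoarseSpace}.
Implicit Types C D : coarseModule R X.

Lemma cm_projK C (A : set X) v : cm_proj C A (cm_proj C A v) = cm_proj C A v.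
Proof. by rewrite cm_projM setIid. Qed.

Lemma cm_proj_id C (A B : set X) v :
  A `<=` B -> cm_proj C A v = v -> cm_proj C B v = v.
Proof. by move=> AB Av; rewrite -[in LHS]Av cm_projM setIC (setIidl AB). Qed.

Lemma cm_proj_sub C (A B : set X) v :
  A `<=` B -> cm_proj C A (cm_proj C B v) = cm_proj C A v.
Proof. by move=> AB; rewrite cm_projM (setIidl AB). Qed.

Lemma cm_proj_pythagoras C (A : set X) v :
  hnorm v ^+ 2 = hnorm (cm_proj C A v) ^+ 2 + hnorm (cm_proj C (~` A) v) ^+ 2.
Proof.
have e : v = cm_proj C A v + cm_proj C (~` A) v by rewrite cm_projCE addrC subrK.
rewrite {1}e hnormD_sq cm_proj_rin cm_projM setICr cm_proj0 rin0r.
by rewrite mulr0 addr0.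
Qed.

Lemma cm_proj_le C (A : set X) v : hnorm (cm_proj C A v) <= hnorm v.
Proof. by rewrite ler_hnorm_sq (cm_proj_pythagoras A v) lerDl sqr_ge0. Qed.

Lemma cm_proj_mono C (A B : set X) v : A `<=` B ->
  hnorm (cm_proj C A v) <= hnorm (cm_proj C B v).
Proof. by move=> AB; rewrite -(cm_proj_sub v AB) cm_proj_le. Qed.

Lemma cm_proj_norm_sq C (A : set X) v : hnorm (cm_proj C A v) ^+ 2 = rin (cm_proj C A v) v.
Proof. by rewrite hnorm_sq -cm_proj_rin cm_projK. Qed.

Lemma cm_projB C (A : set X) v w : cm_proj C A (v - w) = cm_proj C A v - cm_proj C A w.
Proof. exact: (bounded_opBE (cm_proj_bounded C A)). Qed.

Lemma cm_projD C (A : set X) v w : cm_proj C A (v + w) = cm_proj C A v + cm_proj C A w.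
Proof. exact: (linear_opD (cm_proj_bounded C A).1). Qed.

Lemma cm_projZ C (A : set X) a v : cm_proj C A (a *: v) = a *: cm_proj C A v.
Proof. exact: (bounded_opZ (cm_proj_bounded C A)). Qed.

Lemma cm_proj_v0 C (A : set X) : cm_proj C A 0 = 0.
Proof. exact: (linear_op0 (cm_proj_bounded C A).1). Qed.

(** Local finiteness turns the bounded sets of the nondegeneracy axiom into finite ones. *)
Lemma finite_support_approx C (v : C) (e : R) : 0 < e ->
  exists2 G : set X, finite_set G & hnorm (v - cm_proj C G v) <= e.
Proof.
move=> e0; have [E [cE _ _] dE] := cm_nondegenerate C.
have : closure (lin_span [set v | exists2 A, E_bounded E A &
    range (cm_proj C A) v]) v by rewrite dE.
have eC : 0 < e%:C :> R[i] by rewrite ltcR.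
move=> /(_ _ (nbhsx_ballx v _ eC)) [w [[n [c [u [Su wE]]]]]].
rewrite -ball_normE /= hnormE ltcR => /ltW vw.
have /choice [A AP] : forall i, exists A, E_bounded E A /\ cm_proj C A (u i) = u i.
  by move=> i; have [A EA [x _ <-]] := Su i; exists A; rewrite cm_projK.
pose G := \bigcup_(i in [set: 'I_n]) A i.
have Gf : finite_set G.
  by apply: bigcup_finite => // i _; apply: lf_spaceP; exists E => //; exact: (AP i).1.
exists G => //.
have Gw : cm_proj C G w = w.
  rewrite wE (linear_op_sum (cm_proj_bounded C G).1); apply: eq_bigr => i _.
  by rewrite cm_projZ (@cm_proj_id C (A i))// ?(AP i).2//; exact: bigcup_sup.
have -> : v - cm_proj C G v = cm_proj C (~` G) (v - w).
  by rewrite cm_projCE cm_projB Gw opprB addrA subrK.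
exact: le_trans (cm_proj_le _ _) vw.
Qed.

Lemma proj_norm_finite C (v : C) (A : set X) (e : R) : e < hnorm (cm_proj C A v) ->
  exists G, [/\ finite_set G, G `<=` A & e < hnorm (cm_proj C G v)].
Proof.
move=> eA; pose d := (hnorm (cm_proj C A v) - e) / 2.
have d0 : 0 < d by rewrite divr_gt0// subr_gt0.
have [G Gf Ge] := finite_support_approx (cm_proj C A v) d0.
exists (G `&` A); split; [exact: finite_setIl|exact: subIsetr|].
move: Ge; rewrite cm_projM => Ge.
have := hnorm_leB (cm_proj C A v) (cm_proj C (G `&` A) v).
move: Ge; rewrite /d; lra.
Qed.

End Modules.

Definition agree (J : Type) (G A A' : set J) : Prop := forall j, G j -> (A j <-> A' j).

Lemma agree_trans (J : Type) (G A B B' : set J) : agree G A B -> agree G B B' -> agree G A B'.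
Proof. by move=> AB BB' j Gj; rewrite (AB j Gj); exact: BB'. Qed.

Lemma proj_agree (R : realType) (X : lfCoarseSpace) (C : coarseModule R X) (v : C) (e : R) :
  0 < e -> exists2 G : set X, finite_set G &
    forall A A', agree G A A' -> hnorm (cm_proj C A v - cm_proj C A' v) <= e.
Proof.
move=> e0; have e2 : 0 < e / 2 by rewrite divr_gt0.
have [G Gf Ge] := finite_support_approx v e2; exists G => // A A' AA'.
have -> : cm_proj C A v - cm_proj C A' v =
    cm_proj C A (v - cm_proj C G v) - cm_proj C A' (v - cm_proj C G v).
  rewrite !cm_projB !cm_projM.
  have -> : A' `&` G = A `&` G by apply/seteqP; split => i [? Gi]; split => //; apply/(AA' i).
  by rewrite opprB addrA subrK.
apply: (le_trans (hnormB _ _)); rewrite [leRHS]splitr.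
by apply: lerD; apply: le_trans (cm_proj_le _ _) Ge.
Qed.

(** In the product topology on subsets of [J], the good index sets form a closed set: an ultrafilter
    on the good sets that refines the neighbourhoods of [A] reduces this to [approx_at_closed]. *)
Lemma approx_at_cluster (R : realType) (Y : lfCoarseSpace) (C D : coarseModule R Y) (J : Type)
    (T : set J -> C -> D) (M : R) A e E : 0 <= M -> 0 <= e -> bounded_op (T A) ->
  (forall A v, hnorm (T A v) <= M * hnorm v) ->
  (forall v w (d : R), 0 < d -> exists2 G, finite_set G &
     forall A', agree G A A' -> `|rin (T A v - T A' v) w| <= d) ->
  (forall G, finite_set G -> exists2 A', agree G A A' & approx_at (T A') e E) ->
  approx_at (T A) e E.
Proof.
move=> M0 e0 Tb TM Tc clus; pose K := {A' | approx_at (T A') e E}.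
pose F : set_system K := [set P | exists2 G, finite_set G
  & forall k : K, agree G A (sval k) -> P k].
have FF : ProperFilter F.
  split.
    move=> [G Gf GP]; have [A' AA' A'E] := clus G Gf.
    exact: (GP (exist _ A' A'E)).
  split; first by exists set0.
    move=> P Q [G Gf GP] [G' G'f G'Q]; exists (G `|` G'); first by rewrite finite_setU.
    by move=> k kA; split; [apply: GP|apply: G'Q] => j Gj; apply: kA; [left|right].
  by move=> P Q PQ [G Gf GP]; exists G => // k /GP /PQ.
have [U [UU FU]] := ultraFilterLemma FF.
apply: (@approx_at_closed R Y K U C D (T A) (fun k => T (sval k)) M) => //.
- move=> v w; apply/cvgrPdist_le => d d0; apply: FU.
  have [G Gf GP] := Tc v w d d0.
  by exists G => // k /GP; rewrite rinBl.
- by case.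
Qed.

(** * Uniform propagation for families indexed by subsets *)

Section Baire.
Context {R : realType} {Y : lfCoarseSpace} (hY : countably_generated Y).
Context {C D : coarseModule R Y} {J : Type} (T : set J -> C -> D) (M : R).
Hypothesis T_approx : forall A, approximable (T A).
Hypothesis T_bounded : forall A v, hnorm (T A v) <= M * hnorm v.
Hypothesis T_point : forall A j v, A j -> T A v = T (A `\ j) v + T [set j] v.
Hypothesis T_continuous : forall A v w (e : R), 0 < e ->
  exists2 G, finite_set G & forall A', agree G A A' -> `|rin (T A v - T A' v) w| <= e.
Hypothesis M_ge0 : 0 <= M.

(* Baire category in the compact space of subsets of [J], whose basic open sets
   are the cylinders [agree G A]. *)
Lemma approx_at_cylinder e : 0 < e -> exists G A E, [/\ finite_set G, controlled E
  & forall A', agree G A A' -> approx_at (T A') e E].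
Proof.
move=> e0; have [E [Ec Em Ecof]] := controlled_cofinal hY.
apply: contrapT => no.
(* Without a good cylinder, the sets failing for [E n] are dense; by [approx_at_cluster] they are
   also open, so a smaller cylinder consists of failures only. *)
have bad G A n : finite_set G -> exists GA : set J * set J, [/\ finite_set GA.1,
    G `<=` GA.1, agree G A GA.2
    & forall A', agree GA.1 GA.2 A' -> ~ approx_at (T A') e (E n)].
  move=> Gf; have [A' [AA' nA']] : exists A', agree G A A' /\ ~ approx_at (T A') e (E n).
    apply: contrapT => h; apply: no; exists G, A, (E n); split => // A' AA'.
    by apply: contrapT => nA'; apply: h; exists A'.
  have [G' [G'f G'P]] : exists G', finite_set G' /\
      forall A'', agree G' A' A'' -> ~ approx_at (T A'') e (E n).
    apply: contrapT => h; apply: nA'.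
    apply: (approx_at_cluster M_ge0 (ltW e0) _ T_bounded (@T_continuous A')).
      by case: (T_approx A').
    move=> G' G'f; apply: contrapT => h'; apply: h; exists G'; split => // A'' A'A'' aA''.
    by apply: h'; exists A''.
  exists (G `|` G', A'); split => //=.
  - by rewrite finite_setU.
  - by move=> A'' A'A''; apply: G'P => j G'j; apply: A'A''; right.
pose K := {G : set J | finite_set G}.
have step (n : nat) (s : K * set J) : exists s' : K * set J,
    [/\ sval s.1 `<=` sval s'.1, agree (sval s.1) s.2 s'.2
    & forall A', agree (sval s'.1) s'.2 A' -> ~ approx_at (T A') e (E n)].
  have [[G' A'] [/= G'f GG' AA' P]] := bad (sval s.1) s.2 n (svalP s.1).
  by exists (exist _ G' G'f, A').
have /choice [next nextP] : forall ns : nat * (K * set J), exists s' : K * set J,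
    [/\ sval ns.2.1 `<=` sval s'.1, agree (sval ns.2.1) ns.2.2 s'.2
    & forall A', agree (sval s'.1) s'.2 A' -> ~ approx_at (T A') e (E ns.1)].
  by move=> [n s]; exact: step.
pose S := fix S n := if n is m.+1 then next (m, S m)
                     else (exist _ set0 (finite_set0 J), set0) : K * set J.
have SP n := nextP (n, S n).
pose G n := sval (S n).1; pose A n := (S n).2.
have Gm m n : (m <= n)%N -> G m `<=` G n.
  elim: n => [|n IH]; first by rewrite leqn0 => /eqP ->.
  rewrite leq_eqVlt => /orP[/eqP -> //|mn].
  by apply: subset_trans (IH mn) _; case: (SP n).
have Aa m n : (m <= n)%N -> agree (G m) (A m) (A n).
  elim: n => [|n IH]; first by rewrite leqn0 => /eqP ->.
  rewrite leq_eqVlt => /orP[/eqP -> //|mn].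
  apply: agree_trans (IH mn) _ => j Gj; case: (SP n) => _ h _.
  by apply: h; exact: Gm Gj.
(* The point common to all nested cylinders. Its operator fails for every [E n], although it is
   approximable. *)
pose A' := [set j | exists2 n, G n j & A n j].
have AA' n : agree (G n) (A n) A'.
  move=> j Gj; split=> [Aj|[m Gmj Amj]]; first by exists n.
  have [mn|/ltnW nm] := leqP m n; first by rewrite -(Aa _ _ mn j Gmj).
  by rewrite (Aa _ _ nm j Gj).
have [_ /(_ e e0) [E' E'c aE']] := iffLR (approximableP _) (T_approx A').
have [n E'n] := Ecof _ E'c.
case: (SP n) => _ _ /(_ A' (AA' n.+1)); apply.
by apply: approx_atS aE'.
Qed.

(** A good cylinder constrains only the finite set [G]. Changing an index set on [G] adds or removes
    finitely many operators [T [set j]], each with an entourage of its own. *)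
Lemma approx_at_uniform e : 0 < e -> exists2 E, controlled E & forall A, approx_at (T A) e E.
Proof.
move=> e0; have e2 : 0 < e / 2 by rewrite divr_gt0.
have [G [A0 [E [Gf Ec EP]]]] := approx_at_cylinder e2.
have diff : forall d : R, 0 < d -> exists2 E', controlled E' & forall A A',
    (forall j, ~ G j -> (A j <-> A' j)) ->
    approx_at (fun v => T A v + - T A' v) d E'.
  move: Gf; move: {EP} G; apply: finite_set_ind.
    move=> d d0; exists [set xy | xy.1 = xy.2]; first exact: coarse_diagonal (controlledP Y).
    move=> A A' AA'; have -> : A' = A.
      by apply/funext => j; apply/propext; split => /AA'; apply.
    exists (fun=> 0); split; first exact: bounded_op0.
    - move=> [y x] h; case: h; apply/funext => v /=; exact: cm_proj_v0.
    - by move=> v; rewrite subrr subr0 hnorm0 mulr_ge0 ?hnorm_ge0 ?ltW.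
  move=> j G IH d d0; have d2 : 0 < d / 2 by rewrite divr_gt0.
  have [E1 E1c E1P] := IH _ d2.
  have [_ /(_ _ d2) [E2 E2c E2P]] := iffLR (approximableP _) (T_approx [set j]).
  exists (E1 `|` E2); first exact: (coarse_union (controlledP Y)).
  move=> A A' AA'; rewrite (splitr d).
  have {E1P} := E1P (A `\ j) (A' `\ j); case.
    move=> i nGi; have [->|ij] := pselect (i = j); first by split=> -[_ /(_ erefl)].
    have /AA' h : ~ (j |` G) i by case.
    by split=> -[/h ? ?]; split.
  have Tj B v : T B v = T (B `\ j) v + (if `[< B j >] then T [set j] v else 0).
    have [Bj|nBj] := asboolP (B j); first exact: T_point.
    rewrite addr0 (_ : B `\ j = B)//; apply/seteqP; split => [i []//|i Bi].
    by split=> // ij; apply: nBj; rewrite -ij.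
  have c : approx_at (fun v => (if `[< A j >] then T [set j] v else 0) -
      (if `[< A' j >] then T [set j] v else 0)) (d / 2) E2.
    have z : approx_at (fun=> 0 : D) (d / 2) E2 (C := C).
      exists (fun=> 0); split; first exact: bounded_op0.
      - move=> [y x] h; case: h; apply/funext => v /=; exact: cm_proj_v0.
      - by move=> v; rewrite subr0 hnorm0 mulr_ge0 ?hnorm_ge0 ?ltW.
    have [Aj|nAj] := asboolP (A j); have [A'j|nA'j] := asboolP (A' j).
    - by move: z; congr approx_at; apply/funext => v; rewrite subrr.
    - by move: E2P; congr approx_at; apply/funext => v; rewrite subr0.
    - by move: (approx_atN E2P); congr approx_at; apply/funext => v; rewrite sub0r.
    - by move: z; congr approx_at; apply/funext => v; rewrite subrr.
  move=> s sP; have := approx_atD (ex_intro _ s sP) c; congr approx_at.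
  by apply/funext => v; rewrite addrACA -opprD -!Tj.
have [E' E'c E'P] := diff _ e2.
exists (E `|` E'); first exact: (coarse_union (controlledP Y)).
(* [A'] follows [A0] on [G], hence lies in the cylinder, and equals [A] elsewhere. *)
move=> A; pose A' := (A0 `&` G) `|` (A `\` G).
rewrite (splitr e); have := approx_atD (EP A' _) (E'P A A' _).
have -> : (fun v => T A' v + (T A v + - T A' v)) = T A.
  by apply/funext => v; rewrite addrC subrK.
apply.
  by move=> j Gj; split=> [A0j|[[]//|[_ /(_ Gj)]//]]; left.
by move=> j nGj; split=> [Aj|[[_ /nGj]//|[]//]]; right.
Qed.

End Baire.

(** * Rank one operators and orthonormal sequences *)

Section RankOne.
Context {R : realType}.
Implicit Types H K L : hilbertType R.

Definition rank_one H K (u : K) (v : H) : H -> K := fun x => inner H x v *: u.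

Lemma rank_one_bounded H K (u : K) (v : H) : bounded_op (rank_one u v).
Proof.
split=> [a x y|]; first by rewrite /rank_one innerDl innerZl scalerDl scalerA.
exists (hnorm v * hnorm u) => x; rewrite hnormZ -/(cabs _) mulrAC ler_wpM2r ?hnorm_ge0//.
by rewrite mulrC inner_cabs_le.
Qed.

Lemma rank_one_adj H K (u : K) (v : H) : adjoint_pair (rank_one u v) (rank_one v u).
Proof.
by move=> x y; rewrite /rank_one innerZl innerZr -innerC mulrC.
Qed.

Lemma rank_one_compl H K L (t : K -> L) (u : K) (v : H) : bounded_op t ->
  t \o rank_one u v = rank_one (t u) v.
Proof. by move=> tb; apply/funext => x; rewrite /rank_one /= (bounded_opZ tb). Qed.

Lemma rank_one_compr H K L (t : L -> H) (t' : H -> L) (u : K) (v : H) :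
  adjoint_pair t t' -> rank_one u v \o t = rank_one u (t' v).
Proof. by move=> tt'; apply/funext => x; rewrite /rank_one /= tt'. Qed.

Lemma rank_one_mul H K L (u : L) (v w : K) (x : H) :
  rank_one u v \o rank_one w x = (fun y => inner K w v *: rank_one u x y).
Proof.
by apply/funext => y; rewrite /rank_one /= innerZl mulrC scalerA.
Qed.

Lemma inner_self H (x : H) : inner H x x = (hnorm x ^+ 2)%:C.
Proof. by rewrite -innerE hnormE rmorphXn. Qed.

Lemma rank_one_self H K (u : K) (v : H) : rank_one u v v = (hnorm v ^+ 2)%:C *: u.
Proof. by rewrite /rank_one inner_self. Qed.

Lemma bounded_opD H K (s t : H -> K) : bounded_op s -> bounded_op t ->
  bounded_op (fun x => s x + t x).
Proof.
move=> sb tb; have := bounded_opZD 1 sb tb; congr bounded_op.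
by apply/funext => v; rewrite scale1r.
Qed.

Definition orthonormal_seq H (a : nat -> H) : Prop :=
  forall i j, inner H (a i) (a j) = (i == j)%:R.

Lemma orthonormal_sum_sq K (a : nat -> K) (c : nat -> R[i]) n : orthonormal_seq a ->
  hnorm (\sum_(k < n) c k *: a k) ^+ 2 = \sum_(k < n) cabs (c k) ^+ 2.
Proof.
move=> oa; elim: n => [|n IH]; first by rewrite !big_ord0 hnorm0 expr0n.
rewrite !big_ord_recr /= hnormD_sq IH hnormZ -/(cabs _) exprMn.
have -> : hnorm (a n) ^+ 2 = 1 by rewrite hnorm_sq /rin oa eqxx.
rewrite mulr1 (_ : rin _ _ = 0) ?mulr0 ?addr0//.
rewrite /rin innerZr inner_suml big1 ?mulr0// => k _.
by rewrite innerZl oa (ltn_eqF (ltn_ord k)) mulr0.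
Qed.

Lemma bessel H (b : nat -> H) v n : orthonormal_seq b ->
  \sum_(k < n) cabs (inner H v (b k)) ^+ 2 <= hnorm v ^+ 2.
Proof.
move=> ob; pose r n := v - \sum_(k < n) inner H v (b k) *: b k.
suff <- : hnorm (r n) ^+ 2 + \sum_(k < n) cabs (inner H v (b k)) ^+ 2 = hnorm v ^+ 2.
  by rewrite lerDr sqr_ge0.
elim: n => [|n IH]; first by rewrite /r !big_ord0 subr0 addr0.
rewrite -IH big_ord_recr /= addrCA addrC; congr (_ + _).
have -> : r n.+1 = r n - inner H v (b n) *: b n by rewrite /r big_ord_recr /= opprD addrA.
rewrite hnormB_sq hnormZ -/(cabs _) exprMn.
have -> : hnorm (b n) ^+ 2 = 1 by rewrite hnorm_sq /rin ob eqxx.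
have -> : rin (r n) (inner H v (b n) *: b n) = cabs (inner H v (b n)) ^+ 2.
  rewrite /rin innerZr innerBl inner_suml big1 ?subr0.
    by rewrite mulrC -cabs_sq.
  by move=> k _; rewrite innerZl ob (ltn_eqF (ltn_ord k)) mulr0.
lra.
Qed.

Lemma bessel_tail H (b : nat -> H) v (e : R) : orthonormal_seq b -> 0 < e ->
  exists m, forall n,
    \sum_(k < n) (if (m <= k)%N then cabs (inner H v (b k)) ^+ 2 else 0) <= e.
Proof.
move=> ob e0; pose S n := \sum_(k < n) cabs (inner H v (b k)) ^+ 2.
have sS : has_sup (range S).
  split; first by exists (S 0%N), 0%N.
  by exists (hnorm v ^+ 2) => _ [n _ <-]; exact: bessel.
have [_ [m _ <-] mS] := sup_adherent e0 sS.
exists m => n.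
have Sub k : S k <= sup (range S) by apply: ub_le_sup; [exact: sS.2|exists k].
suff : S m + \sum_(k < n) (if (m <= k)%N then cabs (inner H v (b k)) ^+ 2 else 0) <=
  S (maxn m n).
  by have := Sub (maxn m n); move: mS; clear => *; lra.
have [nm|mn] := leqP n m.
  rewrite big1 ?addr0// => k _.
  by rewrite leqNgt (leq_trans (ltn_ord k) nm).
rewrite /S -!(big_mkord xpredT (fun k => cabs (inner H v (b k)) ^+ 2)).
rewrite -(big_mkord xpredT (fun k => if (m <= k)%N then cabs (inner H v (b k)) ^+ 2 else 0)).
rewrite (@big_cat_nat _ _ _ m 0 n)//= ?(ltnW mn)// (@big_cat_nat _ _ _ m 0 n _ _ _ (ltnW mn))//=.
rewrite [X in _ + (X + _)]big1_seq ?add0r; last first.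
  by move=> k /andP[_]; rewrite mem_index_iota => /andP[_ km]; rewrite leqNgt km.
rewrite lerD2l big_nat_cond [leRHS]big_nat_cond; apply: ler_sum => k.
by rewrite andbT => /andP[-> _].
Qed.

(** One ultrafilter serves all index sets, which makes the weak sums additive in [A]. It refines
    [\oo], so eventually constant partial sums have the expected limit. *)
Lemma orthonormal_operators H K (a : nat -> K) (b : nat -> H) :
  orthonormal_seq a -> orthonormal_seq b ->
  exists (G : set_system nat) (T : set nat -> H -> K), [/\ ProperFilter G, \oo `<=` G,
    forall A, bounded_op (T A) /\ forall v, hnorm (T A v) <= hnorm v
    & forall (A : set nat) v w,
      (fun n => rin (\sum_(k < n) (if `[< A k >] then inner H v (b k) else 0) *: a k) w)
         @ G --> rin (T A v) w].
Proof.
move=> oa ob; have [G [GU ooG]] := ultraFilterLemma eventually_filter.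
pose p (A : set nat) n (v : H) := \sum_(k < n) (if `[< A k >] then inner H v (b k) else 0) *: a k.
have pl A n : linear (p A n).
  move=> c x y; rewrite /p scaler_sumr -big_split; apply: eq_bigr => k _ /=.
  case: ifP => _; last by rewrite !scale0r scaler0 addr0.
  by rewrite innerDl innerZl scalerDl scalerA.
have pM A n v : hnorm (p A n v) <= 1 * hnorm v.
  rewrite mul1r ler_hnorm_sq.
  rewrite /p (orthonormal_sum_sq (fun k => if `[< A k >] then inner H v (b k) else 0) n oa).
  apply: le_trans (bessel v n ob); apply: ler_sum => k _.
  by case: ifP => // _; rewrite cabs0 expr0n sqr_ge0.
have /choice [T TP] : forall A, exists t : H -> K,
    [/\ bounded_op t, forall x, hnorm (t x) <= 1 * hnorm x
    & forall x y, (fun n => rin (p A n x) y) @ G --> rin (t x) y].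
  by move=> A; exact: (@weak_limit R nat G H K (p A) 1 GU ler01 (pl A) (pM A)).
exists G, T; split; [exact: ultra_proper|exact: ooG| |by move=> A; case: (TP A)].
by move=> A; case: (TP A) => tb tM _; split => // v; rewrite -[leRHS]mul1r.
Qed.

Lemma cvg_uniq (T : Type) (G : set_system T) (f : T -> R) (a b : R) :
  ProperFilter G -> f @ G --> a -> f @ G --> b -> a = b.
Proof. by move=> GP fa fb; exact: (@cvg_unique _ (@Rhausdorff R) (f @ G) _ _ _ fa fb). Qed.

Lemma cvg_near_cst_eq (T : Type) (G : set_system T) (f : T -> R) (a b : R) :
  ProperFilter G -> f @ G --> a -> G [set k | f k = b] -> a = b.
Proof.
move=> GP fa Gb; apply: cvg_uniq fa _; exact: cvg_near_cst.
Qed.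

End RankOne.

(** * Supports and separated sets *)

Section Supports.
Context {R : realType} {X : lfCoarseSpace}.
Implicit Types C D : coarseModule R X.

Lemma support_separated C D (s : C -> D) E (A B : set X) v :
  bounded_op s -> op_support s `<=` E -> (forall y x, B y -> A x -> ~ E (y, x)) ->
  cm_proj D B (s (cm_proj C A v)) = 0.
Proof.
move=> sb sE AB.
apply: (proj_pointwise_zero (bounded_op_comp (cm_proj_bounded D B) sb)) => x Ax w /=.
apply: proj_zero => y; rewrite cm_projM.
have [By|nBy] := pselect (B y).
  have -> : [set y] `&` B = [set y] by apply/setIidPl => _ ->.
  by apply: (iffLR (supportPn s y x)) => /sE; exact: AB.
rewrite (_ : _ `&` _ = set0) ?cm_proj0//.
by rewrite -subset0 => _ [->].
Qed.

Lemma support_thickening C D (s : C -> D) E (A : set X) v :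
  bounded_op s -> op_support s `<=` E ->
  cm_proj D (~` thickening E A) (s (cm_proj C A v)) = 0.
Proof.
by move=> sb sE; apply: support_separated sb sE _ => y x nEy Ax Eyx; apply: nEy; exists x.
Qed.

Lemma rank_one_support C D (u : D) (v : C) (A B : set X) :
  cm_proj D B u = u -> cm_proj C A v = v -> op_support (rank_one u v) `<=` B `*` A.
Proof.
move=> uB vA [y x]; apply: contraPP => nBA; apply/supportPn => w.
rewrite /rank_one cm_projZ -uB -vA -[inner _ _ _](cm_proj_adj) cm_projM cm_projM.
have [By|nBy] := pselect (B y); last first.
  have -> : [set y] `&` B = set0 by rewrite -subset0 => _ [->].
  by rewrite cm_proj0 scaler0.
have -> : A `&` [set x] = set0.
  by rewrite -subset0 => z [Az zx]; apply: nBA; split => //=; rewrite -zx.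
by rewrite cm_proj0 linear0l scale0r.
Qed.

Lemma approximable_controlled C D (t : C -> D) (E : set (X * X)) :
  bounded_op t -> controlled E -> op_support t `<=` E -> approximable t.
Proof.
move=> tb Ec tE; apply/approximableP; split => // e e0; exists E => //.
exists t; split => // v; rewrite subrr hnorm0 mulr_ge0 ?hnorm_ge0 ?ltW//.
Qed.

Lemma proj_support C (A : set X) : op_support (cm_proj C A) `<=` [set xy | xy.1 = xy.2].
Proof.
move=> [y x]; apply: contraPP => /= yx; apply/supportPn => v /=.
rewrite !cm_projM (_ : _ `&` _ = set0) ?cm_proj0//.
by rewrite -subset0 => z [[-> _] ].
Qed.

Lemma approximable_proj C (A : set X) : approximable (cm_proj C A).
Proof.
apply: approximable_controlled (@proj_support C A); first exact: cm_proj_bounded.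
exact: coarse_diagonal (controlledP X).
Qed.

Lemma orthonormal_support C D (a : nat -> D) (b : nat -> C) (G : set_system nat)
    (t : C -> D) (A : set nat) E : ProperFilter G ->
  (forall v w,
      (fun n => rin (\sum_(k < n) (if `[< A k >] then inner C v (b k) else 0) *: a k) w)
         @ G --> rin (t v) w) ->
  (forall k, op_support (rank_one (a k) (b k)) `<=` E) -> op_support t `<=` E.
Proof.
move=> GP tG abE [y x]; apply: contraPP => nE; apply/supportPn => v.
apply: rin_ext => w; rewrite rin0l cm_proj_rin.
apply: (cvg_near_cst_eq _ (tG _ _)); apply: filterE => n /=.
rewrite -cm_proj_rin (linear_op_sum (cm_proj_bounded D _).1) big1 ?rin0l// => k _.
case: ifP => _; last by rewrite scale0r cm_proj_v0.
have /supportPn/(_ v) : ~ op_support (rank_one (a k) (b k)) (y, x) by move/abE.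
by [].
Qed.

(* Quasi-locality of the rank one operator [rank_one p q]. *)
Definition separated_small C (p q : C) (e : R) (E : set (X * X)) : Prop :=
  forall B' B : set X, (forall y y', B' y -> B y' -> ~ E (y, y')) ->
    hnorm (cm_proj C B' p) * hnorm (cm_proj C B q) <= e.

Lemma separated_smallS C (p q : C) e e' (E E' : set (X * X)) : e <= e' -> E `<=` E' ->
  separated_small p q e E -> separated_small p q e' E'.
Proof.
move=> ee EE h B' B BB; apply: (le_trans _ ee); apply: h => y y' B'y By' Eyy'.
by case: (BB y y') => //; exact: EE.
Qed.

(** Test at the part [w] of [q] over [B]: the approximant sends it outside [B'], while the rank one
    operator sends it to [hnorm w ^+ 2] times [p]. *)
Lemma rank_one_separated C (p q : C) e E : 0 <= e ->
  approx_at (rank_one p q) e E -> separated_small p q e E.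
Proof.
move=> e0 [s [sb sE se]] B' B BB; set w := cm_proj C B q.
have [->|w0] := eqVneq (hnorm w) 0; first by rewrite mulr0.
have w0' : 0 < hnorm w by rewrite lt_def w0 hnorm_ge0.
rewrite -(ler_pM2r w0') -mulrA -expr2.
apply: le_trans (se w); apply: le_trans (cm_proj_le B' _); rewrite cm_projB.
rewrite {2}/w (support_separated q sb sE BB) subr0 /rank_one cm_projZ.
have -> : inner C w q = (hnorm w ^+ 2)%:C.
  by rewrite -inner_self /w [in RHS](cm_proj_adj) cm_projK -cm_proj_adj.
by rewrite hnormZr ger0_norm ?sqr_ge0// mulrC.
Qed.

End Supports.

(** * Families conjugated by a unitary *)

Section UniformFamilies.
Context {R : realType} {X Y : lfCoarseSpace} (hY : countably_generated Y).
Context {C : coarseModule R X} {D : coarseModule R Y} {U : C -> D} {V : D -> C}.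
Hypothesis UV : unitary_pair U V.
Hypothesis UVapprox : forall t : C -> C, approximable t -> approximable (U \o t \o V).

Lemma unitary_bounded : bounded_op U. Proof. by case: UV. Qed.
Lemma unitary_inv_bounded : bounded_op V. Proof. by case: UV. Qed.
Lemma unitary_adj : adjoint_pair U V. Proof. by case: UV. Qed.
Lemma unitaryK : cancel U V. Proof. by case: UV. Qed.
Lemma unitary_invK : cancel V U. Proof. by case: UV. Qed.

Lemma unitary_norm v : hnorm (U v) = hnorm v.
Proof.
apply/eqP; rewrite -(@eqrXn2 _ 2) ?hnorm_ge0// !hnorm_sq.
by rewrite (adjoint_rinE unitary_adj) unitaryK.
Qed.

Lemma unitary_inv_norm w : hnorm (V w) = hnorm w.
Proof. by rewrite -unitary_norm unitary_invK. Qed.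

Lemma unitary_rank_one u v : U \o rank_one u v \o V = rank_one (U u) (U v).
Proof.
rewrite (rank_one_compl u v unitary_bounded).
exact: (rank_one_compr (U u) v (adjoint_sym unitary_adj)).
Qed.

Lemma uniform_projections e : 0 < e -> exists2 E, controlled E &
  forall A : set X, approx_at (U \o cm_proj C A \o V) e E.
Proof.
apply: (approx_at_uniform hY (M := 1)) => //.
- by move=> A; apply: UVapprox; exact: approximable_proj.
- by move=> A v; rewrite mul1r /= unitary_norm -(unitary_inv_norm v) cm_proj_le.
- move=> A j v Aj /=; rewrite (cm_projD1 _ Aj) (linear_opD unitary_bounded.1).
  by rewrite addrC.
- move=> A v w d d0; have w0 : 0 < hnorm w + 1 by rewrite ltr_wpDl ?hnorm_ge0.
  have [|G Gf Gd] := proj_agree (V v) (_ : 0 < d / (hnorm w + 1)); first by rewrite divr_gt0.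
  exists G => // A' AA'; rewrite /= -(bounded_opBE unitary_bounded).
  apply: (le_trans (rin_norm_le _ _)); rewrite unitary_norm.
  apply: (@le_trans _ _ (d / (hnorm w + 1) * hnorm w)).
    by rewrite ler_wpM2r ?hnorm_ge0// Gd.
  by rewrite mulrAC ler_pdivrMr// ler_wpM2l ?(ltW d0)// lerDl.
Qed.

(** All sub-sums of the orthonormal family are approximable over [E], so the uniformity principle
    applies with index set [nat]; singletons give back the individual rank one operators. *)
Lemma uniform_orthonormal (a b : nat -> C) E e : 0 < e ->
  orthonormal_seq a -> orthonormal_seq b -> controlled E ->
  (forall k, op_support (rank_one (a k) (b k)) `<=` E) ->
  exists2 E', controlled E' & forall k, approx_at (rank_one (U (a k)) (U (b k))) e E'.
Proof.
move=> e0 oa ob Ec abE.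
have [G [T [GP ooG Tb TG]]] := orthonormal_operators oa ob.
have Tpt A j v : A j -> T A v = T (A `\ j) v + T [set j] v.
  move=> Aj; apply: rin_ext => w; rewrite rinDl.
  apply: cvg_uniq (TG A v w) _; apply: cvg_trans (cvgD (TG (A `\ j) v w) (TG [set j] v w)).
  apply: near_eq_cvg; apply: filterE => n.
  change (rin (\sum_(k < n) (if `[< (A `\ j) k >] then inner C v (b k) else 0) *: a k) w +
   rin (\sum_(k < n) (if `[< [set j] k >] then inner C v (b k) else 0) *: a k) w =
   rin (\sum_(k < n) (if `[< A k >] then inner C v (b k) else 0) *: a k) w).
  rewrite -rinDl -big_split /=; congr rin; apply: eq_bigr => k _; rewrite -scalerDl.
  congr (_ *: _); have [kj|kj] := pselect (k = j :> nat).
    rewrite (asboolF (_ : ~ (A `\ j) k)); last by case.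
    by rewrite (asboolT (_ : [set j] _))// add0r asboolT// kj.
  rewrite (asboolF (_ : ~ [set j] _))// addr0; congr (if _ then _ else _).
  by apply: asbool_equiv_eq; split=> [[]|].
have Tk k : T [set k] = rank_one (a k) (b k).
  apply/funext => v; apply: rin_ext => w.
  apply: (cvg_near_cst_eq _ (TG [set k] v w)); apply: ooG; exists k.+1 => // n /= kn.
  rewrite (bigD1 (Ordinal kn)) //= asboolT// big1 ?addr0// => i.
  rewrite -val_eqE /= => ik; rewrite asboolF ?scale0r// => /eqP.
  by rewrite (negbTE ik).
have [E' E'c E'P] : exists2 E', controlled E' & forall A, approx_at (U \o T A \o V) e E'.
  apply: (approx_at_uniform hY (M := 1)) e0 => //.
  - move=> A; apply: UVapprox; apply: approximable_controlled Ec _; first exact: (Tb A).1.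
    exact: orthonormal_support (TG A) abE.
  - move=> A v; rewrite mul1r /= unitary_norm -(unitary_inv_norm v).
    exact: (Tb A).2.
  - by move=> A j v Aj /=; rewrite (Tpt A j)// (linear_opD unitary_bounded.1).
  - move=> A v w d d0; have w0 : 0 < hnorm (V w) + 1 by rewrite ltr_wpDl ?hnorm_ge0.
    pose d' := d / (hnorm (V w) + 1).
    have d'0 : 0 < d' by rewrite divr_gt0.
    (* Sub-sums over sets agreeing below [m] differ only in Bessel coefficients of [V v] with square
       sum at most [d' ^+ 2]; this is the weak continuity in the index set. *)
    have [|m mP] := bessel_tail (V v) ob (_ : 0 < d' ^+ 2); first by rewrite exprn_gt0.
    exists `I_m; first exact: finite_II.
    move=> A' AA'; rewrite /= -(bounded_opBE unitary_bounded) (adjoint_rinE unitary_adj).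
    have diff (B B' : set nat) : agree `I_m B B' ->
        rin (T B (V v) - T B' (V v)) (V w) <= d.
      move=> BB'; rewrite rinBl; apply: (cvg_le GP (cvgB (TG B _ _) (TG B' _ _))) => n.
      change (rin (\sum_(k < n) (if `[< B k >] then inner C (V v) (b k) else 0) *: a k) (V w) -
        rin (\sum_(k < n) (if `[< B' k >] then inner C (V v) (b k) else 0) *: a k) (V w) <= d).
      rewrite -rinBl -sumrB; under eq_bigr do rewrite -scalerBl.
      apply: (le_trans (rin_le _ _)).
      apply: (@le_trans _ _ (d' * hnorm (V w))); last first.
        by rewrite mulrAC ler_pdivrMr// ler_wpM2l ?(ltW d0)// lerDl.
      rewrite ler_wpM2r ?hnorm_ge0// -(@ler_pXn2r _ 2) ?nnegrE ?hnorm_ge0 ?(ltW d'0)//.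
      pose c k := (if `[< B k >] then inner C (V v) (b k) else 0) -
                  (if `[< B' k >] then inner C (V v) (b k) else 0).
      rewrite (orthonormal_sum_sq c n oa); apply: le_trans (mP n).
      apply: ler_sum => k _; rewrite /c; have [mk|km] := leqP m k.
        have [_|_] := boolP `[< B k >]; have [_|_] := boolP `[< B' k >].
        + by rewrite subrr cabs0 expr0n sqr_ge0.
        + by rewrite subr0.
        + by rewrite sub0r /cabs normrN.
        + by rewrite subrr cabs0 expr0n sqr_ge0.
      rewrite (asbool_equiv_eq (BB' k km)) subrr cabs0 expr0n//.
    rewrite ler_norml diff// andbT lerNl -rinNl opprB diff// => k km.
    by rewrite (AA' k km).
exists E' => // k; have := E'P [set k].
by rewrite Tk unitary_rank_one.
Qed.

End UniformFamilies.

(** * Dependent choice with full memory *)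

Section DependentSequences.
Context {T : Type} (Q : seq T -> T -> Prop).

Fixpoint hereditary (l : seq T) : Prop :=
  if l is t :: l' then hereditary l' /\ Q l' t else True.

Fixpoint history (f : nat -> T) n : seq T :=
  if n is m.+1 then f m :: history f m else [::].

Lemma size_history f n : size (history f n) = n.
Proof. by elim: n => //= n ->. Qed.

Lemma In_history f n i : (i < n)%N -> List.In (f i) (history f n).
Proof.
elim: n => //= n IH; rewrite ltnS leq_eqVlt => /orP[/eqP ->|/IH]; [by left|by right].
Qed.

(** Each choice sees all earlier ones, latest first; the length of the list tells the stage. *)
Lemma dependent_sequence : (forall l, hereditary l -> exists t, Q l t) ->
  exists f : nat -> T, forall n, Q (history f n) (f n).
Proof.
move=> ex; have /choice [next nextP] : forall l : {l | hereditary l}, exists t, Q (sval l) t.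
  by move=> [l lh]; exact: ex.
pose S := fix S n : {l | hereditary l} := if n is m.+1
  then exist hereditary (next (S m) :: sval (S m)) (conj (svalP (S m)) (nextP (S m)))
  else exist hereditary [::] I.
have SE n : sval (S n) = history (fun i => next (S i)) n by elim: n => //= n ->.
by exists (fun n => next (S n)) => n; rewrite -SE; exact: nextP.
Qed.

End DependentSequences.

Section LocalFiniteness.
Context {X : lfCoarseSpace}.

Lemma thickening_finite (E : set (X * X)) (A : set X) :
  controlled E -> finite_set A -> finite_set (thickening E A).
Proof.
move=> Ec Af; have -> : thickening E A = \bigcup_(a in A) thickening E [set a].
  apply/seteqP; split => [x [a Aa Exa]|x [a Aa [_ -> Exa]]]; last by exists a.
  by exists a => //; exists a.
apply: bigcup_finite => // a _; apply: lf_spaceP.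
exists ((E^-1)%relation \; E)%relation.
  apply: (coarse_compose (controlledP X)) => //.
  exact: (coarse_transpose (controlledP X)).
by move=> [x y] [/= [_ -> Exa] [_ -> Eya]]; exists a.
Qed.

Lemma bounded_finite (E : set (X * X)) (A : set X) :
  controlled E -> E_bounded E A -> finite_set A.
Proof. by move=> Ec EA; apply: lf_spaceP; exists E. Qed.

End LocalFiniteness.

(** * Uniform quasi-locality of rank one images *)

Section UniformRankOne.
Context {R : realType} {X Y : lfCoarseSpace} (hY : countably_generated Y).
Context {C : coarseModule R X} {D : coarseModule R Y} {U : C -> D} {V : D -> C}.
Hypothesis UV : unitary_pair U V.
Hypothesis UVapprox : forall t : C -> C, approximable t -> approximable (U \o t \o V).

Let Ub := unitary_bounded UV.

Lemma proj_unitary_le (B : set Y) u : hnorm (cm_proj D B (U u)) <= hnorm u.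
Proof. by rewrite -(unitary_norm UV) cm_proj_le. Qed.

(** Makes a vector orthogonal to earlier choices without losing what it has far away: each [U b] is
    almost finitely supported, so outside a large finite set the subtracted components are
    invisible. *)
Lemma project_off (x : X) (l : seq C) (e : R) : 0 < e ->
  hereditary (fun l b => [/\ cm_proj C [set x] b = b, hnorm b = 1
                & forall b', List.In b' l -> inner C b b' = 0]) l ->
  exists2 M0 : set Y, finite_set M0 & forall M : set Y, M0 `<=` M ->
    forall u, cm_proj C [set x] u = u -> exists u',
      [/\ cm_proj C [set x] u' = u', hnorm u' <= hnorm u,
          forall b, List.In b l -> inner C u' b = 0
        & hnorm (cm_proj D (~` M) (U u) - cm_proj D (~` M) (U u')) <= e * hnorm u].
Proof.
elim: l e => [|b l IH] e e0 /=.
  move=> _; exists set0 => // M _ u ux; exists u; split => //.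
  by rewrite subrr hnorm0 mulr_ge0 ?hnorm_ge0 ?ltW.
move=> [hl [bx b1 bl]]; have e2 : 0 < e / 2 by rewrite divr_gt0.
have [M0 M0f M0P] := IH _ e2 hl.
have [G Gf Gb] := finite_support_approx (U b) e2.
exists (M0 `|` G); first by rewrite finite_setU.
move=> M MM u ux.
have [|u' [u'x u'u u'l u'e]] := M0P M _ u ux; first by move=> y M0y; apply: MM; left.
exists (u' - inner C u' b *: b); split.
- by rewrite cm_projB cm_projZ u'x bx.
- apply: le_trans u'u; rewrite ler_hnorm_sq hnormB_sq hnormZ -/(cabs _) b1 mulr1.
  have -> : rin u' (inner C u' b *: b) = cabs (inner C u' b) ^+ 2.
    by rewrite /rin innerZr mulrC -cabs_sq.
  have := sqr_ge0 (cabs (inner C u' b)); lra.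
- move=> b' [<-|b'l]; rewrite innerBl innerZl.
    by rewrite inner_self b1 expr1n mulr1 subrr.
  by rewrite u'l// bl// mulr0 subr0.
- rewrite (bounded_opBE Ub) cm_projB opprB addrCA addrC.
  apply: (le_trans (hnormD _ _)); rewrite [X in X * _](splitr e) mulrDl lerD//.
  rewrite (bounded_opZ Ub) cm_projZ hnormZ -/(cabs _) mulrC.
  apply: ler_pM; rewrite ?hnorm_ge0 ?cabs_ge0//.
    apply: le_trans Gb; rewrite -cm_projCE; apply: cm_proj_mono; apply: subsetC.
    by move=> y Gy; apply: MM; right.
  by apply: (le_trans (inner_cabs_le _ _)); rewrite b1 mulr1.
Qed.

(* Otherwise an orthonormal sequence [c] with range in the fibre over [x] and finite
   sets [r n] carrying a fixed amount of the mass of [U (c n)], each far from the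
   previous ones, would make the rank one operators [c (2 n + 1) c (2 n)^*] violate
   [uniform_orthonormal]. *)
Lemma unitary_point_localized (x : X) (e : R) : 0 < e ->
  exists2 M : set Y, finite_set M & forall u, cm_proj C [set x] u = u ->
    hnorm (cm_proj D (~` M) (U u)) <= e * hnorm u.
Proof.
move=> e0; apply: contrapT => no.
have big M : finite_set M -> exists u, cm_proj C [set x] u = u /\
    e * hnorm u < hnorm (cm_proj D (~` M) (U u)).
  move=> Mf; apply: contrapT => h; apply: no; exists M => // u ux.
  by rewrite leNgt; apply/negP => ue; apply: h; exists u.
have [E [Ec Em Ecof]] := controlled_cofinal hY.
pose Q (l : seq (C * set Y)) (p : C * set Y) :=
  [/\ [/\ cm_proj C [set x] p.1 = p.1, hnorm p.1 = 1
        & forall b', List.In b' (map fst l) -> inner C p.1 b' = 0],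
      finite_set p.2, e / 4 < hnorm (cm_proj D p.2 (U p.1))
    & forall q, List.In q l -> forall y y', p.2 y -> q.2 y' -> ~ E (size l) (y, y')].
have [|f fQ] := @dependent_sequence _ Q.
  move=> l hl.
  have hl' : hereditary (fun l b => [/\ cm_proj C [set x] b = b, hnorm b = 1
      & forall b', List.In b' l -> inner C b b' = 0]) (map fst l).
    by elim: l hl => //= p l IH [/IH hl [hp _ _ _]].
  have [|M0 M0f M0P] := project_off (_ : 0 < e / 2) hl'; first by rewrite divr_gt0.
  have [M1 M1f M1P] : exists2 M1, finite_set M1 &
      forall q, List.In q l -> thickening (E (size l)) q.2 `<=` M1.
    move: (size l) => n; elim: l hl {hl' M0 M0f M0P} => [|q l IH] /=.
      by move=> _; exists set0.
    move=> [/IH [M1 M1f M1P] [_ qf _ _]]; exists (thickening (E n) q.2 `|` M1).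
      by rewrite finite_setU; split => //; exact: thickening_finite.
    move=> q' [<- y ?|/M1P h y /h ?]; [by left|by right].
  (* [M0] protects the norm during orthogonalisation; [M1] keeps the new set far from all previous
     ones. *)
  have [|u [ux ue]] := big (M0 `|` M1); first by rewrite finite_setU.
  have [|u' [u'x u'u u'l u'e]] := M0P (M0 `|` M1) _ u ux; first by move=> y; left.
  have u'2 : e / 2 * hnorm u' < hnorm (cm_proj D (~` (M0 `|` M1)) (U u')).
    have := hnorm_leB (cm_proj D (~` (M0 `|` M1)) (U u)) (cm_proj D (~` (M0 `|` M1)) (U u')).
    move: ue u'e; have : e / 2 * hnorm u' <= e / 2 * hnorm u.
      by rewrite ler_wpM2l// divr_ge0// ltW.
    by clear => *; lra.
  have u'0 : 0 < hnorm u'.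
    rewrite lt_def hnorm_ge0 andbT; apply/eqP => u'0.
    move: u'2; rewrite (hnorm_eq0 u'0) (linear_op0 Ub.1) cm_proj_v0 !hnorm0 mulr0.
    by rewrite ltxx.
  pose b := ((hnorm u')^-1)%:C *: u'.
  have b1 : hnorm b = 1.
    by rewrite hnormZr ger0_norm ?invr_ge0 ?hnorm_ge0// mulVf// gt_eqF.
  have b2 : e / 4 < hnorm (cm_proj D (~` (M0 `|` M1)) (U b)).
    rewrite (bounded_opZ Ub) cm_projZ hnormZr ger0_norm ?invr_ge0 ?hnorm_ge0//.
    rewrite [ltRHS]mulrC ltr_pdivlMr//; apply: lt_trans u'2.
    by rewrite ltr_pM2r// ltr_pM2l// ltf_pV2 ?posrE// ltr_nat.
  have [G [Gf GM Gb]] := proj_norm_finite b2.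
  exists (b, G); split => //=.
  - split => //; first by rewrite cm_projZ u'x.
    by move=> b' b'l; rewrite innerZl u'l// mulr0.
  - move=> q ql y y' Gy qy' Eyy'; apply: (GM y Gy); right; apply: (M1P q ql).
    by exists y'.
have fx n : cm_proj C [set x] (f n).1 = (f n).1 by have [[]] := fQ n.
have fo : orthonormal_seq (fun n => (f n).1).
  have lt i j : (i < j)%N -> inner C (f j).1 (f i).1 = 0.
    move=> ij; have [[_ _ h] _ _ _] := fQ j; apply: h.
    by apply: List.in_map; exact: In_history.
  move=> i j; have [ij|ji|->] := ltngtP i j.
  - by rewrite innerC lt// conjC0.
  - by rewrite lt.
  - by have [[_ h _] _ _ _] := fQ j; rewrite inner_self h expr1n.
pose a n := (f n.*2.+1).1; pose b n := (f n.*2).1.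
have oa : orthonormal_seq a by move=> i j; rewrite fo eqSS -!muln2 eqn_pmul2r.
have ob : orthonormal_seq b by move=> i j; rewrite fo -!muln2 eqn_pmul2r.
have e4 : 0 < e / 4 by rewrite divr_gt0.
(* Orthogonalisation costs [e / 2] and cutting to a finite set leaves more than [e / 4], so the
   product of two such norms exceeds this square. *)
have ee : 0 < (e / 4) ^+ 2 by rewrite exprn_gt0.
have [|E' E'c E'P] := uniform_orthonormal hY UV UVapprox ee oa ob
   (coarse_diagonal (controlledP X)).
  move=> k; apply: subset_trans (rank_one_support (fx _) (fx _)) _.
  by move=> [y z] [/= -> ->].
have [n E'n] := Ecof _ E'c.
have [_ _ ma far] := fQ n.*2.+1; have [_ _ mb _] := fQ n.*2.
have := rank_one_separated (ltW ee) (E'P n) (B' := (f n.*2.+1).2) (B := (f n.*2).2).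
move=> /(_ _); have sep y y' : (f n.*2.+1).2 y -> (f n.*2).2 y' -> ~ E' (y, y').
  move=> fy fy' /E'n Eyy'; apply: (far (f n.*2) _ y y' fy fy').
    exact: In_history.
  rewrite size_history; apply: Em Eyy'.
  by rewrite -addnn -addnS leq_addr.
move=> /(_ sep); rewrite leNgt => /negP; apply.
by rewrite expr2 ltr_pM// ltW.
Qed.

Lemma unitary_finite_localized (K : set X) (e : R) : finite_set K -> 0 < e ->
  exists2 M : set Y, finite_set M & forall u, cm_proj C K u = u ->
    hnorm (cm_proj D (~` M) (U u)) <= e * hnorm u.
Proof.
move=> Kf; move: K Kf e; apply: (@finite_set_ind X (fun K => forall e : R, 0 < e ->
  exists2 M : set Y, finite_set M & forall u, cm_proj C K u = u ->
    hnorm (cm_proj D (~` M) (U u)) <= e * hnorm u)).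
  move=> e e0; exists set0 => // u; rewrite cm_proj0 => <-.
  by rewrite (linear_op0 Ub.1) cm_proj_v0 !hnorm0 mulr0.
move=> x K IH e e0; have e2 : 0 < e / 2 by rewrite divr_gt0.
have [M Mf MP] := IH _ e2; have [M' M'f M'P] := unitary_point_localized x e2.
exists (M `|` M') => [|u uK]; first by rewrite finite_setU.
have -> : u = cm_proj C [set x] u + cm_proj C ((x |` K) `\ x) u.
  by rewrite -cm_projD1 ?uK//; left.
rewrite (linear_opD Ub.1) cm_projD; apply: (le_trans (hnormD _ _)).
have -> : cm_proj C [set x] u + cm_proj C ((x |` K) `\ x) u = u.
  by rewrite -cm_projD1 ?uK//; left.
rewrite [X in X * _](splitr e) mulrDl addrC; apply: lerD.
  apply: (@le_trans _ _ (e / 2 * hnorm (cm_proj C ((x |` K) `\ x) u))); last first.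
    by rewrite ler_wpM2l ?(ltW e2)// cm_proj_le.
  apply: le_trans (MP _ _); first by apply: cm_proj_mono; apply: subsetC; left.
  by apply: cm_proj_id (cm_projK _ _) => z [[->|//] /(_ erefl)].
apply: (@le_trans _ _ (e / 2 * hnorm (cm_proj C [set x] u))); last first.
  by rewrite ler_wpM2l ?(ltW e2)// cm_proj_le.
apply: le_trans (M'P _ (cm_projK _ _)).
by apply: cm_proj_mono; apply: subsetC; right.
Qed.

(** A nonzero entry cannot be removed by an approximation within half its size. This certifies
    single pairs as entourages, which is not automatic when [Y] is coarsely disconnected. *)
Lemma rank_one_entry_controlled (F : set (X * X)) (A : set X) a b y y' : controlled F ->
  E_bounded F A -> cm_proj C A a = a -> cm_proj C A b = b ->
  cm_proj D [set y] (U a) <> 0 -> cm_proj D [set y'] (U b) <> 0 ->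
  controlled [set (y, y')].
Proof.
move=> Fc FA aA bA ya y'b.
have : approximable (rank_one (U a) (U b)).
  rewrite -(unitary_rank_one UV); apply: UVapprox.
  apply: approximable_controlled Fc _; first exact: rank_one_bounded.
  exact: subset_trans (rank_one_support aA bA) FA.
have norm_gt0 (v : D) : v <> 0 -> 0 < hnorm v.
  by move=> v0; rewrite lt_def hnorm_ge0 andbT; apply/eqP => /hnorm_eq0.
have p0 : 0 < hnorm (cm_proj D [set y] (U a)) * hnorm (cm_proj D [set y'] (U b)).
  by rewrite mulr_gt0 ?norm_gt0.
move=> /approximableP[_ /(_ _ (divr_gt0 p0 (ltr0n _ 2)))] [E Ec /rank_one_separated].
move=> /(_ (ltW (divr_gt0 p0 (ltr0n _ 2)))) sep.
apply: (coarse_subset (controlledP Y)) Ec => _ ->; apply: contrapT => nE.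
have := sep [set y] [set y'].
have h y0 z : [set y] y0 -> [set y'] z -> ~ E (y0, z) by move=> -> ->.
by move=> /(_ h); move: p0; clear => *; lra.
Qed.

Lemma cm_proj_split (B M : set Y) (w : D) :
  hnorm (cm_proj D B w) <= hnorm (cm_proj D (B `&` M) w) + hnorm (cm_proj D (~` M) w).
Proof.
have -> : cm_proj D B w = cm_proj D (B `&` M) w + cm_proj D (B `&` ~` M) w.
  by rewrite -!cm_projM -cm_projD cm_projCE addrC subrK.
apply: (le_trans (hnormD _ _)); rewrite lerD2l; apply: cm_proj_mono.
exact: subIsetr.
Qed.

(** Over a finite [K] all images lie in one finite [M] up to [d]. The entourage consists of the
    pairs in [M] that are entourages by themselves; separation from it forces [p * q = 0], leaving
    at most [3 * d] from the product [(p + d) * (q + d)]. *)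
Lemma uniform_rank_one_finite (F : set (X * X)) (K : set X) (e : R) : 0 < e ->
  controlled F -> finite_set K ->
  exists2 E, controlled E & forall A a b, E_bounded F A -> A `<=` K ->
    cm_proj C A a = a -> cm_proj C A b = b -> hnorm a = 1 -> hnorm b = 1 ->
    separated_small (U a) (U b) e E.
Proof.
move=> e0 Fc Kf; pose d := Num.min 1 (e / 3).
have d0 : 0 < d by rewrite lt_min ltr01 divr_gt0.
have d1 : d <= 1 by rewrite ge_min lexx.
have de : d <= e / 3 by rewrite ge_min lexx orbT.
have [M Mf MP] := unitary_finite_localized Kf d0.
pose E := [set z | exists2 yy, ((M `*` M) `&` [set yy | controlled [set yy]]) yy & [set yy] z].
have Ec : controlled E.
  apply: controlled_finite_union; last by move=> yy [].
  by apply: finite_setIl; exact: finite_setX.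
exists E => // A a b FA AK aA bA a1 b1 B' B sep.
have aK : cm_proj C K a = a by exact: cm_proj_id aA.
have bK : cm_proj C K b = b by exact: cm_proj_id bA.
set p := hnorm (cm_proj D (B' `&` M) (U a)); set q := hnorm (cm_proj D (B `&` M) (U b)).
have ha : hnorm (cm_proj D B' (U a)) <= p + d.
  apply: (le_trans (cm_proj_split _ M _)); rewrite lerD2l -[leRHS]mulr1 -a1.
  exact: MP.
have hb : hnorm (cm_proj D B (U b)) <= q + d.
  apply: (le_trans (cm_proj_split _ M _)); rewrite lerD2l -[leRHS]mulr1 -b1.
  exact: MP.
have p0 : 0 <= p by exact: hnorm_ge0. have q0 : 0 <= q by exact: hnorm_ge0.
have p1 : p <= 1 by rewrite -a1 proj_unitary_le.
have q1 : q <= 1 by rewrite -b1 proj_unitary_le.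
have pq : p * q = 0.
  apply/eqP; rewrite mulf_eq0; apply: contrapT => /negP.
  rewrite negb_or => /andP[/eqP pn /eqP qn].
  have nz (B0 : set Y) w : hnorm (cm_proj D B0 w) <> 0 ->
      exists2 y, B0 y & cm_proj D [set y] w <> 0.
    move=> w0; apply: contrapT => h; apply: w0.
    rewrite (_ : cm_proj D B0 w = 0) ?hnorm0//; apply: proj_zero => y; rewrite cm_projM.
    have [By|nBy] := pselect (B0 y).
      have -> : [set y] `&` B0 = [set y] by apply/setIidPl => _ ->.
      by apply: contrapT => yw; apply: h; exists y.
    rewrite (_ : _ `&` _ = set0) ?cm_proj0//.
    by rewrite -subset0 => _ [->].
  have [y [By My] ya] := nz _ _ pn; have [y' [By' My'] yb] := nz _ _ qn.
  apply: (sep y y' By By'); exists (y, y') => //; split => //.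
  exact: rank_one_entry_controlled Fc FA aA bA ya yb.
apply: (@le_trans _ _ ((p + d) * (q + d))); first by apply: ler_pM; rewrite ?hnorm_ge0.
have h1 : p * d <= d by rewrite ler_piMl// ltW.
have h2 : d * q <= d by rewrite ler_piMr// ltW.
have h3 : d * d <= d by rewrite ler_piMr// ltW.
rewrite mulrDl !mulrDr pq; move: h1 h2 h3 de; clear; lra.
Qed.

(* Along a sequence of counterexamples the sets [A] can be taken pairwise disjoint,
   by [uniform_rank_one_finite], and then [uniform_orthonormal] applies. *)
Lemma uniform_rank_one (F : set (X * X)) (e : R) : 0 < e -> controlled F ->
  exists2 E, controlled E & forall A a b, E_bounded F A ->
    cm_proj C A a = a -> cm_proj C A b = b ->
    separated_small (U a) (U b) (e * hnorm a * hnorm b) E.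
Proof.
move=> e0 Fc.
suff [E Ec EP] : exists2 E, controlled E & forall A a b, E_bounded F A ->
    cm_proj C A a = a -> cm_proj C A b = b -> hnorm a = 1 -> hnorm b = 1 ->
    separated_small (U a) (U b) e E.
  exists E => // A a b FA aA bA B' B sep.
  have [a0|a0] := eqVneq (hnorm a) 0.
    rewrite (hnorm_eq0 a0) (linear_op0 Ub.1) cm_proj_v0 hnorm0 mul0r.
    by rewrite hnorm0 mulr0 mul0r.
  have [b0|b0] := eqVneq (hnorm b) 0.
    by rewrite b0 (hnorm_eq0 b0) (linear_op0 Ub.1) cm_proj_v0 hnorm0 !mulr0.
  have ap : 0 < hnorm a by rewrite lt_def a0 hnorm_ge0.
  have bp : 0 < hnorm b by rewrite lt_def b0 hnorm_ge0.
  have := EP A (((hnorm a)^-1)%:C *: a) (((hnorm b)^-1)%:C *: b) FA.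
  rewrite !cm_projZ aA bA !hnormZr !ger0_norm ?invr_ge0 ?hnorm_ge0// !mulVf//.
  move=> /(_ erefl erefl erefl erefl B' B sep).
  rewrite !(bounded_opZ Ub) !cm_projZ !hnormZr !ger0_norm ?invr_ge0 ?hnorm_ge0//.
  by rewrite mulrACA -invfM mulrC ler_pdivrMr ?mulr_gt0// mulrA.
have [E [Ec Em Ecof]] := controlled_cofinal hY.
apply: contrapT => no.
pose Bad n (t : set X * (C * C)) := [/\ E_bounded F t.1,
  cm_proj C t.1 t.2.1 = t.2.1 /\ cm_proj C t.1 t.2.2 = t.2.2,
  hnorm t.2.1 = 1 /\ hnorm t.2.2 = 1
  & ~ separated_small (U t.2.1) (U t.2.2) e (E n)].
have bad n : exists t, Bad n t.
  apply: contrapT => h; apply: no; exists (E n) => // A a b FA aA bA a1 b1.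
  by apply: contrapT => s; apply: h; exists (A, (a, b)).
have badS m n t : (m <= n)%N -> Bad n t -> Bad m t.
  move=> mn [? ? ? ns]; split => // s; apply: ns.
  by apply: separated_smallS s => //; exact: Em.
(* A bounded set meeting a point [g] lies in the finite [F]-neighbourhood of [g], where one
   entourage already works; counterexamples for large entourages must miss [g]. *)
have avoid (G : set X) : finite_set G ->
    exists N, forall t, Bad N t -> forall g, G g -> ~ t.1 g.
  move: G; apply: finite_set_ind; first by exists 0%N.
  move=> g G [N NP].
  have Kf : finite_set (thickening F [set g]).
    by apply: thickening_finite => //; exact: finite_set1.
  have [E' E'c E'P] := uniform_rank_one_finite e0 Fc Kf.
  have [N' N'E] := Ecof _ E'c.
  exists (maxn N N') => t tb g' [->|Gg']; last first.
    by apply: NP Gg'; apply: badS tb; exact: leq_maxl.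
  have [FA [aA bA] [a1 b1] ns] := badS N' _ _ (leq_maxr _ _) tb.
  move=> tg; apply: ns; apply: separated_smallS (E'P _ _ _ FA _ aA bA a1 b1) => //.
  by move=> z tz; exists g => //; exact: (FA (z, g)).
pose Q (l : seq (set X * (C * C))) t :=
  Bad (size l) t /\ forall q, List.In q l -> t.1 `&` q.1 = set0.
have [|f fQ] := @dependent_sequence _ Q.
  move=> l hl.
  have [G Gf GP] : exists2 G, finite_set G & forall q, List.In q l -> q.1 `<=` G.
    elim: l hl => [_|q l IH /= [/IH [G Gf GP] [[FA _ _ _] _]]]; first by exists set0.
    exists (q.1 `|` G); first by rewrite finite_setU; split => //; exact: bounded_finite FA.
    by move=> q' [<-|/GP h] x qx; [left|right; exact: h].
  have [N NP] := avoid G Gf.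
  have [t tb] := bad (maxn N (size l)).
  exists t; split; first by apply: badS tb; exact: leq_maxr.
  move=> q ql; rewrite -subset0 => x [tx qx].
  apply: (NP t _ x (GP q ql x qx) tx); apply: badS tb; exact: leq_maxl.
have disj i j : i != j -> (f i).1 `&` (f j).1 = set0.
  rewrite neq_ltn => /orP[ij|ji].
    by rewrite setIC; have [_ h] := fQ j; apply: h; exact: In_history.
  by have [_ h] := fQ i; apply: h; exact: In_history.
have ortho (a : nat -> C) : (forall n, cm_proj C (f n).1 (a n) = a n) ->
    (forall n, hnorm (a n) = 1) -> orthonormal_seq a.
  move=> af a1 i j; have [->|ij] := eqVneq i j; first by rewrite inner_self a1 expr1n.
  rewrite -(af i) -(af j) [inner _ _ _](cm_proj_adj) cm_projM disj// cm_proj0.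
  by rewrite linear0r.
have [|||E' E'c E'P] := @uniform_orthonormal _ _ _ hY _ _ _ _ UV UVapprox
   (fun n => (f n).2.1) (fun n => (f n).2.2) F e e0 _ _ Fc.
- by apply: ortho => n; have [[_ [? ?] [? ?] _] _] := fQ n.
- by apply: ortho => n; have [[_ [? ?] [? ?] _] _] := fQ n.
- move=> n; have [[FA [? ?] _ _] _] := fQ n.
  exact: subset_trans (rank_one_support _ _) FA.
have [n E'n] := Ecof _ E'c.
have [[_ _ _ ns] _] := fQ n; apply: ns; rewrite size_history.
by apply: separated_smallS (rank_one_separated (ltW e0) (E'P n)).
Qed.

End UniformRankOne.

(** * Calculus of entourages *)

Section Coarse.
Context {X : coarseSpace}.
Let P := controlledP X.

Lemma controlled_diag : controlled [set xy : X * X | xy.1 = xy.2].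
Proof. exact: coarse_diagonal P. Qed.

Lemma controlledS (A B : set (X * X)) : A `<=` B -> controlled B -> controlled A.
Proof. exact: (coarse_subset P). Qed.

Definition rel_comp (A B : set (X * X)) : set (X * X) :=
  [set xz | exists2 y, A (xz.1, y) & B (y, xz.2)].

Lemma controlled_comp (A B : set (X * X)) : controlled A -> controlled B ->
  controlled (rel_comp A B).
Proof.
move=> Ac Bc; apply: controlledS (coarse_compose P Bc Ac).
by move=> [x z] [y Axy Byz]; exists y.
Qed.

Definition rel_inv (A : set (X * X)) : set (X * X) := [set xy | A (xy.2, xy.1)].

Lemma controlled_inv (A : set (X * X)) : controlled A -> controlled (rel_inv A).
Proof. by move=> Ac; apply: controlledS (coarse_transpose P Ac) => -[x y]. Qed.

Lemma controlledU (A B : set (X * X)) : controlled A -> controlled B -> controlled (A `|` B).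
Proof. exact: (coarse_union P). Qed.

End Coarse.

(** The sets lying inside a product of two entourages are already closed under all coarse
    operations. *)
Lemma product_controlledP (Y X : coarseSpace) (D : set ((Y * X) * (Y * X))) :
  @controlled (product_coarse Y X) D <-> exists E' E, [/\ controlled E', controlled E
    & D `<=` [set pq | E' (pq.1.1, pq.2.1) /\ E (pq.1.2, pq.2.2)]].
Proof.
split; last first.
  move=> [E' [E [E'c Ec DE]]] S SP FS; apply: (coarse_subset SP DE); apply: FS.
  by exists E', E.
move=> /(_ [set D | exists E' E, [/\ controlled E', controlled E
    & D `<=` [set pq : (Y * X) * (Y * X) | E' (pq.1.1, pq.2.1) /\ E (pq.1.2, pq.2.2)]]]).
apply; last by move=> _ [E' [E [E'c Ec ->]]]; exists E', E; split.
split.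
- exists [set xy | xy.1 = xy.2], [set xy | xy.1 = xy.2].
  by split; [exact: controlled_diag|exact: controlled_diag|move=> [p q] /= ->].
- by move=> A B AB [E' [E [E'c Ec BE]]]; exists E', E; split => // z /AB /BE.
- move=> A B [E' [E [E'c Ec AE]]] [F' [F [F'c Fc BF]]].
  exists (E' `|` F'), (E `|` F); split; [exact: controlledU|exact: controlledU|].
  by move=> z [/AE [? ?]|/BF [? ?]]; split; [left|left|right|right].
- move=> A [E' [E [E'c Ec AE]]]; exists (rel_inv E'), (rel_inv E).
  split; [exact: controlled_inv|exact: controlled_inv|].
  by move=> [p q] /AE.
- move=> A B [E' [E [E'c Ec AE]]] [F' [F [F'c Fc BF]]].
  exists (rel_comp F' E'), (rel_comp F E); split; [exact: controlled_comp|exact: controlled_comp|].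
  by move=> [p q] [z /BF /= [? ?] /AE /= [? ?]]; split; [exists z.1|exists z.2].
Qed.

(** The contradiction is 9/16 against 1/4. *)
Lemma mass_gap (R : realType) (n n' k k' p q : R) :
  0 < n -> 0 < n' -> 0 <= k -> 0 <= k' -> k <= n -> k' <= n' ->
  3 / 4 * n <= p -> 3 / 4 * n' <= q -> ~ p * q <= 4^-1 * k * k'.
Proof.
move=> n_gt0 n'_gt0 k0 k'0 kn kn' np n'q pqk.
have h1 : (3 / 4 * n) * (3 / 4 * n') <= p * q.
  by apply: ler_pM => //; apply: mulr_ge0; rewrite ?divr_ge0// ltW.
have h2 : k * k' <= n * n' by apply: ler_pM.
have h3 : 0 < n * n' by rewrite mulr_gt0.
by move: h1 h2 h3 pqk => *; lra.
Qed.

(** * Concentration of the image of a fibre *)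

Section Concentration.
Context {R : realType}.

Definition module_support (X : lfCoarseSpace) (C : coarseModule R X) : set X :=
  [set x | cm_proj C [set x] <> (fun=> 0)].

(* [U] carries half of the mass of the unit vector [v x] in the fibre over [x] to the
   uniformly bounded set [G x], which contains [g x]. *)
Record concentrates (X Y : lfCoarseSpace) (C : coarseModule R X) (D : coarseModule R Y)
    (U : C -> D) (g : X -> Y) (v : X -> C) (G : X -> set Y) (E0 : set (Y * Y)) : Prop := {
  conc_controlled : controlled E0;
  conc_fibre : forall x, module_support C x -> cm_proj C [set x] (v x) = v x;
  conc_unit : forall x, module_support C x -> hnorm (v x) = 1;
  conc_mem : forall x, module_support C x -> G x (g x);
  conc_bounded : forall x, module_support C x -> E_bounded E0 (G x);
  conc_half : forall x, module_support C x -> 2^-1 <= hnorm (cm_proj D (G x) (U (v x)));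
  conc_support : forall x, module_support C x -> module_support D (g x) }.

Lemma unitary_pair_sym (H K : hilbertType R) (U : H -> K) (V : K -> H) :
  unitary_pair U V -> unitary_pair V U.
Proof. by case=> Ub Vb UV UK VK; split => //; exact: adjoint_sym. Qed.

Lemma module_support_unit (X : lfCoarseSpace) (C : coarseModule R X) x :
  module_support C x -> exists2 v, cm_proj C [set x] v = v & hnorm v = 1.
Proof.
move=> xC; have [u u0] : exists u, cm_proj C [set x] u <> 0.
  apply: contrapT => h; apply: xC; apply/funext => u.
  by apply: contrapT => u0; apply: h; exists u.
have n0 : hnorm (cm_proj C [set x] u) != 0 by apply/eqP => /hnorm_eq0.
exists ((hnorm (cm_proj C [set x] u))^-1%:C *: cm_proj C [set x] u).
  by rewrite cm_projZ cm_projK.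
by rewrite hnormZr ger0_norm ?invr_ge0 ?hnorm_ge0// mulVf.
Qed.

Lemma module_supportP (X : lfCoarseSpace) (C : coarseModule R X) x u :
  cm_proj C [set x] u <> 0 -> module_support C x.
Proof. by move=> u0 x0; apply: u0; rewrite x0. Qed.

Context {X Y : lfCoarseSpace} (hX : countably_generated X) (hY : countably_generated Y).
Context {C : coarseModule R X} {D : coarseModule R Y} {U : C -> D} {V : D -> C}.
Hypothesis UV : unitary_pair U V.
Hypothesis UVapprox : forall t : C -> C, approximable t -> approximable (U \o t \o V).
Hypothesis VUapprox : forall s : D -> D, approximable s -> approximable (V \o s \o U).

Let Ub := unitary_bounded UV.
Let Vb := unitary_inv_bounded UV.

(* The signs are chosen greedily, so that all cross terms are nonnegative. *)
Lemma signed_sum_mass (A : set X) (v : C) (c : R) (B : set Y) : 0 <= c -> finite_set B ->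
  (forall y, B y -> c * hnorm (cm_proj D [set y] (U v)) ^+ 2 <=
     hnorm (cm_proj C A (V (cm_proj D [set y] (U v)))) ^+ 2) ->
  exists B1 B2, [/\ B1 `<=` B, B2 `<=` B & c * hnorm (cm_proj D B (U v)) ^+ 2 <=
    hnorm (cm_proj C A (V (cm_proj D B1 (U v))) - cm_proj C A (V (cm_proj D B2 (U v)))) ^+ 2].
Proof.
move=> c0; pose W B := cm_proj C A (V (cm_proj D B (U v))).
move=> Bf; move: B Bf; apply: finite_set_ind.
  move=> _; exists set0, set0; split => //.
  by rewrite cm_proj0 hnorm0 expr0n mulr0 sqr_ge0.
move=> y B IH yB.
have [By|nBy] := pselect (B y).
  have -> : y |` B = B by apply/seteqP; split => [z [->|]//|z]; right.
  by apply: IH => z Bz; apply: yB; right.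
have [|B1 [B2 [B1B B2B Bm]]] := IH; first by move=> z Bz; apply: yB; right.
have Wy B0 : B0 `<=` B -> W (y |` B0) = W B0 + W [set y].
  move=> B0B; rewrite /W (cm_projD1 (A := y |` B0) (a := y)); last by left.
  have -> : (y |` B0) `\ y = B0.
    apply/seteqP; split => [z [[->|//] /(_ erefl)]//|z B0z]; split; first by right.
    by move=> zy; apply: nBy; rewrite -zy; exact: B0B.
  by rewrite (linear_opD Vb.1) cm_projD addrC.
have mass : hnorm (cm_proj D (y |` B) (U v)) ^+ 2 =
    hnorm (cm_proj D B (U v)) ^+ 2 + hnorm (cm_proj D [set y] (U v)) ^+ 2.
  rewrite (cm_projD1 (A := y |` B) (a := y)); last by left.
  have -> : (y |` B) `\ y = B.
    apply/seteqP; split => [z [[->|//] /(_ erefl)]//|z Bz]; split; first by right.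
    by move=> zy; apply: nBy; rewrite -zy.
  rewrite hnormD_sq cm_proj_rin cm_projM (_ : _ `&` _ = set0) ?cm_proj0 ?rin0r; first by lra.
  by rewrite -subset0 => _ [-> /nBy].
have ym := yB y (or_introl erefl); rewrite -/(W [set y]) in ym.
have [r0|r0] := leP 0 (rin (W B1 - W B2) (W [set y])).
  exists (y |` B1), B2; split; [by move=> z [->|/B1B]; [left|right]|by move=> z /B2B; right|].
  rewrite -/(W _) -/(W _) Wy// addrAC hnormD_sq mass; move: Bm ym r0.
  by rewrite -/(W _) -/(W _); clear; lra.
exists B1, (y |` B2); split; [by move=> z /B1B; right|by move=> z [->|/B2B]; [left|right]|].
rewrite -/(W _) -/(W _) Wy// opprD addrA hnormB_sq mass; move: Bm ym r0.
by rewrite -/(W _) -/(W _); clear; lra.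
Qed.

(** A point [y] is good if [V] returns the component of [U v] at [y] mostly to the bounded set [A]
    around [x]. Bad points carry little mass, since a signed sum of their components would leak out
    of [A]. Good points are mutually close: the returned vectors all live over [A], and their images
    keep 3/4 of the norm at their points, against the bound of [uniform_rank_one]. *)
Lemma fibre_concentration : exists2 E0, controlled E0 & forall x v,
  cm_proj C [set x] v = v -> hnorm v = 1 ->
  exists2 G : set Y, E_bounded E0 G & 2^-1 <= hnorm (cm_proj D G (U v)).
Proof.
(* The difference of [W B1] and [W B2] is then at most 1/16; with [c] equal to 1/16 this bounds the
   squared norm over bad points by 1/16. *)
have e32 : 0 < 32^-1 :> R by rewrite invr_gt0.
have [E Ec EP] := uniform_projections hX (unitary_pair_sym UV) VUapprox e32.
pose F := rel_comp E (rel_inv E).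
have Fc : controlled F by apply: controlled_comp => //; exact: controlled_inv.
have e4 : 0 < 4^-1 :> R by rewrite invr_gt0.
have [E0 E0c E0P] := uniform_rank_one hY UV UVapprox e4 Fc.
exists E0 => // x v xv v1; pose A := thickening E [set x].
have FA : E_bounded F A.
  by move=> [y z] [/= [_ -> Eyx] [_ -> Ezx]]; exists x.
pose W B := cm_proj C (~` A) (V (cm_proj D B (U v))).
have W32 B : hnorm (W B) <= 32^-1.
  have [s [sb sE se]] := EP B.
  have -> : W B = cm_proj C (~` A) (V (cm_proj D B (U v)) - s v).
    by rewrite cm_projB -{2}xv (support_thickening _ _ sb sE) subr0.
  by apply: (le_trans (cm_proj_le _ _)); have := se v; rewrite v1 mulr1.
have Uv1 : hnorm (U v) = 1 by rewrite (unitary_norm UV).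
have [S Sf Se] := finite_support_approx (U v) e4.
pose c : R := 16^-1.
have c0 : 0 <= c by rewrite /c invr_ge0.
(* The threshold is the square of 1/4: at most a quarter of the norm escapes [A]. *)
pose good y := hnorm (W [set y]) ^+ 2 < c * hnorm (cm_proj D [set y] (U v)) ^+ 2.
pose B := S `&` [set y | ~ good y]; pose G := S `&` [set y | good y].
have [||B1 [B2 [_ _ Bm]]] := @signed_sum_mass (~` A) v c B c0.
- exact: finite_setIl.
- by move=> y [_ /negP]; rewrite -leNgt.
exists G; last first.
  have mS : hnorm (cm_proj D S (U v)) ^+ 2 =
      hnorm (cm_proj D B (U v)) ^+ 2 + hnorm (cm_proj D G (U v)) ^+ 2.
    have := cm_proj_pythagoras [set y | ~ good y] (cm_proj D S (U v)).
    rewrite !cm_projM [_ `&` S]setIC => ->; congr (_ + hnorm (cm_proj D _ _) ^+ 2).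
    by apply/seteqP; split => y [? ?]; split => //; exact: contrapT.
  have := cm_proj_pythagoras S (U v); rewrite cm_projCE Uv1 mS.
  have := hnormB (W B1) (W B2); have := W32 B1; have := W32 B2; move: Bm Se.
  rewrite -/(W B1) -/(W B2) /c.
  have := hnorm_ge0 (W B1 - W B2); have := hnorm_ge0 (cm_proj D G (U v)).
  have := hnorm_ge0 (U v - cm_proj D S (U v)).
  move: (hnorm (W B1 - W B2)) (hnorm (W B1)) (hnorm (W B2)) (hnorm (cm_proj D B (U v)))
   (hnorm (cm_proj D G (U v))) (hnorm (U v - cm_proj D S (U v))); clear.
  move=> w w1 w2 b g s s0 g0 w0 h1 h2 h3 h4 h5 h6.
  have hw : w ^+ 2 <= (16^-1) ^+ 2 by rewrite ler_pXn2r ?nnegrE ?invr_ge0//; lra.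
  have hs : s ^+ 2 <= (4^-1) ^+ 2 by rewrite ler_pXn2r ?nnegrE ?invr_ge0.
  by rewrite -(@ler_pXn2r _ 2) ?nnegrE ?invr_ge0//; lra.
have key y : G y -> let a := cm_proj C A (V (cm_proj D [set y] (U v))) in
    [/\ 0 < hnorm (cm_proj D [set y] (U v)), cm_proj C A a = a,
        hnorm a <= hnorm (cm_proj D [set y] (U v))
      & 3 / 4 * hnorm (cm_proj D [set y] (U v)) <= hnorm (cm_proj D [set y] (U a))].
  move=> [_ gy]; set n := hnorm (cm_proj D [set y] (U v)) in gy *.
  have n0 : 0 < n.
    rewrite lt_def hnorm_ge0 andbT; apply/eqP => n0; move: gy.
    by rewrite /= /good -/n n0 expr0n mulr0 ltNge sqr_ge0.
  split => //; first by rewrite cm_projK.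
    by apply: (le_trans (cm_proj_le _ _)); rewrite (unitary_inv_norm UV).
  have -> : cm_proj C A (V (cm_proj D [set y] (U v))) =
      V (cm_proj D [set y] (U v)) - W [set y].
    by rewrite /W cm_projCE opprB addrC subrK.
  rewrite (bounded_opBE Ub) (unitary_invK UV) cm_projB cm_projK.
  have h1 := hnorm_leB (cm_proj D [set y] (U v))
    (cm_proj D [set y] (U v) - cm_proj D [set y] (U (W [set y]))).
  rewrite subKr in h1.
  have h2 := proj_unitary_le UV [set y] (W [set y]).
  have h3 : hnorm (W [set y]) <= n / 4.
    rewrite -(@ler_pXn2r _ 2) ?nnegrE ?hnorm_ge0 ?divr_ge0 ?(ltW n0)//.
    move: gy; rewrite /= /good /c -/n => /ltW; rewrite expr_div_n => h.
    by apply: (le_trans h); rewrite mulrC ler_wpM2l ?sqr_ge0// -natrX.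
  by move: h1 h2 h3; rewrite -/n; clear; lra.
move=> [y y'] [/= Gy Gy']; apply: contrapT => nE.
have [n0 aA an a3] := key y Gy; have [n'0 a'A a'n a'3] := key y' Gy'.
have sep z z' : [set y] z -> [set y'] z' -> ~ E0 (z, z') by move=> -> ->.
apply: mass_gap n0 n'0 (hnorm_ge0 _) (hnorm_ge0 _) an a'n a3 a'3 _.
exact: E0P A _ _ FA aA a'A [set y] [set y'] sep.
Qed.

Lemma concentration_map : faithful_module C -> exists g v G E0, @concentrates X Y C D U g v G E0.
Proof.
move=> [_ [E _ XE]]; have [E0 E0c E0P] := fibre_concentration.
have /choice [t tP] : forall x : X, exists t : Y * (C * set Y), module_support C x ->
    [/\ cm_proj C [set x] t.2.1 = t.2.1 /\ hnorm t.2.1 = 1, t.2.2 t.1, E_bounded E0 t.2.2,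
        2^-1 <= hnorm (cm_proj D t.2.2 (U t.2.1)) & module_support D t.1].
  move=> x; have ex a : module_support C a -> exists t : Y * (C * set Y),
    [/\ cm_proj C [set a] t.2.1 = t.2.1 /\ hnorm t.2.1 = 1, t.2.2 t.1, E_bounded E0 t.2.2,
        2^-1 <= hnorm (cm_proj D t.2.2 (U t.2.1)) & module_support D t.1].
    move=> aC; have [v av v1] := module_support_unit aC.
    have [G GE Gv] := E0P a v av v1.
    have [y Gy yD] : exists2 y, G y & cm_proj D [set y] (U v) <> 0.
      apply: contrapT => h; move: Gv; rewrite (_ : cm_proj D G (U v) = 0).
        by rewrite hnorm0 leNgt invr_gt0 ltr0n.
      apply: proj_zero => y; rewrite cm_projM.
      have [By|nBy] := pselect (G y).
        have -> : [set y] `&` G = [set y] by apply/setIidPl => _ ->.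
        by apply: contrapT => yw; apply: h; exists y.
      rewrite (_ : _ `&` _ = set0) ?cm_proj0//.
      by rewrite -subset0 => _ [->].
    exists (y, (v, G)); split => //=; exact: module_supportP yD.
  (* Points outside the support receive the data of a supported point as a mere default. *)
  have [a aC _] := XE x I; have [t ta] := ex a aC.
  have [xC|nxC] := pselect (module_support C x); last by exists t.
  by have [t' t'P] := ex x xC; exists t'.
exists (fun x => (t x).1), (fun x => (t x).2.1), (fun x => (t x).2.2), E0.
by split => // x xC; have [[? ?] ? ? ? ?] := tP x xC.
Qed.

Context {g : X -> Y} {v : X -> C} {G : X -> set Y} {E0 : set (Y * Y)}.
Hypothesis gP : concentrates U g v G E0.

(** The reference vector [v x] keeps norm at least 1/2 on [G x], so the product bound for [u] and
    [v x] becomes a bound on the far part of [U u] alone, at the price of a factor 2. *)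
Lemma bounded_concentration (F : set (X * X)) (e : R) : 0 < e -> controlled F ->
  exists2 E, controlled E & forall x A u, module_support C x -> E_bounded F A -> A x ->
    cm_proj C A u = u -> hnorm (cm_proj D (~` thickening E [set g x]) (U u)) <= e * hnorm u.
Proof.
move=> e0 Fc; have e2 : 0 < e / 2 by rewrite divr_gt0.
have [E Ec EP] := uniform_rank_one hY UV UVapprox e2 Fc.
exists (rel_comp E E0); first exact: controlled_comp (conc_controlled gP).
move=> x A u xC FA Ax Au.
have vA : cm_proj C A (v x) = v x by apply: cm_proj_id (conc_fibre gP xC) => _ ->.
have := EP A u (v x) FA Au vA (~` thickening (rel_comp E E0) [set g x]) (G x).
rewrite (conc_unit gP xC) mulr1 => h.
have {h} := h _; set p := hnorm _; set q := hnorm _ => h.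
have q2 : 2^-1 <= q by exact: conc_half gP _ xC.
have p0 : 0 <= p by exact: hnorm_ge0.
have : p * q <= e / 2 * hnorm u.
  apply: h => y z ny Gz Eyz; apply: ny; exists (g x) => //; exists z => //.
  by apply: (conc_bounded gP xC); split => //=; exact: conc_mem gP _ xC.
have : p * 2^-1 <= p * q by rewrite ler_wpM2l.
lra.
Qed.

(** If [G x] and [G x'] were separated, the two halves would give 1/4 at most 1/8. *)
Lemma concentration_controlled (F : set (X * X)) : controlled F ->
  exists2 E, controlled E & forall x x', module_support C x -> module_support C x' ->
    F (x, x') -> E (g x, g x').
Proof.
move=> Fc; pose F' := (F `|` rel_inv F) `|` [set xy | xy.1 = xy.2].
have F'c : controlled F'.
  by apply: controlledU controlled_diag; apply: controlledU => //; exact: controlled_inv.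
have e8 : 0 < 8^-1 :> R by rewrite invr_gt0.
have [E Ec EP] := uniform_rank_one hY UV UVapprox e8 F'c.
have E0c := conc_controlled gP.
exists (rel_comp E0 (rel_comp E E0)).
  by apply: controlled_comp => //; exact: controlled_comp.
move=> x x' xC x'C Fxx'; pose A := [set x] `|` [set x'].
have FA : E_bounded F' A.
  by move=> [a b] [/= [->|->] [->|->]]; [right|left; left|left; right|right].
have vA : cm_proj C A (v x) = v x by apply: cm_proj_id (conc_fibre gP xC) => _ ->; left.
have v'A : cm_proj C A (v x') = v x' by apply: cm_proj_id (conc_fibre gP x'C) => _ ->; right.
apply: contrapT => nE.
have := EP A _ _ FA vA v'A (G x) (G x') _.
rewrite (conc_unit gP xC) (conc_unit gP x'C) !mulr1 => h.
have : 2^-1 * 2^-1 <= 8^-1 :> R.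
  apply: le_trans (h _); last first.
    move=> y y' Gy Gy' Eyy'; apply: nE; exists y.
      by apply: (conc_bounded gP xC); split => //=; exact: conc_mem gP _ xC.
    exists y' => //.
    by apply: (conc_bounded gP x'C); split => //=; exact: conc_mem gP _ x'C.
  by apply: ler_pM; rewrite ?invr_ge0//; [exact: conc_half gP _ xC|exact: conc_half gP _ x'C].
lra.
Qed.

End Concentration.

(** * The coarse equivalence induced by a unitary *)

Section Rigidity.
Context {R : realType} {X Y : lfCoarseSpace}.
Context (hX : countably_generated X) (hY : countably_generated Y).
Context {C : coarseModule R X} {D : coarseModule R Y} {U : C -> D} {V : D -> C}.
Hypothesis UV : unitary_pair U V.
Hypothesis UVapprox : forall t : C -> C, approximable t -> approximable (U \o t \o V).
Hypothesis VUapprox : forall s : D -> D, approximable s -> approximable (V \o s \o U).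

Let Ub := unitary_bounded UV.

(** The part [u] of [U (v x)] over [G x] satisfies [rin (V u) (v x) = hnorm u ^+ 2], at least half
    of [hnorm u]. But [V u] is concentrated near [h (g x)] up to 1/8, so [x] cannot be far from
    there. *)
Lemma concentration_inverse g v G E0 h w K E1 :
  @concentrates R X Y C D U g v G E0 -> @concentrates R Y X D C V h w K E1 ->
  exists2 F, controlled F & forall x, module_support C x -> F (x, h (g x)).
Proof.
move=> gP hP; have e8 : 0 < 8^-1 :> R by rewrite invr_gt0.
have [F Fc FP] := bounded_concentration hX (unitary_pair_sym UV) VUapprox hP e8
  (conc_controlled gP).
exists F => // x xC; apply: contrapT => nF.
have gxD := conc_support gP xC.
have := FP _ _ _ gxD (conc_bounded gP xC) (conc_mem gP xC) (cm_projK (G x) (U (v x))).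
set u := cm_proj D (G x) (U (v x)) => h1.
have u1 : hnorm u <= 1 by rewrite -(conc_unit gP xC) -(unitary_norm UV) cm_proj_le.
have u2 : 2^-1 <= hnorm u := conc_half gP xC.
have : hnorm u ^+ 2 <= 8^-1 * hnorm u.
  rewrite /u cm_proj_norm_sq -/u -(adjoint_rinE (adjoint_sym (unitary_adj UV))).
  rewrite -(conc_fibre gP xC) -cm_proj_rin.
  apply: (le_trans (rin_le _ _)); rewrite (conc_unit gP xC) mulr1.
  by apply: le_trans h1; apply: cm_proj_mono => _ -> [_ ->].
have : 2^-1 * hnorm u <= hnorm u ^+ 2 by rewrite expr2 ler_wpM2r ?hnorm_ge0.
by move: u2; lra.
Qed.

(** Concentration says nothing about empty fibres; composing with [r] moves every point to a
    nonempty one within bounded distance. *)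
Lemma faithful_retraction (Z : lfCoarseSpace) (B : coarseModule R Z) : faithful_module B ->
  exists (r : Z -> Z) (E : set (Z * Z)), controlled E /\
    forall z, module_support B (r z) /\ E (z, r z).
Proof.
move=> [_ [E Ec ZE]].
have /choice [r rP] : forall z, exists a, module_support B a /\ E (z, a).
  by move=> z; have [a aB Eza] := ZE z I; exists a.
by exists r, E.
Qed.

Lemma concentration_roundtrip g v G E0 h w K E1 (r : X -> X) (Er : set (X * X))
    (r' : Y -> Y) (Er' : set (Y * Y)) :
  @concentrates R X Y C D U g v G E0 -> @concentrates R Y X D C V h w K E1 ->
  controlled Er -> (forall x, module_support C (r x) /\ Er (x, r x)) ->
  controlled Er' -> (forall y, module_support D (r' y) /\ Er' (y, r' y)) ->
  coarse_close ((h \o r') \o (g \o r)) id.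
Proof.
move=> gP hP Erc rP Er'c r'P.
have [F Fc FP] := concentration_inverse gP hP.
have [F' F'c F'P] := concentration_controlled hX (unitary_pair_sym UV) VUapprox hP Er'c.
pose Q := rel_comp Er (rel_comp F F').
have Qc : controlled Q by apply: controlled_comp => //; exact: controlled_comp.
have QP x : Q (x, h (r' (g (r x)))).
  have [rx Ex] := rP x; exists (r x) => //; exists (h (g (r x))); first exact: FP.
  have gD := conc_support gP rx.
  by have [? ?] := r'P (g (r x)); exact: F'P.
move=> E Ec; apply: controlledS (controlled_comp (controlled_inv Qc) Ec).
by move=> _ [[x y] Exy <-]; exists x => //; exact: QP.
Qed.

Lemma concentration_coarse_map g v G E0 (r : X -> X) (Er : set (X * X)) :
  @concentrates R X Y C D U g v G E0 ->
  controlled Er -> (forall x, module_support C (r x) /\ Er (x, r x)) ->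
  coarse_map (g \o r).
Proof.
move=> gP Erc rP E Ec.
have Qc : controlled (rel_comp (rel_inv Er) (rel_comp E Er)).
  by apply: controlled_comp; [exact: controlled_inv|exact: controlled_comp].
have [F Fc FP] := concentration_controlled hY UV UVapprox gP Qc.
apply: controlledS Fc => _ [[x y] Exy <-] /=.
have [rx Ex] := rP x; have [ry Ey] := rP y.
by apply: FP => //; exists x => //; exists y.
Qed.

Lemma opnorm_gt (H K : hilbertType R) (t : H -> K) (M : R) : 0 <= M -> M < opnorm t ->
  exists u, M * hnorm u < hnorm (t u).
Proof.
move=> M0; apply: contraPP => h; apply/negP; rewrite -leNgt; apply: opnorm_le => // u.
by rewrite leNgt; apply/negP => ?; apply: h; exists u.
Qed.

(** Otherwise [B] would avoid a neighbourhood of [g x] for every supported [x] in [A], and the block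
    would have norm at most [d]. *)
Lemma concentration_meets g v G E0 (F : set (X * X)) (d : R) :
  @concentrates R X Y C D U g v G E0 -> controlled F -> 0 < d ->
  exists2 E, controlled E & forall (B : set Y) (A : set X), E_bounded F A ->
    d < opnorm (cm_proj D B \o U \o cm_proj C A) ->
    exists x y, [/\ module_support C x, A x, B y & E (y, g x)].
Proof.
move=> gP Fc d0; have [E Ec EP] := bounded_concentration hY UV UVapprox gP d0 Fc.
exists E => // B A FA /(opnorm_gt (ltW d0)) [u /= du].
have Au0 : cm_proj C A u <> 0.
  move=> Au0; move: du; rewrite Au0 (linear_op0 Ub.1) cm_proj_v0 hnorm0.
  by rewrite ltNge mulr_ge0 ?hnorm_ge0 ?ltW.
have [x Ax xC] : exists2 x, A x & module_support C x.
  apply: contrapT => h; apply: Au0; apply: proj_zero => x; rewrite cm_projM.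
  have [Ax|nAx] := pselect (A x).
    have -> : [set x] `&` A = [set x] by apply/setIidPl => _ ->.
    apply: contrapT => xu; apply: h; exists x => //; exact: module_supportP xu.
  rewrite (_ : _ `&` _ = set0) ?cm_proj0//.
  by rewrite -subset0 => _ [->].
exists x; apply: contrapT => h; move: du; apply/negP; rewrite -leNgt.
have := EP x A _ xC FA Ax (cm_projK A u) => h1.
apply: (@le_trans _ _ (d * hnorm (cm_proj C A u))); last first.
  by rewrite ler_wpM2l ?(ltW d0)// cm_proj_le.
apply: le_trans h1; apply: cm_proj_mono => y By [_ -> Ey]; apply: h.
by exists y.
Qed.

(** The threshold 1/4 lies strictly below the 1/2 of [conc_half], so the blocks of [G (r x)] against
    the single point [r x] belong to the relation. *)
Lemma concentration_asymptotic g v G E0 (r : X -> X) (Er : set (X * X)) :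
  @concentrates R X Y C D U g v G E0 ->
  controlled Er -> (forall x, module_support C (r x) /\ Er (x, r x)) ->
  @asymptotic (product_coarse Y X)
    (approx_relation U 4^-1 E0 [set xy | xy.1 = xy.2]) (fun_graph (g \o r)).
Proof.
move=> gP Erc rP; have d0 : 0 < 4^-1 :> R by rewrite invr_gt0.
have E0c := conc_controlled gP.
split.
  have [E Ec EP] := concentration_meets gP (@controlled_diag X) d0.
  have [F Fc FP] := concentration_controlled hY UV UVapprox gP Erc.
  pose Q := rel_comp E0 (rel_comp E F).
  have Qc : controlled Q by apply: controlled_comp => //; exact: controlled_comp.
  exists [set pq | Q (pq.1.1, pq.2.1) /\ pq.1.2 = pq.2.2].
    apply/product_controlledP; exists Q, [set xy | xy.1 = xy.2].
    by split => //; exact: controlled_diag.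
  move=> [y x] [B [A [EB EA dBA [/= By Ax]]]].
  have [x' [y' [x'C Ax' By' Ey']]] := EP B A EA dBA.
  have {Ax'} xx' : x' = x by exact: (EA (x', x)).
  rewrite {x'}xx' in x'C Ey'.
  exists (g (r x), x) => //; split => //=.
  exists y'; first exact: (EB (y, y')).
  by exists (g x) => //; have [? ?] := rP x; exact: FP.
exists [set pq | pq.1.1 = pq.2.1 /\ Er (pq.1.2, pq.2.2)].
  apply/product_controlledP; exists [set xy | xy.1 = xy.2], Er.
  by split => //; exact: controlled_diag.
move=> [y x]; rewrite /fun_graph /= => ->; have [rx Ex] := rP x.
exists (g (r x), r x); last by split.
exists (G (r x)), [set r x]; split.
- exact: (conc_bounded gP rx).
- by move=> [a b] [/= -> ->].
- have tb : bounded_op (cm_proj D (G (r x)) \o U \o cm_proj C [set r x]).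
    apply: bounded_op_comp (cm_proj_bounded _ _).
    exact: bounded_op_comp (cm_proj_bounded _ _) Ub.
  have := opnormP tb (v (r x)); rewrite /= (conc_fibre gP rx) (conc_unit gP rx) mulr1.
  by have := conc_half gP rx; lra.
- by split => //=; exact: (conc_mem gP rx).
Qed.

(** The form in which [f] being induced by [U] is used later: no threshold or scales remain, the
    error is arbitrarily small, and passing to a close map is harmless. *)
Definition spreads (f : X -> Y) : Prop :=
  forall e : R, 0 < e -> exists2 E, controlled E & forall x u, cm_proj C [set x] u = u ->
    hnorm (cm_proj D (~` thickening E [set f x]) (U u)) <= e * hnorm u.

(** Near each [(f x, x)] lies a block of norm above [d], which [concentration_meets] places near
    [g x]. So [f] is close to [g] on the support and inherits its concentration. *)
Lemma asymptotic_spreads g v G E0 (f : X -> Y) (d : R) (E' : set (Y * Y)) (E : set (X * X)) :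
  @concentrates R X Y C D U g v G E0 -> 0 < d -> controlled E' -> controlled E ->
  @asymptotic (product_coarse Y X) (approx_relation U d E' E) (fun_graph f) ->
  spreads f.
Proof.
move=> gP d0 E'c Ec [_ [P /product_controlledP [P1 [P2 [P1c P2c PP]]] fP]].
have [E2 E2c E2P] := concentration_meets gP Ec d0.
have [H Hc HP] := concentration_controlled hY UV UVapprox gP
   (controlled_inv (controlled_comp P2c Ec)).
pose Q := rel_comp P1 (rel_comp E' (rel_comp E2 H)).
have Qc : controlled Q.
  by apply: controlled_comp => //; apply: controlled_comp => //; exact: controlled_comp.
have QP x : module_support C x -> Q (f x, g x).
  move=> xC; have [[y x'] [B [A [EB EA dBA [/= By Ax']]]] /PP /= [Py Px']] := fP (f x, x) erefl.
  have [x2 [y2 [x2C Ax2 By2 Ey2]]] := E2P B A EA dBA.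
  exists y => //; exists y2; first exact: (EB (y, y2)).
  exists (g x2) => //; apply: HP => //=; exists x' => //.
  exact: (EA (x', x2)).
move=> e e0; have [E3 E3c E3P] := bounded_concentration hY UV UVapprox gP e0 (@controlled_diag X).
exists (rel_comp E3 (rel_inv Q)); first by apply: controlled_comp => //; exact: controlled_inv.
move=> x u xu.
have [xC|nxC] := pselect (module_support C x); last first.
  have -> : u = 0 by rewrite -xu; apply: contrapT => /module_supportP.
  by rewrite (linear_op0 Ub.1) cm_proj_v0 !hnorm0 mulr0.
have := E3P x [set x] u xC _ erefl xu => h.
apply: le_trans (h _); last by move=> [a b] [/= -> ->].
apply: cm_proj_mono; apply: subsetC => y [_ -> Ey]; exists (f x) => //.
by exists (g x) => //; exact: QP.
Qed.

End Rigidity.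

Section RigidityTheorem.
Context {R : realType} {X Y : lfCoarseSpace}.
Context (hX : countably_generated X) (hY : countably_generated Y).
Context {C : coarseModule R X} {D : coarseModule R Y} {U : C -> D} {V : D -> C}.
Hypothesis UV : unitary_pair U V.
Hypothesis UVapprox : forall t : C -> C, approximable t -> approximable (U \o t \o V).
Hypothesis VUapprox : forall s : D -> D, approximable s -> approximable (V \o s \o U).
Hypotheses (fC : faithful_module C) (fD : faithful_module D).

Theorem unitary_rigidity : exists (f : X -> Y) (d : R) (E' : set (Y * Y)) (E : set (X * X)),
  [/\ coarse_equivalence f, 0 < d < 1, controlled E', controlled E
    & @asymptotic (product_coarse Y X) (approx_relation U d E' E) (fun_graph f)].
Proof.
have VU := unitary_pair_sym UV.
have [g [v [G [E0 gP]]]] := concentration_map hX hY UV UVapprox VUapprox fC.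
have [h [w [K [E1 hP]]]] := concentration_map hY hX VU VUapprox UVapprox fD.
have [r [Er [Erc rP]]] := faithful_retraction fC.
have [r' [Er' [Er'c r'P]]] := faithful_retraction fD.
exists (g \o r), 4^-1, E0, [set xy | xy.1 = xy.2]; split.
- split; first exact: (concentration_coarse_map hY UV UVapprox gP Erc rP).
  exists (h \o r'); split.
  + exact: (concentration_coarse_map hX VU VUapprox hP Er'c r'P).
  + exact: (concentration_roundtrip hY VU UVapprox hP gP Er'c r'P Erc rP).
  + exact: (concentration_roundtrip hX UV VUapprox gP hP Erc rP Er'c r'P).
- by rewrite invr_gt0 ltr0n /= invf_lt1 ?ltr1n.
- exact: conc_controlled gP.
- exact: controlled_diag.
- exact: (concentration_asymptotic hY UV UVapprox gP Erc rP).
Qed.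

Theorem unitary_spreads (f : X -> Y) (d : R) (E' : set (Y * Y)) (E : set (X * X)) :
  0 < d -> controlled E' -> controlled E ->
  @asymptotic (product_coarse Y X) (approx_relation U d E' E) (fun_graph f) ->
  spreads (U := U) f.
Proof.
have [g [v [G [E0 gP]]]] := concentration_map hX hY UV UVapprox VUapprox fC.
exact: (asymptotic_spreads hY UV UVapprox gP).
Qed.

End RigidityTheorem.

Section Adjoints.
Context {R : realType} {X : lfCoarseSpace}.
Implicit Types C D : coarseModule R X.

Lemma approximable_adj C D (t : C -> D) (t' : D -> C) :
  approximable t -> bounded_op t' -> adjoint_pair t t' -> approximable t'.
Proof.
move=> /approximableP [tb ta] t'b tt'; apply/approximableP; split => // e e0.
have [E Ec [s [sb sE se]]] := ta e e0.
exists (rel_inv E); first exact: controlled_inv.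
have [s' [s'b ss' _]] := adjoint_exists sb.
exists s'; split => //.
  move=> [x y]; apply: contraPP => nE; apply/supportPn => v.
  apply: rin_ext => w; rewrite rin0l cm_proj_rin rinC -(adjoint_rinE ss') -cm_proj_rin.
  have /supportPn -> : ~ op_support s (y, x) by move/sE => Eyx; apply: nE.
  by rewrite rin0l.
have [r [_ tsr rM]] := adjoint_exists (bounded_opB tb sb).
move=> v; have -> : t' v - s' v = r v.
  have : adjoint_pair (t \- s) (t' \- s').
    apply: adjoint_rin; first exact: bounded_opB.
    by move=> x y; rewrite /= rinBl rinBr (adjoint_rinE tt') (adjoint_rinE ss').
  by move=> /(adjoint_unique tsr) ->.
by apply: rM => //; exact: ltW.
Qed.

End Adjoints.

(** * Pushforward of modules along a coarse map *)

Section Pushforward.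
Context {R : realType} {X Y : lfCoarseSpace} (f : X -> Y).

(** The diagonal is added because the image of a gauge misses the points outside the range of
    [f]. *)
Definition push_gauge (E : set (X * X)) : set (Y * Y) :=
  [set (f xy.1, f xy.2) | xy in E] `|` [set xy | xy.1 = xy.2].

Hypothesis cf : coarse_map f.
Context (C : coarseModule R X).

Let push_proj (B : set Y) : C -> C := cm_proj C (f @^-1` B).

Lemma push_nondegenerate : exists2 E, coarse_gauge E &
  closure (lin_span [set v | exists2 A, E_bounded E A & range (push_proj A) v]) = setT.
Proof.
have [E [Ec Es Ed] dE] := cm_nondegenerate C.
exists (push_gauge E).
  split; last by move=> z; right.
    by apply: controlledU; [exact: cf|exact: controlled_diag].
  apply/seteqP; split => -[y z].
    move=> [[[a b] Eab [<- <-]]|/= ->]; last by right.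
    by left; exists (b, a) => //; rewrite -Es.
  move=> [[[a b] Eab [<- <-]]|/= ->]; last by right.
  by left; exists (b, a) => //; rewrite -Es.
rewrite -subTset -[X in X `<=` _]dE; apply: closure_subset => v [n [c [w [Sw ->]]]].
exists n, c, w; split => // i; have [A EA [u _ <-]] := Sw i.
exists (f @` A).
  by move=> [y z] [/= [a Aa <-] [b Ab <-]]; left; exists (a, b) => //; exact: EA.
exists (cm_proj C A u) => //; apply: cm_proj_id (cm_projK A u) => x Ax.
by exists x.
Qed.

(** The Hilbert space is kept and only the projections change, so operators over [X] are literally
    operators between pushforwards. *)
Definition pushforward : coarseModule R Y.
Proof.
refine (@CoarseModule R Y C push_proj _ _ _ _ push_nondegenerate).
- move=> A; exact: cm_proj_projection.
- exact: cm_projT.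
- by move=> A B; exact: cm_projI.
- by move=> A; exact: cm_projC.
Defined.

End Pushforward.

Section PushforwardOperators.
Context {R : realType} {X Y : lfCoarseSpace} (f : X -> Y) (cf : coarse_map f).
Context (C D : coarseModule R X).

Lemma pushforward_approximable (t : C -> D) : @approximable R X C D t ->
  @approximable R Y (pushforward cf C) (pushforward cf D) t.
Proof.
move=> /approximableP [tb ta]; apply/approximableP; split => // e e0.
have [E Ec [s [sb sE se]]] := ta e e0.
exists [set (f xy.1, f xy.2) | xy in E]; first exact: cf.
exists s; split => // -[b a]; apply: contraPP => nE; apply/supportPn => v.
change (cm_proj D (f @^-1` [set b]) (s (cm_proj C (f @^-1` [set a]) v)) = 0).
apply: (@support_separated R X C D s E (f @^-1` [set a]) (f @^-1` [set b]) v sb sE).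
move=> y x /= fy fx Eyx; apply: nE.
by exists (y, x) => //=; rewrite fy fx.
Qed.

(** Each [x] is uniformly close to [g (f x)], so closeness of images is carried back by [g]. *)
Lemma coarse_equivalence_embedding (E' : set (Y * Y)) : coarse_equivalence f ->
  controlled E' -> controlled [set xy | E' (f xy.1, f xy.2)].
Proof.
move=> [_ [g [cg _ gf]]] E'c.
have Q := gf _ (@controlled_diag X).
apply: controlledS (controlled_comp (controlled_inv Q) (controlled_comp (cg _ E'c) Q)).
move=> [x x'] /= Exx'; exists (g (f x)); first by exists (x, x).
exists (g (f x')); last by exists (x', x').
by exists (f x, f x').
Qed.

Lemma pushforward_approximable_inv (t : C -> D) : coarse_equivalence f ->
  @approximable R Y (pushforward cf C) (pushforward cf D) t -> @approximable R X C D t.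
Proof.
move=> ef /approximableP [tb ta]; apply/approximableP; split => // e e0.
have [E Ec [s [sb sE se]]] := ta e e0.
exists [set xy | E (f xy.1, f xy.2)]; first exact: coarse_equivalence_embedding.
exists s; split => // -[y x]; apply: contraPP => nE; apply/supportPn => v.
have /supportPn h : ~ @op_support R Y (pushforward cf C) (pushforward cf D) s (f y, f x).
  by move/sE.
have := h (cm_proj C [set x] v).
have -> : cm_proj (pushforward cf C) [set f x] (cm_proj C [set x] v) = cm_proj C [set x] v.
  by apply: (@cm_proj_id _ _ C [set x] (f @^-1` [set f x])); rewrite ?cm_projK// => _ ->.
move=> /(congr1 (cm_proj D [set y])); rewrite cm_proj_v0 => <-.
by symmetry; apply: (@cm_proj_sub _ _ D [set y] (f @^-1` [set f y])) => _ ->.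
Qed.

End PushforwardOperators.

(** * Approximability of [U] over the pushforward *)

Section SpreadApproximable.
Context {R : realType} {X Y : lfCoarseSpace} (hY : countably_generated Y).
Context {C : coarseModule R X} {D : coarseModule R Y} {U : C -> D} {V : D -> C}.
Hypothesis UV : unitary_pair U V.
Hypothesis UVapprox : forall t : C -> C, approximable t -> approximable (U \o t \o V).
Context (f : X -> Y) (cf : coarse_map f).
Hypothesis fU : spreads (U := U) f.

Let Ub := unitary_bounded UV.
Let Vb := unitary_inv_bounded UV.

Lemma sqrt_concave (a b : R) : 0 <= a -> 0 <= b ->
  (Num.sqrt a + Num.sqrt b) / 2 <= Num.sqrt ((a + b) / 2).
Proof.
move=> a0 b0; rewrite -(@ler_pXn2r _ 2) ?nnegrE ?sqrtr_ge0 ?divr_ge0 ?addr_ge0 ?sqrtr_ge0//.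
rewrite sqr_sqrtr ?divr_ge0 ?addr_ge0// -[in leRHS](sqr_sqrtr a0) -[in leRHS](sqr_sqrtr b0).
have := sqr_ge0 (Num.sqrt a - Num.sqrt b); move: (Num.sqrt a) (Num.sqrt b) => x y.
by rewrite sqrrB expr_div_n sqrrD; lra.
Qed.

Lemma fibre_sum_sq (s : seq {classic X}) (w : X -> C) : uniq s ->
  hnorm (\sum_(x <- s) cm_proj C [set x : X] (w x)) ^+ 2 =
  \sum_(x <- s) hnorm (cm_proj C [set x : X] (w x)) ^+ 2.
Proof.
elim: s => [|x s IH] /=; first by rewrite !big_nil hnorm0 expr0n.
move=> /andP[xs us]; rewrite !big_cons hnormD_sq IH// (_ : rin _ _ = 0).
  by rewrite mulr0 addr0.
elim: s xs {us IH} => [|y s IH]; first by rewrite big_nil rin0r.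
rewrite inE negb_or big_cons => /andP[xy xs]; rewrite rinDr IH// addr0.
rewrite cm_proj_rin cm_projM (_ : _ `&` _ = set0) ?cm_proj0 ?rin0r//.
by rewrite -subset0 => z [/= -> yx]; move: xy; rewrite yx eqxx.
Qed.

Lemma proj_seq_sum (s : seq {classic X}) (v : C) : uniq s ->
  cm_proj C [set` s] v = \sum_(x <- s) cm_proj C [set x : X] v.
Proof.
elim: s => [|x s IH] /=; first by rewrite big_nil set_nil cm_proj0.
move=> /andP[xs us]; rewrite big_cons -IH//.
rewrite (cm_projD1 (A := [set` x :: s]) (a := x)) /=; last by rewrite inE eqxx.
congr (_ + cm_proj C _ v); apply/seteqP; split => y /=.
  by move=> [] /=; rewrite inE => /orP[/eqP|].
move=> ys; split; first by rewrite /= inE ys orbT.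
by move=> yx; move: xs; rewrite -yx ys.
Qed.

Let T (A : set X) : D -> D := U \o cm_proj C A \o V.

Lemma T_point A x w : ~ A x -> T (x |` A) w = T A w + T [set x] w.
Proof.
move=> nAx; rewrite /T /= (cm_projD1 (A := x |` A) (a := x)); last by left.
rewrite (linear_opD Ub.1) addrC; congr (U (cm_proj C _ _) + _).
apply/seteqP; split => [z [[->|//] /(_ erefl)]//|z Az]; split; first by right.
by move=> zx; apply: nAx; rewrite -zx.
Qed.

Lemma op_support0 (M : lfCoarseSpace) (A B : coarseModule R M) :
  op_support (fun=> 0 : B) (C := A) = set0.
Proof.
rewrite -subset0 => -[y x]; apply; apply/funext => v /=; exact: cm_proj_v0.
Qed.

(* Averaging over signs: with [m_x] localised near [f x], the sum of the [T_x m_x] is the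
   mean over all signs [s] of [(sum s_x T_x) (sum s_x m_x)], where the first factors are
   uniformly approximable and the second ones have bounded mean square. *)
Lemma sign_average (e : R) (E1 E2 : set (Y * Y)) (m : X -> pushforward cf C -> D)
    (s : seq {classic X}) (A B : set X) (M : pushforward cf C -> D) :
  0 <= e -> (forall A, approx_at (T A) e E2) ->
  (forall x, bounded_op (m x) /\ op_support (m x) `<=` E1) ->
  uniq s -> (forall x : {classic X}, x \in s -> ~ A x /\ ~ B x) ->
  bounded_op M -> op_support M `<=` E1 ->
  exists S : pushforward cf C -> D, [/\ bounded_op S, op_support S `<=` rel_comp E2 E1
    & forall v, hnorm (T A (M v) - T B (M v) + \sum_(x <- s) T [set x : X] (m x v) - S v) <=
       2 * e * Num.sqrt (hnorm (M v) ^+ 2 + \sum_(x <- s) hnorm (m x v) ^+ 2)].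
Proof.
move=> e0 TE mE; elim: s A B M => [|x s IH] A B M /=.
  move=> _ _ Mb ME; have [a [ab aE ae]] := TE A; have [b [bb bE be]] := TE B.
  exists (fun v => a (M v) - b (M v)); split.
  - exact: (bounded_op_comp (bounded_opB ab bb) Mb).
  - move=> [z x] zs.
    have [y /= yz xy] := @support_comp R Y (pushforward cf C) D D (a \- b) M
      (bounded_opB ab bb) Mb (z, x) zs.
    exists y; last exact: ME.
    have := @supportZD _ _ _ _ (-1) b a (z, y).
    rewrite (_ : (fun x => -1 *: b x + a x) = (a \- b)); last first.
      by apply/funext => u /=; rewrite scaleN1r addrC.
    by move=> /(_ yz) [/bE|/aE].
  - move=> v; rewrite !big_nil !addr0 sqrtr_sqr ger0_norm ?hnorm_ge0//.
    have -> : T A (M v) - T B (M v) - (a (M v) - b (M v)) =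
      (T A (M v) - a (M v)) - (T B (M v) - b (M v))
      by apply: rin_ext => u; rewrite !(rinDl, rinNl); lra.
    apply: (le_trans (hnormB _ _)); rewrite -mulrA mulrDl mul1r.
    by apply: lerD; [exact: ae|exact: be].
move=> /andP[xs us] AB Mb ME; have [mb mE'] := mE x.
have [nAx nBx] : ~ A x /\ ~ B x by apply: AB; rewrite inE eqxx.
have notin (y : {classic X}) : y \in s -> y <> x by move=> ys yx; move: xs; rewrite -yx ys.
(* [A] and [B] collect the points of sign plus and minus. Here [x] gets plus, next it gets minus; in
   the mean all cross terms cancel except [T [set x]] applied to [m x v]. *)
have [|||S1 [S1b S1E S1e]] := IH (x |` A) B (fun v => M v + m x v) us.
- move=> y ys; have [nAy nBy] := AB y (mem_behead (s := x :: s) ys).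
  by split => // -[/(notin y ys)|].
- exact: bounded_opD.
- have := @supportZD _ _ _ _ 1 (m x) M.
  rewrite (_ : (fun v => 1 *: m x v + M v) = (fun v => M v + m x v)); last first.
    by apply/funext => v; rewrite scale1r addrC.
  by move=> h z /h [/mE'|/ME].
have [|||S2 [S2b S2E S2e]] := IH A (x |` B) (fun v => M v - m x v) us.
- move=> y ys; have [nAy nBy] := AB y (mem_behead (s := x :: s) ys).
  by split => // -[/(notin y ys)|].
- exact: bounded_opB.
- have := @supportZD _ _ _ _ (-1) (m x) M.
  rewrite (_ : (fun v => -1 *: m x v + M v) = (fun v => M v - m x v)); last first.
    by apply/funext => v; rewrite scaleN1r addrC.
  by move=> h z /h [/mE'|/ME].
exists (fun v => (2^-1)%:C *: (S1 v + S2 v)); split.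
- have := bounded_opZD (2^-1)%:C (bounded_opD S1b S2b) (@bounded_op0 R _ _).
  by congr bounded_op; apply/funext => v; rewrite addr0.
- move=> [z y]; apply: contraPP => nE; apply/supportPn => v.
  have /supportPn h1 : ~ op_support S1 (z, y) by move/S1E.
  have /supportPn h2 : ~ op_support S2 (z, y) by move/S2E.
  by rewrite cm_projZ cm_projD h1 h2 addr0 scaler0.
move=> v; set r := \sum_(i <- s) hnorm (m i v) ^+ 2.
have r0 : 0 <= r by apply: sumr_ge0 => i _; exact: sqr_ge0.
have := S1e v; have := S2e v; rewrite -/r !big_cons -/r.
set w := M v; set n := m x v; set Sg := \sum_(i <- s) T _ _.
have Tb A' : bounded_op (T A').
  exact: bounded_op_comp (bounded_op_comp Ub (cm_proj_bounded _ _)) Vb.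
rewrite !T_point// !(linear_opD (Tb _).1) !(bounded_opN (Tb _)) => h2 h1.
have -> : T A w - T B w + (T [set x] n + Sg) - (2^-1)%:C *: (S1 v + S2 v) =
  (2^-1)%:C *: ((T A w + T A n + (T [set x] w + T [set x] n) - (T B w + T B n) + Sg - S1 v) +
   (T A w - T A n - (T B w - T B n + (T [set x] w - T [set x] n)) + Sg - S2 v)).
  by apply: rin_ext => z; rewrite !(rinZl, rinDl, rinNl); lra.
rewrite hnormZr ger0_norm ?invr_ge0//.
(* The mean of the two bounds merges into one root by concavity and the parallelogram law. The
   factor 2 covers the separate errors of [T A] and [T B]. *)
apply: (@le_trans _ _ (2 * e * ((Num.sqrt (hnorm (w + n) ^+ 2 + r) +
  Num.sqrt (hnorm (w - n) ^+ 2 + r)) / 2))).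
  rewrite mulrC mulrA ler_pM2r ?invr_gt0// mulrDr.
  by apply: (le_trans (hnormD _ _)); exact: lerD.
rewrite ler_wpM2l ?mulr_ge0//; apply: (le_trans (sqrt_concave _ _)).
- by rewrite addr_ge0 ?sqr_ge0.
- by rewrite addr_ge0 ?sqr_ge0.
rewrite ler_wsqrtr// hnormD_sq hnormB_sq; lra.
Qed.

(** Finite sets of fibres are treated with one common entourage, then [approx_at_cluster] reaches
    all of [U]. One third of [e] pays for cutting each fibre image to a neighbourhood of [f x], two
    thirds for the sign average. *)
Theorem spread_approximable : @approximable R Y (pushforward cf C) D U.
Proof.
apply/approximableP; split => // e e0; have e3 : 0 < e / 3 by rewrite divr_gt0.
have [E1 E1c E1P] := fU e3.
have [E2 E2c E2P] := uniform_projections hY UV UVapprox e3.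
pose m (x : X) : pushforward cf C -> D :=
  cm_proj D (thickening E1 [set f x]) \o U \o cm_proj C [set x].
exists (rel_comp E2 E1); first exact: controlled_comp.
have mb x : bounded_op (m x).
  exact: bounded_op_comp (bounded_op_comp (cm_proj_bounded _ _) Ub) (cm_proj_bounded _ _).
have mE x : op_support (m x) `<=` E1.
  move=> [y z]; apply: contraPP => nE; apply/supportPn => v.
  change (cm_proj D [set y] (cm_proj D (thickening E1 [set f x])
    (U (cm_proj C [set x] (cm_proj C (f @^-1` [set z]) v)))) = 0).
  rewrite !cm_projM; have [zx|zx] := pselect (z = f x); last first.
    rewrite (_ : [set x] `&` _ = set0) ?cm_proj0 ?(linear_op0 Ub.1) ?cm_proj_v0//.
    by rewrite -subset0 => _ [-> /= fx]; apply: zx.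
  rewrite (_ : [set y] `&` _ = set0) ?cm_proj0//.
  rewrite -subset0 => _ [-> [_ -> Ey]]; apply: nE.
  by rewrite zx.
suff : @approx_at R Y (pushforward cf C) D (U \o cm_proj C setT) e (rel_comp E2 E1).
  by rewrite cm_projT.
apply: (@approx_at_cluster R Y (pushforward cf C) D X (fun A => U \o cm_proj C A) 1).
- exact: ler01.
- exact: ltW.
- exact: bounded_op_comp Ub (cm_proj_bounded _ _).
- by move=> A v; rewrite mul1r /= (unitary_norm UV) cm_proj_le.
- move=> v w d d0; have w0 : 0 < hnorm w + 1 by rewrite ltr_wpDl ?hnorm_ge0.
  have [|G Gf Gd] := proj_agree (v : C) (_ : 0 < d / (hnorm w + 1)); first by rewrite divr_gt0.
  exists G => // A' AA'; rewrite /= -(bounded_opBE Ub).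
  apply: (le_trans (rin_norm_le _ _)); rewrite (unitary_norm UV).
  apply: (@le_trans _ _ (d / (hnorm w + 1) * hnorm w)).
    by rewrite ler_wpM2r ?hnorm_ge0// Gd.
  by rewrite mulrAC ler_pdivrMr// ler_wpM2l ?(ltW d0)// lerDl.
(* A finite [G] agrees with the whole space on [G] itself, so finite sets cluster at [setT]. *)
move=> G Gf; exists G; first by [].
move: Gf => /(@finite_seqP {classic X}) [s0 ->].
have [s [us ->]] : exists s : seq {classic X}, uniq s /\ [set` s0] = [set` s].
  exists (undup s0); split; first exact: undup_uniq.
  by apply/seteqP; split => x /=; rewrite mem_undup.
have [S [Sb SE Se]] := @sign_average (e / 3) E1 E2 m s set0 set0 (fun=> 0)
  (ltW e3) E2P (fun x => conj (mb x) (mE x)) us (fun x _ => conj id id)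
  (@bounded_op0 R _ _) (eq_ind_r (fun A => A `<=` E1) (@sub0set _ E1) (@op_support0 _ _ _)).
exists S; split => // v.
set Sg := \sum_(x <- s) T [set x : X] (m x v).
have h1 : hnorm (Sg - S v) <= 2 * (e / 3) * hnorm v.
  have := Se v; rewrite subrr add0r -/Sg hnorm0 expr0n add0r => h; apply: (le_trans h).
  apply: ler_wpM2l; first by rewrite mulr_ge0 ?(ltW e3).
  have -> : hnorm v = Num.sqrt (hnorm v ^+ 2) by rewrite sqrtr_sqr ger0_norm ?hnorm_ge0.
  apply: ler_wsqrtr.
  apply: (@le_trans _ _ (\sum_(x <- s) hnorm (cm_proj C [set x : X] v) ^+ 2)).
    apply: ler_sum => x _; rewrite -ler_hnorm_sq; apply: (le_trans (cm_proj_le _ _)).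
    by rewrite (unitary_norm UV).
  by rewrite -fibre_sum_sq// -proj_seq_sum// -ler_hnorm_sq cm_proj_le.
(* The factor [T [set x]] in front of [m x] puts the cutting errors into distinct fibres after
   applying [V]. They are therefore orthogonal and add in square, so the fibrewise bound survives
   the sum. *)
have h2 : hnorm (U (cm_proj C [set` s] v) - Sg) <= e / 3 * hnorm v.
  pose w (x : X) := V (cm_proj D (~` thickening E1 [set f x]) (U (cm_proj C [set x] v))).
  have -> : U (cm_proj C [set` s] v) - Sg = U (\sum_(x <- s) cm_proj C [set x : X] (w x)).
    rewrite /Sg /T -(big_morph U (linear_opD Ub.1) (linear_op0 Ub.1)) -(bounded_opBE Ub).
    rewrite proj_seq_sum// -sumrB; congr U; apply: eq_bigr => x _.
    rewrite /w cm_projCE (bounded_opBE Vb) (unitaryK UV) cm_projB cm_projK.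
    by congr (_ - _).
  rewrite (unitary_norm UV) -(@ler_pXn2r _ 2) ?nnegrE ?mulr_ge0 ?hnorm_ge0 ?(ltW e0)//.
  rewrite fibre_sum_sq// exprMn.
  apply: (@le_trans _ _ ((e / 3) ^+ 2 * \sum_(x <- s) hnorm (cm_proj C [set x : X] v) ^+ 2)).
    rewrite mulr_sumr; apply: ler_sum => x _; rewrite -exprMn.
    rewrite ler_pXn2r ?nnegrE ?mulr_ge0 ?hnorm_ge0 ?(ltW e0)//.
    apply: (le_trans (cm_proj_le _ _)); rewrite (unitary_inv_norm UV).
    by apply: E1P; exact: cm_projK.
  rewrite ler_wpM2l ?sqr_ge0//.
  by rewrite -fibre_sum_sq// -proj_seq_sum// -ler_hnorm_sq cm_proj_le.
have := hnormD (U (cm_proj C [set` s] v) - Sg) (Sg - S v).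
rewrite addrA subrK => h; apply: (le_trans h); move: h1 h2; lra.
Qed.

Theorem spread_inverse_approximable : @approximable R Y D (pushforward cf C) V.
Proof. by apply: (approximable_adj spread_approximable Vb); exact: unitary_adj UV. Qed.

End SpreadApproximable.

(** * Unitary implementation of isomorphisms *)

Section Spatial.
Context {R : realType} {X Y : lfCoarseSpace}.
Context {C : coarseModule R X} {D : coarseModule R Y}.

Record operator_iso (F : (C -> C) -> (D -> D)) : Prop := {
  op_iso_approx : forall t, approximable t -> approximable (F t);
  op_iso_comp : forall s t, approximable s -> approximable t -> F (s \o t) = F s \o F t;
  op_iso_linear : forall a s t, approximable s -> approximable t ->
    F (fun x => a *: s x + t x) = (fun y => a *: F s y + F t y);
  op_iso_adj : forall s t, approximable s -> approximable t ->
    adjoint_pair s t -> adjoint_pair (F s) (F t);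
  op_iso_surj : forall r, approximable r -> exists2 t, approximable t & F t = r;
  op_iso_inj : forall t, approximable t -> F t = (fun=> 0) -> t = (fun=> 0) }.

(** Membership in one coarse component. It decides whether rank one operators between nonzero
    vectors of two fibres are approximable. *)
Definition connected_points (x x' : X) : Prop := controlled [set (x, x')].

Lemma connected_refl x : connected_points x x.
Proof. by apply: controlledS (@controlled_diag X) => _ ->. Qed.

Lemma connected_sym x x' : connected_points x x' -> connected_points x' x.
Proof. by move=> /controlled_inv; apply: controlledS => _ ->. Qed.

Lemma connected_trans x y z : connected_points x y -> connected_points y z -> connected_points x z.
Proof. by move=> xy yz; apply: controlledS (controlled_comp xy yz) => _ ->; exists y. Qed.

Lemma rank_one_fibres x x' (u v : C) : cm_proj C [set x] u = u -> cm_proj C [set x'] v = v ->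
  connected_points x x' -> approximable (rank_one u v).
Proof.
move=> xu xv xx'; apply: approximable_controlled xx' _; first exact: rank_one_bounded.
by move=> z /(rank_one_support xu xv) [/= z1 z2]; case: z z1 z2 => a b /= -> ->.
Qed.

Lemma rank_one_connected x x' (u v : C) : cm_proj C [set x] u = u -> cm_proj C [set x'] v = v ->
  u <> 0 -> v <> 0 -> approximable (rank_one u v) -> connected_points x x'.
Proof.
move=> xu xv u0 v0 /approximableP [_ ta].
have norm_gt0 (w : C) : w <> 0 -> 0 < hnorm w.
  by move=> w0; rewrite lt_def hnorm_ge0 andbT; apply/eqP => /hnorm_eq0.
have uv : 0 < hnorm u * hnorm v by rewrite mulr_gt0 ?norm_gt0.
have [|E Ec /rank_one_separated] := ta (hnorm u * hnorm v / 2); first by rewrite divr_gt0.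
move=> /(_ _ [set x] [set x']); rewrite xu xv divr_ge0 ?(ltW uv)// => /(_ isT) sep.
apply: controlledS Ec => _ ->; apply: contrapT => nE.
have h y z : [set x] y -> [set x'] z -> ~ E (y, z) by move=> -> ->.
by have := sep h; move: uv; lra.
Qed.

Lemma rank_one_homogeneous (H K : hilbertType R) (a : R[i]) (u : K) (v : H) :
  rank_one (a *: u) v = (fun y => a *: rank_one u v y).
Proof. by apply/funext => y; rewrite /rank_one !scalerA mulrC. Qed.

Context (F : (C -> C) -> (D -> D)) (isoF : operator_iso F).

Lemma op_iso0 : F (fun=> 0) = (fun=> 0).
Proof.
have := op_iso_linear isoF (-1) (@approximable0 _ _ C C) (@approximable0 _ _ C C).
rewrite (_ : (fun x : C => -1 *: 0 + 0 : C) = (fun=> 0)); last first.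
  by apply/funext => x; rewrite scaler0 addr0.
move=> ->; apply/funext => y; rewrite scaleN1r addNr//.
Qed.

Lemma op_isoZ a t : approximable t -> F (fun x => a *: t x) = (fun y => a *: F t y).
Proof.
move=> ta; have := op_iso_linear isoF a ta (@approximable0 _ _ C C).
rewrite op_iso0 (_ : (fun x => a *: t x + 0) = (fun x => a *: t x)); last first.
  by apply/funext => x; rewrite addr0.
by move=> ->; apply/funext => y; rewrite addr0.
Qed.

Lemma op_iso_bounded t : approximable t -> bounded_op (F t).
Proof. by move=> /(op_iso_approx isoF) []. Qed.

Lemma op_zero_fibres (Z : lfCoarseSpace) (B : coarseModule R Z) (H : hilbertType R) (t : B -> H) :
  bounded_op t -> (forall z u, cm_proj B [set z] u = u -> t u = 0) -> forall u, t u = 0.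
Proof.
move=> tb t0 u; rewrite -[u]/(id u) -(cm_projT B).
by apply: proj_pointwise_zero => // z _ w; apply: (t0 z); exact: cm_projK.
Qed.

(* [F p] is a minimal projection, as [p t p] is a multiple of [p] for every [t]. *)
Lemma minimal_projection x v : cm_proj C [set x] v = v -> hnorm v = 1 ->
  exists2 xi, hnorm xi = 1 & F (rank_one v v) = rank_one xi xi.
Proof.
move=> xv v1; set p := rank_one v v.
have pa : approximable p by exact: (rank_one_fibres xv xv (connected_refl x)).
have qb := op_iso_bounded pa.
have pp : p \o p = p.
  by rewrite rank_one_mul inner_self v1 expr1n; apply/funext => y; rewrite scale1r.
have qq y : F p (F p y) = F p y by rewrite -[in RHS]pp (op_iso_comp isoF).
have qadj : adjoint_pair (F p) (F p) by apply: (op_iso_adj isoF) => //; exact: rank_one_adj.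
have [y [d [yd qd]]] : exists y d, cm_proj D [set y] d = d /\ F p d <> 0.
  apply: contrapT => h.
  have /(op_iso_inj isoF pa)/(congr1 (@^~ v)) : F p = (fun=> 0).
    apply/funext; apply: op_zero_fibres => // y d yd.
    by apply: contrapT => qd; apply: h; exists y, d.
  rewrite /p rank_one_self v1 expr1n scale1r => v0.
  by move: v1; rewrite v0 hnorm0 => /esym/eqP; rewrite oner_eq0.
(* Let [F t] be this operator. Since [p t p = c p], its image [c (F p)] is the rank one operator on
   [F p d], so [F p] itself has rank one. *)
have ra : approximable (rank_one d d).
  apply: approximable_controlled (@controlled_diag Y) _; first exact: rank_one_bounded.
  by apply: subset_trans (rank_one_support yd yd) _ => -[a b] [/= -> ->].
have [t ta tr] := op_iso_surj isoF ra.
have ptp : p \o (t \o p) = (fun z => inner C (t v) v *: p z).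
  by apply/funext => z; rewrite /p /rank_one /= (bounded_opZ ta.1) innerZl mulrC scalerA.
have : F (p \o (t \o p)) = rank_one (F p d) (F p d).
  rewrite (op_iso_comp isoF pa (approximable_comp ta pa)) (op_iso_comp isoF ta pa) tr.
  by rewrite (rank_one_compr d d qadj) (rank_one_compl _ _ qb).
rewrite ptp (op_isoZ _ pa); set c := inner C _ _ => qc.
have n0 : hnorm (F p d) != 0 by apply/eqP => /hnorm_eq0.
have nC : (hnorm (F p d))%:C != 0 :> R[i] by rewrite eq_complex /= eqxx andbT.
have cE : c = (hnorm (F p d) ^+ 2)%:C.
  have /(congr1 (@^~ (F p d))) := qc; rewrite qq rank_one_self => /eqP.
  rewrite -subr_eq0 -scalerBl scaler_eq0 => /orP[|/eqP //].
  by rewrite subr_eq0 => /eqP.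
exists ((hnorm (F p d))^-1%:C *: F p d).
  by rewrite hnormZr ger0_norm ?invr_ge0 ?hnorm_ge0// mulVf.
apply/funext => z; set r : R[i] := (hnorm (F p d))^-1%:C.
have rr : Num.conj r = r by exact: conj_real.
have rc : r * r * c = 1.
  by rewrite cE /r -!rmorphM /= -invfM -expr2 mulVf// expf_neq0.
rewrite /rank_one innerZr rr scalerA mulrAC -scalerA.
have <- : c *: F p z = inner D z (F p d) *: F p d by exact: (congr1 (@^~ z) qc).
by rewrite scalerA rc scale1r.
Qed.

(** The choice depends only on the set of supported points of a component, so connected supported
    points get equal base points. *)
Lemma basepoints : exists b : X -> X, forall x, module_support C x ->
  [/\ connected_points x (b x), module_support C (b x)
    & forall y, connected_points x y -> module_support C y -> b y = b x].
Proof.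
have [[x0]|nX] := pselect (inhabited X); last first.
  by exists id => x; case: nX; constructor.
have /choice [get getP] : forall A : set X, exists x, (exists x', A x') -> A x.
  by move=> A; have [[x Ax]|nA] := pselect (exists x', A x'); [exists x|exists x0].
pose c x := [set y | connected_points x y /\ module_support C y].
exists (fun x => get (c x)) => x xC.
have [xb bC] := getP (c x) (ex_intro _ x (conj (connected_refl x) xC)).
split => // y xy yC; congr get; apply/seteqP; split => z [h zC]; split => //.
  exact: connected_trans xy h.
exact: connected_trans (connected_sym xy) h.
Qed.

(* Over a connected component with base point [b x] and unit vector [e (b x)], the operator
   [U] sends [u] to [F (rank_one u (e (b x))) (xi (b x))], where [xi (b x)] spans the range
   of the image under [F] of the projection onto [e (b x)]. *)
Theorem spatial_implementation : exists (U : C -> D) (V : D -> C), unitary_pair U V /\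
  forall t, approximable t -> F t = U \o t \o V.
Proof.
have [b bP] := basepoints.
have /choice [e eP] : forall x, exists e, module_support C x ->
    cm_proj C [set x] e = e /\ hnorm e = 1.
  move=> x; have [xC|nxC] := pselect (module_support C x); last by exists 0.
  by have [e xe e1] := module_support_unit xC; exists e.
have /choice [xi xiP] : forall x, exists xi, module_support C x ->
    hnorm xi = 1 /\ F (rank_one (e x) (e x)) = rank_one xi xi.
  move=> x; have [xC|nxC] := pselect (module_support C x); last by exists 0.
  have [xe e1] := eP x xC; have [xi xi1 Fxi] := minimal_projection xe e1.
  by exists xi.
pose S x u := rank_one (cm_proj C [set x] u) (e (b x)).
have proj_nonsupport x u : ~ module_support C x -> cm_proj C [set x] u = 0.
  by move=> nxC; apply: contrapT => /module_supportP.
have Sa x u : approximable (S x u).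
  have [xC|nxC] := pselect (module_support C x); last first.
    rewrite /S proj_nonsupport// (_ : rank_one 0 _ = fun=> 0); first exact: approximable0.
    by apply/funext => y; rewrite /rank_one scaler0.
  have [xb bC _] := bP x xC.
  exact: (rank_one_fibres (cm_projK _ _) (eP _ bC).1 xb).
pose U0 x u := F (S x u) (xi (b x)).
(* The key computation: [<F Q xi, F Q' xi'>] for rank one operators [Q], [Q']. *)
have key w w' x x' : module_support C x -> module_support C x' ->
    approximable (rank_one w (e (b x))) -> approximable (rank_one w' (e (b x'))) ->
    inner D (F (rank_one w (e (b x))) (xi (b x))) (F (rank_one w' (e (b x'))) (xi (b x')))
    = inner C w w'.
  move=> xC x'C Qa Q'a.
  have Pa' : approximable (rank_one (e (b x')) w').
    by apply: (approximable_adj Q'a); [exact: rank_one_bounded|exact: rank_one_adj].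
  have [xb bC bb] := bP x xC; have [x'b' b'C _] := bP x' x'C.
  have FQ' := op_iso_adj isoF Q'a Pa' (@rank_one_adj _ _ _ _ _).
  rewrite (innerC _ (F (rank_one w _) _)) FQ' -innerC.
  rewrite -[F _ (F _ _)](congr1 (@^~ (xi (b x))) (op_iso_comp isoF Pa' Qa)).
  have Pa : approximable (rank_one (e (b x')) w' \o rank_one w (e (b x))).
    exact: approximable_comp.
  move: Pa; rewrite rank_one_mul => Pa.
  have [->|ww'0] := eqVneq (inner C w w') 0.
    rewrite (_ : (fun y => 0 *: _) = (fun=> 0)) ?op_iso0 ?linear0l//.
    by apply/funext => y; rewrite scale0r.
  have [eb e1] := eP _ bC; have [eb' e1'] := eP _ b'C.
  have nz z : hnorm (e z) = 1 -> e z <> 0.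
    by move=> h ez; move: h; rewrite ez hnorm0 => /esym/eqP; rewrite oner_eq0.
  (* The product of the two approximable operators is a nonzero rank one operator between the base
     fibres, which connects the base points and hence identifies them. *)
  have conn : connected_points (b x') (b x).
    apply: (@rank_one_connected _ _ (inner C w w' *: e (b x')) (e (b x))) => //.
    - by rewrite cm_projZ eb'.
    - move=> /eqP; rewrite scaler_eq0 (negbTE ww'0) /= => /eqP; exact: nz.
    - exact: nz.
    - by rewrite rank_one_homogeneous.
  have bE : b x' = b x.
    apply: bb => //; apply: connected_trans xb _; apply: connected_trans (connected_sym conn) _.
    exact: connected_sym.
  rewrite bE in Pa *.
  have ba : approximable (rank_one (e (b x)) (e (b x))).
    exact: (rank_one_fibres eb eb (connected_refl _)).
  have [xi1 Fxi] := xiP _ bC.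
  rewrite (op_isoZ _ ba) Fxi rank_one_self xi1 expr1n scale1r innerZl inner_self.
  by rewrite xi1 expr1n mulr1.
have U0z x u : cm_proj C [set x] u = 0 -> U0 x u = 0.
  move=> xu; rewrite /U0 /S xu (_ : rank_one 0 _ = fun=> 0) ?op_iso0//.
  by apply/funext => y; rewrite /rank_one scaler0.
have U0l x : linear (U0 x).
  move=> a u v; rewrite /U0 -[a *: F _ _ + _](congr1 (@^~ (xi (b x)))
    (op_iso_linear isoF a (Sa x u) (Sa x v))); congr (F _ _).
  by apply/funext => y; rewrite /S /rank_one cm_projD cm_projZ scalerDr !scalerA mulrC.
have U0i x x' u u' : rin (U0 x u) (U0 x' u') = rin (cm_proj C [set x] u) (cm_proj C [set x'] u').
  rewrite /rin; have [xC|/proj_nonsupport xu] := pselect (module_support C x); last first.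
    by rewrite U0z// xu !linear0l.
  have [x'C|/proj_nonsupport xu'] := pselect (module_support C x'); last first.
    by rewrite (U0z x' u') ?xu'// !linear0r.
  by rewrite /U0 /S key//; exact: Sa.
have U0sum (s : seq {classic X}) u :
    hnorm (\sum_(x <- s) U0 x u) ^+ 2 = hnorm (\sum_(x <- s) cm_proj C [set x : X] u) ^+ 2.
  elim: s => [|x s IH]; first by rewrite !big_nil !hnorm0.
  rewrite !big_cons !hnormD_sq IH (hnorm_sq (U0 x u)) U0i -hnorm_sq.
  congr (_ + _ * _ + _); elim: s {IH} => [|y s IH]; first by rewrite !big_nil !rin0r.
  by rewrite !big_cons !rinDr IH U0i.
(* Finite partial sums over fibres, directed by inclusion; an ultrafilter refining this direction
   yields the full sum weakly. *)
pose K := {s : seq {classic X} | uniq s}.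
pose Fl : set_system K := [set P | exists s0 : seq {classic X},
  forall k : K, {subset s0 <= sval k} -> P k].
have FF : ProperFilter Fl.
  split.
    move=> [s0 s0P]; apply: (s0P (exist _ (undup s0) (undup_uniq s0))) => x /=.
    by rewrite mem_undup.
  split; first by exists [::].
    move=> P Q [s0 s0P] [s1 s1P]; exists (s0 ++ s1) => k kP.
    split; [apply: s0P|apply: s1P] => x xs; apply: kP; rewrite mem_cat xs ?orbT//.
  by move=> P Q PQ [s0 s0P]; exists s0 => k /s0P /PQ.
have [G [GU FG]] := ultraFilterLemma FF.
have [||U [Ub _ UG]] := @weak_limit R K G C D (fun k u => \sum_(x <- sval k) U0 x u) 1 GU ler01.
- move=> k a u v; rewrite scaler_sumr -big_split /=; apply: eq_bigr => x _.
  exact: U0l.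
- move=> [s us] u /=; rewrite mul1r ler_hnorm_sq U0sum -proj_seq_sum// -ler_hnorm_sq.
  exact: cm_proj_le.
have Ux x u : cm_proj C [set x] u = u -> U u = U0 x u.
  move=> xu; apply: rin_ext => w; apply: (cvg_near_cst_eq _ (UG u w)).
  apply: FG; exists [:: x : {classic X}] => -[s us] /= sx; congr rin.
  have xs : (x : {classic X}) \in s by apply: sx; rewrite inE eqxx.
  rewrite (bigD1_seq (x : {classic X}))//= big1 ?addr0// => y yx; apply: U0z.
  rewrite -xu cm_projM (_ : _ `&` _ = set0) ?cm_proj0//.
  by rewrite -subset0 => z [/= zy zx]; move: yx; rewrite -zy zx eqxx.
have [V [Vb UV _]] := adjoint_exists Ub.
have projx x u w : cm_proj C [set x] w = w -> rin (cm_proj C [set x] u) w = rin u w.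
  by move=> xw; rewrite cm_proj_rin xw.
have fibre_ext u u' : (forall x w, cm_proj C [set x] w = w -> rin u w = rin u' w) -> u = u'.
  move=> uu'; apply/eqP; rewrite -subr_eq0; apply/eqP; apply: proj_zero => x.
  by apply: rin_ext => w; rewrite rin0l cm_proj_rin rinBl (uu' x) ?subrr// cm_projK.
(* Weak limits may lose norm, so isometry is checked again, on vectors of single fibres, where [U]
   is [U0]. *)
have UK : cancel U V.
  move=> u; apply/eqP; rewrite -subr_eq0; apply/eqP.
  apply: (op_zero_fibres (t := fun u => V (U u) - u)) => //.
    exact: (bounded_opB (bounded_op_comp Vb Ub) (@bounded_op_id R C)).
  move=> x {}u xu; apply/eqP; rewrite subr_eq0; apply/eqP; apply: fibre_ext => x' w x'w.
  rewrite (adjoint_rinE (adjoint_sym UV)) (Ux x u xu) (Ux x' w x'w) U0i xu.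
  by rewrite x'w.
have Uinner u u' : rin (U u) (U u') = rin u u' by rewrite (adjoint_rinE UV) UK.
have Uinj u : U u = 0 -> u = 0 by move=> Uu; rewrite -(UK u) Uu (linear_op0 Vb.1).
have FU t : approximable t -> forall u, F t (U u) = U (t u).
  move=> ta u; apply/eqP; rewrite -subr_eq0; apply/eqP.
  apply: (op_zero_fibres (t := fun u => F t (U u) - U (t u))) => //.
    exact: (bounded_opB (bounded_op_comp (op_iso_bounded ta) Ub) (bounded_op_comp Ub ta.1)).
  move=> x {}u xu; apply/eqP; rewrite subr_eq0; apply/eqP.
  have [xC|nxC] := pselect (module_support C x); last first.
    have -> : u = 0 by rewrite -xu proj_nonsupport.
    rewrite (linear_op0 Ub.1) (linear_op0 (op_iso_bounded ta).1) (linear_op0 ta.1.1).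
    by rewrite (linear_op0 Ub.1).
  rewrite (Ux x u xu) /U0 /S xu.
  have Qa : approximable (rank_one u (e (b x))) by have := Sa x u; rewrite /S xu.
  have Pa : approximable (rank_one (t u) (e (b x))).
    by rewrite -(rank_one_compl _ _ ta.1); exact: approximable_comp.
  rewrite -[F t (F _ _)](congr1 (@^~ (xi (b x))) (op_iso_comp isoF ta Qa)).
  rewrite (rank_one_compl _ _ ta.1).
  (* Surjectivity of [U] is not known yet. Instead [z] has the norm of [t u] and [V z = t u], so the
     squared distance from [z] to [U (t u)] expands to zero. *)
  set z := F _ _.
  have zz : hnorm z ^+ 2 = hnorm (t u) ^+ 2 by rewrite !hnorm_sq /rin /z key.
  have Vz : V z = t u.
    apply: fibre_ext => x' w x'w; rewrite (adjoint_rinE (adjoint_sym UV)) (Ux x' w x'w).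
    have [x'C|nx'C] := pselect (module_support C x').
      rewrite /U0 /S x'w /rin key//.
      by have := Sa x' w; rewrite /S x'w.
    have w0 : w = 0 by rewrite -x'w proj_nonsupport.
    by rewrite U0z ?x'w// w0 !rin0r.
  apply/eqP; rewrite -subr_eq0; apply/eqP/hnorm_eq0/eqP; rewrite -sqrf_eq0 hnormB_sq.
  rewrite -(adjoint_rinE (adjoint_sym UV)) Vz -hnorm_sq zz.
  by rewrite [X in _ + X]hnorm_sq Uinner -hnorm_sq; apply/eqP; lra.
(* For nonzero [d] in a fibre, the operator [rank_one d d] is some [F t]; its value at [U u] is both
   [U (t u)] and a multiple of [d], nonzero for suitable [u]. *)
have VK : cancel V U.
  move=> d; apply/eqP; rewrite -subr_eq0; apply/eqP.
  apply: (op_zero_fibres (t := fun d => U (V d) - d)) => //.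
    exact: (bounded_opB (bounded_op_comp Ub Vb) (@bounded_op_id R D)).
  move=> y {}d yd; apply/eqP; rewrite subr_eq0; apply/eqP.
  have [->|/eqP d0] := eqVneq d 0; first by rewrite (linear_op0 Vb.1) (linear_op0 Ub.1).
  have ra : approximable (rank_one d d).
    apply: approximable_controlled (@controlled_diag Y) _; first exact: rank_one_bounded.
    by apply: subset_trans (rank_one_support yd yd) _ => -[a c] [/= -> ->].
  have [t ta tr] := op_iso_surj isoF ra.
  have [u tu] : exists u, t u <> 0.
    apply: contrapT => h; apply: d0.
    have t0 : t = (fun=> 0) by apply/funext => u; apply: contrapT => tu; apply: h; exists u.
    have /(congr1 (@^~ d)) : rank_one d d = (fun=> 0) by rewrite -tr t0 op_iso0.
    rewrite rank_one_self => /eqP; rewrite scaler_eq0 => /orP[|/eqP//].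
    by rewrite eq_complex /= eqxx andbT sqrf_eq0 => /eqP /hnorm_eq0.
  have := FU t ta u; rewrite tr /rank_one; set c := inner D _ _ => cd.
  have c0 : c != 0.
    by apply/eqP => c0; apply: tu; apply: Uinj; rewrite -cd c0 scale0r.
  have -> : d = U (c^-1 *: t u).
    by rewrite (bounded_opZ Ub) -cd scalerA mulVf// scale1r.
  by rewrite UK.
exists U, V; split; first by split.
by move=> t ta; apply/funext => d /=; rewrite -(FU t ta) VK.
Qed.

End Spatial.

Section ApproxOps.
Context {R : realType} {X : lfCoarseSpace}.
Implicit Types C D : coarseModule R X.

Definition mk_approx C D (t : C -> D) (h : approximable t) : approxOp C D :=
  ApproxOp (introT (asboolP _) h).

Lemma approxOpP C D (t : approxOp C D) : approximable t.
Proof. exact: elimT (asboolP _) (approx_funP t). Qed.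

Lemma approxOp_ext C D (s t : approxOp C D) : s = t :> (C -> D) -> s = t.
Proof. by move=> st; apply: val_inj. Qed.

Lemma approxOp_bounded C D (t : approxOp C D) : bounded_op t.
Proof. by case: (approxOpP t). Qed.

End ApproxOps.

(** * From isomorphisms of algebras to coarse maps *)

Section StarIsomorphisms.
Context {R : realType} {X Y : lfCoarseSpace} {C : coarseModule R X} {D : coarseModule R Y}.
Variable phi : approxOp C C -> approxOp D D.
Hypothesis isophi : is_star_isomorphism phi.

(** Zero off the approximable functions is a mere default; [operator_iso] constrains approximable
    arguments only. *)
Definition raw_iso (t : C -> C) : D -> D :=
  if pselect (approximable t) is left h then phi (mk_approx h) else fun=> 0.

Lemma raw_isoE t (h : approximable t) : raw_iso t = phi (mk_approx h).
Proof.
rewrite /raw_iso; case: pselect => // h'; congr (approx_fun (phi _)).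
exact: approxOp_ext.
Qed.

Lemma raw_isoP (t : approxOp C C) : raw_iso t = phi t.
Proof. by rewrite (raw_isoE (approxOpP t)); congr (approx_fun (phi _)); exact: approxOp_ext. Qed.

Lemma raw_iso_operator_iso : operator_iso raw_iso.
Proof.
have [phib phil phim phia] := isophi; split.
- by move=> t ta; rewrite (raw_isoE ta); exact: approxOpP.
- move=> s t sa ta; rewrite (raw_isoE sa) (raw_isoE ta) (raw_isoE (approximable_comp sa ta)).
  have -> : mk_approx (approximable_comp sa ta) = approx_comp (mk_approx sa) (mk_approx ta).
    exact: approxOp_ext.
  by rewrite phim.
- move=> a s t sa ta; rewrite (raw_isoE sa) (raw_isoE ta) (raw_isoE (approximableZD a sa ta)).
  have -> : mk_approx (approximableZD a sa ta) = a *: mk_approx sa + mk_approx ta.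
    exact: approxOp_ext.
  by rewrite phil.
- by move=> s t sa ta st; rewrite (raw_isoE sa) (raw_isoE ta); exact: phia.
- move=> r ra; have [psi psiK Kpsi] := phib.
  exists (psi (mk_approx ra)); first exact: approxOpP.
  by rewrite raw_isoP Kpsi.
- move=> t ta; rewrite (raw_isoE ta) => t0.
  have phi0 : phi 0 = 0.
    by have := phil (-1) 0 0; rewrite scaler0 addr0 scaleN1r addNr.
  have : mk_approx ta = 0 by apply: (bij_inj phib); rewrite phi0; exact: approxOp_ext.
  by move=> /(congr1 (@approx_fun _ _ _ _)).
Qed.

(** The second half is surjectivity of [phi]: every approximable [s] is already conjugated from some
    approximable operator. *)
Lemma star_iso_conj_approx (U : C -> D) (V : D -> C) : unitary_pair U V ->
  (forall t, phi t = U \o t \o V :> (D -> D)) ->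
  (forall t : C -> C, approximable t -> approximable (U \o t \o V)) /\
  (forall s : D -> D, approximable s -> approximable (V \o s \o U)).
Proof.
move=> UV phiE; split=> [t ta|s sa].
  by have := approxOpP (phi (mk_approx ta)); rewrite phiE.
have [psi _ Kpsi] := star_iso_bijective isophi.
have := phiE (psi (mk_approx sa)); rewrite Kpsi /= => ->.
suff -> : V \o (U \o psi (mk_approx sa) \o V) \o U = psi (mk_approx sa) by exact: approxOpP.
by apply/funext => v /=; rewrite !(unitaryK UV).
Qed.

Theorem star_iso_induces (hX : countably_generated X) (hY : countably_generated Y) :
  faithful_module C -> faithful_module D -> exists f, induces phi f.
Proof.
move=> fC fD; have [U [V [UV phiE]]] := spatial_implementation raw_iso_operator_iso.
have phiUV t : phi t = U \o t \o V :> (D -> D) by rewrite -raw_isoP (phiE _ (approxOpP t)).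
have [UVa VUa] := star_iso_conj_approx UV phiUV.
have [f [d [E' [E [cf d01 E'c Ec fE]]]]] := unitary_rigidity hX hY UV UVa VUa fC fD.
exists f; split => //; exists U, V; split => //.
by exists d, E', E; split.
Qed.

Lemma induces_spreads (hX : countably_generated X) (hY : countably_generated Y) f :
  faithful_module C -> induces phi f -> exists (U : C -> D) (V : D -> C),
    [/\ unitary_pair U V, forall t, phi t = U \o t \o V :> (D -> D) & spreads (U := U) f].
Proof.
move=> fC [_ [U [V [UV phiE [d [E' [E [/andP[d0 _] E'c Ec fE]]]]]]]].
have [UVa VUa] := star_iso_conj_approx UV phiE.
exists U, V; split => //.
exact: (unitary_spreads hX hY UV UVa VUa fC d0 E'c Ec fE).
Qed.

End StarIsomorphisms.

Lemma spreads_close (R : realType) (X Y : lfCoarseSpace) (C : coarseModule R X)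
    (D : coarseModule R Y) (U : C -> D) (f g : X -> Y) :
  coarse_close f g -> spreads (U := U) f -> spreads (U := U) g.
Proof.
move=> fg fU e e0; have [E Ec EP] := fU e e0.
have Q := fg _ (@controlled_diag X).
exists (rel_comp E [set (f xy.1, g xy.2) | xy in [set xy | xy.1 = xy.2]]).
  exact: controlled_comp.
move=> x u xu; apply: le_trans (EP x u xu); apply: cm_proj_mono; apply: subsetC.
by move=> y [_ -> Ey]; exists (g x) => //; exists (f x) => //; exists (x, x).
Qed.

Lemma end_castK (R : realType) (k : rankBound) (X : lfCoarseSpace) (A B : moduleObj R k X)
  (e : A = B) (t : approxOp A A) : end_cast (esym e) (end_cast e t) = t.
Proof. by case: _ / e. Qed.

(** * Construction of the functor *)

Section FunctorOfFamily.
Context {R : realType} {k : rankBound} {X Y : lfCoarseSpace}.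
Context (hY : countably_generated Y).
Context {I : Type} (CX : I -> moduleObj R k X) (CY : I -> moduleObj R k Y).
Context (phi : forall i, approxOp (CX i) (CX i) -> approxOp (CY i) (CY i)).
Hypothesis hphi : forall i, is_star_isomorphism (@phi i).
Hypothesis hfam : forall i j (e : CX i = CX j), exists e' : CY i = CY j,
  forall t, end_cast e' (@phi i t) = @phi j (end_cast e t).
Context (f : X -> Y) (ef : coarse_equivalence f).
Hypothesis hspread : forall i, exists (U : CX i -> CY i) (V : CY i -> CX i),
  [/\ unitary_pair U V, forall t, @phi i t = U \o t \o V :> (CY i -> CY i)
    & spreads (U := U) f].

Let cf : coarse_map f := proj1 ef.

(** [od_compat] ranges over every index [j] of the object, since an object may occur several times
    in the family but can have only one image. *)
Record object_data (A : moduleObj R k X) := ObjectData {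
  od_obj : moduleObj R k Y;
  od_U : A -> od_obj;
  od_V : od_obj -> A;
  od_unitary : unitary_pair od_U od_V;
  od_approx : @approximable R Y (pushforward cf A) od_obj od_U;
  od_inv_approx : @approximable R Y od_obj (pushforward cf A) od_V;
  od_compat : forall j (e : CX j = A), exists e' : od_obj = CY j,
    forall t (s : approxOp od_obj od_obj),
      s = od_U \o end_cast e t \o od_V :> (od_obj -> od_obj) -> end_cast e' s = @phi j t }.

Arguments od_U {A} o _.
Arguments od_V {A} o _.

Lemma object_data_exists (A : moduleObj R k X) : exists _ : object_data A, True.
Proof.
have [[i <-]|nA] := pselect (exists i, CX i = A).
  have [U [V [UV phiE fU]]] := hspread i.
  have [UVa _] := star_iso_conj_approx (hphi i) UV phiE.
  unshelve eexists (@ObjectData (CX i) (CY i) U V UV _ _ _) => //.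
  - exact: (spread_approximable hY UV UVa cf fU).
  - exact: (spread_inverse_approximable hY UV UVa cf fU).
  (* The unitary came from the index [i]; [hfam] reconciles it with any other index of the same
     module. *)
  move=> j e; have [e' e'P] := hfam (esym e); exists e' => t s sE.
  have -> : s = @phi i (end_cast e t) by apply: approxOp_ext; rewrite sE phiE.
  by rewrite e'P end_castK.
(* Off the family the image is the pushforward; the Hilbert space is unchanged, so the rank bound
   holds and the identity is the unitary. *)
have UV : @unitary_pair R A (pushforward cf A) id id.
  by split => //; exact: bounded_op_id.
unshelve eexists (@ObjectData A (@ModuleObj R k Y (pushforward cf A) _) id id UV _ _ _) => //.
- exact: obj_rank A.
- exact: (@approximable_id R Y (pushforward cf A)).
- exact: (@approximable_id R Y (pushforward cf A)).
- by move=> j e; case: nA; exists j.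
Qed.

Let data (A : moduleObj R k X) : object_data A := projT1 (cid (object_data_exists A)).
Let obj A := od_obj (data A).

Lemma conj_approximable (A B : moduleObj R k X) (t : approxOp A B) :
  approximable (od_U (data B) \o t \o od_V (data A)).
Proof.
apply: (@approximable_comp R Y (obj A) (pushforward cf A) (obj B)
  (od_U (data B) \o t) (od_V (data A))).
  apply: (@approximable_comp R Y (pushforward cf A) (pushforward cf B) (obj B) (od_U (data B)) t).
    exact: od_approx.
  exact: (pushforward_approximable cf (approxOpP t)).
exact: od_inv_approx.
Qed.

Definition conj_mor (A B : moduleObj R k X) (t : approxOp A B) : approxOp (obj A) (obj B) :=
  mk_approx (conj_approximable t).

Lemma conj_mor_linear (A B : moduleObj R k X) : linear (@conj_mor A B).
Proof.
move=> a s t; apply: approxOp_ext; apply/funext => v /=.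
exact: (unitary_bounded (od_unitary (data B))).1.
Qed.

Definition conj_mor_lin (A B : moduleObj R k X) :
    {linear approxOp A B -> approxOp (obj A) (obj B)} :=
  HB.pack (@conj_mor A B)
    (GRing.isLinear.Build R[i] (approxOp A B) (approxOp (obj A) (obj B)) *:%R
      (@conj_mor A B) (@conj_mor_linear A B)).

Definition conj_functor : starFunctor R k X Y.
Proof.
refine (@StarFunctor R k X Y obj conj_mor_lin _ _ _).
- move=> A; apply: approxOp_ext; apply/funext => v /=.
  exact: (unitary_invK (od_unitary (data A))).
- move=> A B D s t; apply: approxOp_ext; apply/funext => v /=.
  by rewrite (unitaryK (od_unitary (data B))).
- move=> A B t s ts.
  apply: (adjoint_comp (adjoint_sym (unitary_adj (od_unitary (data A))))).
  exact: (adjoint_comp ts (unitary_adj (od_unitary (data B)))).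
Defined.

(** Conjugating back yields an operator approximable between pushforwards, and a coarse equivalence
    reflects approximability to [X]. *)
Lemma conj_functor_full : functor_full conj_functor.
Proof.
move=> A B s.
have sa : @approximable R X A B (od_V (data B) \o s \o od_U (data A)).
  apply: (pushforward_approximable_inv (cf := cf) ef).
  apply: (@approximable_comp R Y (pushforward cf A) (obj A) (pushforward cf B)
    (od_V (data B) \o s) (od_U (data A))); last exact: od_approx.
  apply: (@approximable_comp R Y (obj A) (obj B) (pushforward cf B) (od_V (data B)) s).
    exact: od_inv_approx.
  exact: approxOpP.
exists (mk_approx sa); apply: approxOp_ext; apply/funext => v /=.
by rewrite (unitary_invK (od_unitary (data B))) (unitary_invK (od_unitary (data A))).
Qed.

Lemma conj_functor_faithful : functor_faithful conj_functor.
Proof.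
move=> A B s t /(congr1 (@approx_fun _ _ _ _)) /= st; apply: approxOp_ext.
apply/funext => v; have := congr1 (@^~ (od_U (data A) v)) st => /=.
rewrite (unitaryK (od_unitary (data A))) => /(congr1 (od_V (data B))).
by rewrite !(unitaryK (od_unitary (data B))).
Qed.

Lemma conj_functor_family i : exists e : functor_obj conj_functor (CX i) = CY i,
  forall t, end_cast e (functor_mor conj_functor (CX i) (CX i) t) = @phi i t.
Proof.
have [e eP] := od_compat (data (CX i)) (erefl (CX i)).
by exists e => t; apply: eP.
Qed.

End FunctorOfFamily.

(** The factor [1 + e'] bounds the norm of the approximant of the contraction [t]. *)
Lemma approx_at_comp (R : realType) (Z : lfCoarseSpace) (C1 C2 C3 : coarseModule R Z)
    (s : C2 -> C3) (t : C1 -> C2) (M e e' : R) (E E' : set (Z * Z)) :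
  0 <= M -> 0 <= e -> bounded_op s ->
  (forall v, hnorm (s v) <= M * hnorm v) -> (forall v, hnorm (t v) <= hnorm v) ->
  approx_at s e E -> approx_at t e' E' ->
  approx_at (s \o t) (M * e' + e * (1 + e')) (rel_comp E E').
Proof.
move=> M0 e0 sb sM t1 [s' [s'b s'E ss']] [t' [t'b t'E tt']].
exists (s' \o t'); split; first exact: bounded_op_comp.
  apply: subset_trans (support_comp s'b t'b) _ => -[z x] [y /= tx sz].
  by exists y; [exact: s'E|exact: t'E].
move=> v; have -> : (s \o t) v - (s' \o t') v = s (t v - t' v) + (s (t' v) - s' (t' v)).
  by rewrite /= (bounded_opBE sb) addrA subrK.
apply: (le_trans (hnormD _ _)); rewrite mulrDl; apply: lerD.
  by apply: (le_trans (sM _)); rewrite -mulrA ler_wpM2l.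
apply: (le_trans (ss' _)); rewrite -mulrA ler_wpM2l// mulrDl mul1r.
have -> : t' v = t v - (t v - t' v) by rewrite opprB addrC subrK.
by apply: (le_trans (hnormB _ _)); apply: lerD.
Qed.

(** * Closeness of the coarse maps from a functor *)

Section FunctorRigidity.
Context {R : realType} {k : rankBound} {X Y : lfCoarseSpace}.
Context (hY : countably_generated Y).
Context (F : starFunctor R k X Y).

Lemma functor_mk_comp (A B D : moduleObj R k X) (s : B -> D) (t : A -> B) (r : A -> D)
    (sa : approximable s) (ta : approximable t) (ra : approximable r) : r = s \o t ->
  functor_mor F A D (mk_approx ra) =
  functor_mor F B D (mk_approx sa) \o functor_mor F A B (mk_approx ta)
  :> (functor_obj F A -> functor_obj F D).
Proof.
move=> rE; have -> : mk_approx ra = approx_comp (mk_approx sa) (mk_approx ta).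
  exact: approxOp_ext.
by rewrite functor_comp.
Qed.

Context {A B : moduleObj R k X}.
Context {UA : A -> functor_obj F A} {VA : functor_obj F A -> A}.
Context {UB : B -> functor_obj F B} {VB : functor_obj F B -> B}.
Hypotheses (UVA : unitary_pair UA VA) (UVB : unitary_pair UB VB).
Hypothesis FA : forall t,
  functor_mor F A A t = UA \o t \o VA :> (functor_obj F A -> functor_obj F A).
Hypothesis FB : forall t,
  functor_mor F B B t = UB \o t \o VB :> (functor_obj F B -> functor_obj F B).

(** The image [P] absorbs the projections onto [UA v] and [UB w], and [P'] after [P] is the first of
    them. So [P] is the rank one operator between these unit vectors up to the phase [c], and it is
    tested as in [rank_one_separated]. *)
Lemma functor_rank_one (x x' : X) (v : A) (w : B) (G H : set Y) (e : R) E
    (h : approximable (rank_one w v)) :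
  cm_proj A [set x] v = v -> cm_proj B [set x'] w = w -> hnorm v = 1 -> hnorm w = 1 ->
  approx_at (functor_mor F A B (mk_approx h)) e E ->
  (forall y z, H y -> G z -> ~ E (y, z)) ->
  hnorm (cm_proj _ H (UB w)) * hnorm (cm_proj _ G (UA v)) <= e.
Proof.
move=> xv xw v1 w1 [s [sb sE se]] sep.
have ra (M : coarseModule R X) z (u : M) : cm_proj M [set z] u = u -> approximable (rank_one u u).
  move=> zu; apply: approximable_controlled (@controlled_diag X) _; first exact: rank_one_bounded.
  by apply: subset_trans (rank_one_support zu zu) _ => -[a c] [/= -> ->].
have va := ra _ _ _ xv; have wa := ra _ _ _ xw.
set P := functor_mor F A B (mk_approx h) : functor_obj F A -> functor_obj F B.
have h' : approximable (rank_one v w).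
  by apply: (approximable_adj h); [exact: rank_one_bounded|exact: rank_one_adj].
set P' := functor_mor F B A (mk_approx h') : functor_obj F B -> functor_obj F A.
have PP' : adjoint_pair P P' by apply: functor_adj; exact: rank_one_adj.
have mul1 (M1 M2 : hilbertType R) (M3 : hilbertType R) (u : M1) (u2 : M2) (u3 : M3) :
    hnorm u2 = 1 ->
    rank_one u u3 = rank_one u u2 \o rank_one u2 u3.
  move=> u21; rewrite rank_one_mul inner_self u21 expr1n.
  by apply/funext => z; rewrite scale1r.
have PA : P = P \o rank_one (UA v) (UA v).
  rewrite -(unitary_rank_one UVA) -(FA (mk_approx va)).
  by apply: (functor_mk_comp h va h); exact: mul1.
have PB : P = rank_one (UB w) (UB w) \o P.
  rewrite -(unitary_rank_one UVB) -(FB (mk_approx wa)).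
  by apply: (functor_mk_comp wa h h); exact: mul1.
have P'P : P' \o P = rank_one (UA v) (UA v).
  rewrite -(unitary_rank_one UVA) -(FA (mk_approx va)).
  by apply/esym; apply: (functor_mk_comp h' h va); exact: mul1.
have Pb : bounded_op P by exact: approxOp_bounded.
have Uv1 : hnorm (UA v) = 1 by rewrite (unitary_norm UVA).
have Uw1 : hnorm (UB w) = 1 by rewrite (unitary_norm UVB).
have Pv1 : hnorm (P (UA v)) = 1.
  apply/eqP; rewrite -(@eqrXn2 _ 2) ?hnorm_ge0// expr1n hnorm_sq (adjoint_rinE PP').
  rewrite [P' _](congr1 (@^~ (UA v)) P'P) rank_one_self Uv1 expr1n scale1r -hnorm_sq.
  by rewrite Uv1 expr1n.
set c := inner _ (P (UA v)) (UB w).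
have Pv : P (UA v) = c *: UB w by rewrite {1}PB.
have c1 : cabs c = 1 by move: Pv1; rewrite Pv hnormZ Uw1 mulr1.
set p := cm_proj _ G (UA v).
have Pp : P p = (hnorm p ^+ 2)%:C *: (c *: UB w).
  rewrite PA /= /rank_one (bounded_opZ Pb) Pv; congr (_ *: _).
  by rewrite -inner_self /p [in RHS](cm_proj_adj) cm_projK -cm_proj_adj.
have [->|p0] := eqVneq (hnorm p) 0.
  rewrite mulr0; have := se (UA v); rewrite Uv1 mulr1; apply: le_trans; exact: hnorm_ge0.
have p_gt0 : 0 < hnorm p by rewrite lt_def p0 hnorm_ge0.
rewrite -(ler_pM2r p_gt0) -mulrA -expr2; apply: le_trans (se p).
apply: le_trans (cm_proj_le H _); rewrite cm_projB {2}/p (support_separated _ sb sE sep) subr0.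
by rewrite -/P Pp !cm_projZ hnormZr hnormZ -/(cabs c) c1 mul1r ger0_norm ?sqr_ge0// mulrC.
Qed.

(** Both images keep norm 3/4 near [f a] and [g b]; separated neighbourhoods would give 9/16 at most
    1/4. *)
Lemma functor_rank_one_close (f g : X -> Y) : spreads (U := UA) f -> spreads (U := UB) g ->
  forall E, controlled E -> exists2 E', controlled E' &
    forall a b (v : A) (w : B) (h : approximable (rank_one w v)),
      cm_proj A [set a] v = v -> cm_proj B [set b] w = w -> hnorm v = 1 -> hnorm w = 1 ->
      approx_at (functor_mor F A B (mk_approx h)) 4^-1 E -> E' (f a, g b).
Proof.
move=> fU gU E Ec.
have [|E1 E1c E1P] := fU 4^-1; first by rewrite invr_gt0.
have [|E2 E2c E2P] := gU 4^-1; first by rewrite invr_gt0.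
exists (rel_comp (rel_inv E1) (rel_comp (rel_inv E) E2)).
  by do !apply: controlled_comp => //; exact: controlled_inv.
move=> a b v w h av bw v1 w1 FE; apply: contrapT => nE.
have half (M : coarseModule R Y) (S : set Y) (u : M) : hnorm u = 1 ->
    hnorm (cm_proj M (~` S) u) <= 4^-1 -> 3 / 4 <= hnorm (cm_proj M S u).
  move=> u1 Su; have : hnorm u <= hnorm (cm_proj M S u) + hnorm (cm_proj M (~` S) u).
    by apply: le_trans (hnormD _ _); rewrite cm_projCE addrC subrK.
  by rewrite u1; move: Su; lra.
have gv : 3 / 4 <= hnorm (cm_proj (functor_obj F A) (thickening E1 [set f a]) (UA v)).
  apply: half; first by rewrite (unitary_norm UVA).
  by have := E1P a v av; rewrite v1 mulr1.
have hw : 3 / 4 <= hnorm (cm_proj (functor_obj F B) (thickening E2 [set g b]) (UB w)).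
  apply: half; first by rewrite (unitary_norm UVB).
  by have := E2P b w bw; rewrite w1 mulr1.
have : hnorm (cm_proj (functor_obj F B) (thickening E2 [set g b]) (UB w)) *
    hnorm (cm_proj (functor_obj F A) (thickening E1 [set f a]) (UA v)) <= 4^-1.
  apply: functor_rank_one av bw v1 w1 FE _ => y z [_ -> E2y] [_ -> E1z] Eyz.
  by apply: nE; exists z => //; exists y.
apply/negP; rewrite -ltNge; apply: (@lt_le_trans _ _ (3 / 4 * (3 / 4))); first by lra.
by apply: ler_pM => //; rewrite divr_ge0.
Qed.

(** Distinct base points let a projection cut one summand out of the sum of all rank one operators.
    Its image is a fixed operator [S] times a conjugated projection, and [uniform_projections]
    covers the latter for all [n] at once. *)
Lemma functor_uniform_rank_one (a b : nat -> X) (v : nat -> A) (w : nat -> B) (E : set (X * X)) :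
  injective a -> injective b -> controlled E ->
  (forall n, E (b n, a n)) ->
  (forall n, cm_proj A [set a n] (v n) = v n /\ hnorm (v n) = 1) ->
  (forall n, cm_proj B [set b n] (w n) = w n /\ hnorm (w n) = 1) ->
  exists2 E', controlled E' & forall n (h : approximable (rank_one (w n) (v n))),
    approx_at (functor_mor F A B (mk_approx h)) 4^-1 E'.
Proof.
move=> ai bi Ec Eba vP wP.
have ortho (M : coarseModule R X) (c : nat -> X) (u : nat -> M) : injective c ->
    (forall n, cm_proj M [set c n] (u n) = u n /\ hnorm (u n) = 1) -> orthonormal_seq u.
  move=> ci uP i j; have [->|ij] := eqVneq i j; first by rewrite inner_self (uP j).2 expr1n.
  rewrite -(uP i).1 -(uP j).1 [inner _ _ _](cm_proj_adj) cm_projM (_ : _ `&` _ = set0).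
    by rewrite cm_proj0 linear0r.
  by rewrite -subset0 => _ [-> /ci /eqP]; rewrite (negPf ij).
have ov := ortho _ _ _ ai vP; have ow := ortho _ _ _ bi wP.
have [G [T [GP ooG Tb TP]]] := orthonormal_operators ow ov.
have supp n : op_support (rank_one (w n) (v n)) `<=` E.
  by apply: subset_trans (rank_one_support (wP n).1 (vP n).1) _ => -[y x] [/= -> ->].
have Ta : approximable (T setT).
  apply: approximable_controlled (Tb setT).1 Ec _.
  exact: orthonormal_support (TP setT) supp.
have Tn n : rank_one (w n) (v n) = T setT \o cm_proj A [set a n].
  apply/funext => u; apply/esym; apply: rin_ext => z.
  apply: (cvg_near_cst_eq _ (TP setT _ _)); apply: ooG.
  exists n.+1 => // m /= nm; rewrite (bigD1 (Ordinal nm))//= big1 => [|i ni].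
    rewrite addr0 asboolT// /rank_one [inner _ _ _](cm_proj_adj) (vP n).1//.
  rewrite asboolT// [inner _ _ _](cm_proj_adj) -(vP i).1 cm_projM (_ : _ `&` _ = set0).
    by rewrite cm_proj0 linear0r scale0r.
  rewrite -subset0 => _ [-> /ai ni']; move/eqP: ni; apply; exact: val_inj.
set S := functor_mor F A B (mk_approx Ta).
have Sb : bounded_op S by exact: approxOp_bounded.
have M0 := opnorm_ge0 Sb; set M := opnorm S in M0.
(* With error 1/16 for [S] and [d = (8 * (M + 1))^-1] for the projections, the total
   [M * d + 16^-1 * (1 + d)] stays below 1/4. *)
have M1 : 0 < 8 * (M + 1) by lra.
have [Sb' Sapp] := iffLR (approximableP _) (approxOpP S).
have [|E1 E1c SE] := Sapp 16^-1; first by rewrite invr_gt0.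
have UVapprox (t : A -> A) : approximable t -> approximable (UA \o t \o VA).
  by move=> ta; have := approxOpP (functor_mor F A A (mk_approx ta)); rewrite FA.
have e0 : 0 < (8 * (M + 1))^-1 by rewrite invr_gt0.
have [E2 E2c PE] := uniform_projections hY UVA UVapprox e0.
exists (rel_comp E1 E2); first exact: controlled_comp.
move=> n h; have pa := approximable_proj A [set a n].
rewrite (functor_mk_comp Ta pa h (Tn n)) (FA (mk_approx pa)).
apply: approx_atS (approx_at_comp M0 _ Sb (opnormP Sb) _ SE (PE [set a n])) => //.
  set d := _^-1; have Md : M * d + d = 8^-1.
    by rewrite -{2}(mul1r d) -mulrDl /d invfM mulrCA mulfV ?mulr1// gt_eqF// ltr_wpDl.
  have d0 : 0 < d by [].
  have := mulr_ge0 M0 (ltW d0); move: Md d0; lra.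
by move=> u /=; rewrite (unitary_norm UVA) -(unitary_inv_norm UVA u) cm_proj_le.
Qed.

Theorem functor_spreads_close (f g : X -> Y) : faithful_module A -> faithful_module B ->
  coarse_map f -> coarse_map g -> spreads (U := UA) f -> spreads (U := UB) g -> coarse_close f g.
Proof.
move=> fA fB cf cg fU gU.
have [rA [EA [EAc rAP]]] := faithful_retraction fA.
have [rB [EB [EBc rBP]]] := faithful_retraction fB.
have /choice [v vP] : forall x, exists v, cm_proj A [set rA x] v = v /\ hnorm v = 1.
  by move=> x; have [v] := module_support_unit (rAP x).1; exists v.
have /choice [w wP] : forall x, exists w, cm_proj B [set rB x] w = w /\ hnorm w = 1.
  by move=> x; have [w] := module_support_unit (rBP x).1; exists w.
pose p x := (f (rA x), g (rB x)).
have Tc : controlled (rel_comp (rel_inv EB) EA).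
  by apply: controlled_comp => //; exact: controlled_inv.
have Ta x : approximable (rank_one (w x) (v x)).
  apply: approximable_controlled (rank_one_bounded _ _) Tc _.
  apply: subset_trans (rank_one_support (wP x).1 (vP x).1) _ => -[y z] [/= -> ->].
  by exists x; [exact: (rBP x).2|exact: (rAP x).2].
suff [Z Zc pZ] : exists2 Z, controlled Z & forall x, Z (p x).
  move=> E Ec; apply: controlledS (controlled_comp (cf _ (controlled_comp Ec EAc))
    (controlled_comp Zc (cg _ (controlled_inv EBc)))).
  move=> _ [[x x'] Exx <-] /=; exists (f (rA x')).
    by exists (x, rA x') => //; exists x' => //; exact: (rAP x').2.
  by exists (g (rB x')); [exact: pZ|exists (rB x', x') => //; exact: (rBP x').2].
apply: contrapT => no; have [E [Ec Em Ecof]] := controlled_cofinal hY.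
(* Even a single pair must be shown to be an entourage; approximability of the image of one rank one
   operator does it. *)
have point x : controlled [set p x].
  have [_ app] := iffLR (approximableP _) (approxOpP (functor_mor F A B (mk_approx (Ta x)))).
  have [|E' E'c FE] := app 4^-1; first by rewrite invr_gt0.
  have [Q Qc QP] := functor_rank_one_close fU gU E'c.
  apply: controlledS Qc => _ ->.
  exact: (QP _ _ _ _ (Ta x) (vP x).1 (wP x).1 (vP x).2 (wP x).2 FE).
pose N (l : seq X) x := ~ E (size l) (p x) /\
  forall y, List.In y l -> rA x <> rA y /\ rB x <> rB y.
have [l _|x xP] := @dependent_sequence _ N.
  (* By local finiteness only finitely many points share a retraction value with earlier ones. By
     [point] their pairs fit into an entourage, so failures remain elsewhere. *)
  have [S Sf SP] : exists2 S, finite_set S &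
      forall x y, List.In y l -> rA x = rA y \/ rB x = rB y -> S x.
    elim: l => [|y l [S Sf SP]]; first by exists set0.
    exists (thickening EA [set rA y] `|` thickening EB [set rB y] `|` S).
      rewrite !finite_setU; split => //.
      by split; apply: thickening_finite => //; exact: finite_set1.
    move=> x z [<-|zl] xz; last by right; exact: SP zl xz.
    by left; case: xz => <-; [left|right]; [exists (rA x)|exists (rB x)] => //;
      [exact: (rAP x).2|exact: (rBP x).2].
  apply: contrapT => nx; apply: no.
  exists (E (size l) `|` [set z | exists2 x, S x & [set p x] z]).
    by apply: controlledU => //; apply: controlled_finite_union.
  move=> x; have [Ex|nEx] := pselect (E (size l) (p x)); first by left.
  right; exists x => //; apply: contrapT => nS; apply: nx; exists x; split => // y yl.
  by split => rxy; apply: nS; apply: SP yl _; [left|right].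
have inj (r : X -> X) : (forall i j, (i < j)%N -> r (x j) <> r (x i)) -> injective (r \o x).
  move=> rx i j /= rij; apply: contrapT => /eqP; rewrite neq_ltn => /orP[ij|ji].
    by apply: (rx _ _ ij).
  by apply: (rx _ _ ji).
have [E' E'c FE] := functor_uniform_rank_one (a := rA \o x) (b := rB \o x)
  (v := v \o x) (w := w \o x)
  (inj rA (fun i j ij => ((xP j).2 _ (In_history x ij)).1))
  (inj rB (fun i j ij => ((xP j).2 _ (In_history x ij)).2)) Tc
  (fun n => ex_intro2 _ _ (x n) (rBP (x n)).2 (rAP (x n)).2)
  (fun n => vP (x n)) (fun n => wP (x n)).
have [Q Qc QP] := functor_rank_one_close fU gU E'c.
have [n Qn] := Ecof _ Qc; have := (xP n).1; rewrite size_history; apply; apply: Qn.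
exact: (QP _ _ _ _ (Ta (x n)) (vP (x n)).1 (wP (x n)).1 (vP (x n)).2 (wP (x n)).2
  (FE n (Ta (x n)))).
Qed.

End FunctorRigidity.

(** The object equation can be eliminated only while both objects are variables, hence the separate
    statement. *)
Lemma induces_end_cast (R : realType) (k : rankBound) (X Y : lfCoarseSpace)
    (C : coarseModule R X) (D D' : moduleObj R k Y) (e : D = D')
    (phi : approxOp C C -> approxOp D D) (phi' : approxOp C C -> approxOp D' D') f :
  (forall t, end_cast e (phi t) = phi' t) -> induces phi' f -> induces phi f.
Proof.
case: _ / e phi' => phi' phiE; rewrite (_ : phi' = phi)//.
by apply/funext => t; rewrite -phiE.
Qed.

Lemma functor_star_isomorphism (R : realType) (k : rankBound) (X Y : lfCoarseSpace)
    (F : starFunctor R k X Y) (C : moduleObj R k X) :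
  functor_full F -> functor_faithful F -> is_star_isomorphism (functor_mor F C C).
Proof.
move=> full faith; split.
- have /choice [G GP] := full C C; exists G => // t; exact: faith.
- exact: linearP.
- by move=> s t; exact: functor_comp.
- by move=> s t; exact: functor_adj.
Qed.

Theorem corollary0p3 (R : realType) (X Y : lfCoarseSpace)
    (hX : countably_generated X) (hY : countably_generated Y)
    (k : rankBound) (I : Type) (hI : inhabited I)
    (CX : I -> moduleObj R k X) (hCX : forall i, faithful_module (CX i))
    (CY : I -> moduleObj R k Y) (hCY : forall i, faithful_module (CY i))
    (phi : forall i, approxOp (CX i) (CX i) -> approxOp (CY i) (CY i))
    (hphi : forall i, is_star_isomorphism (phi i))
    (hfam : forall i j (e : CX i = CX j), exists e' : CY i = CY j,
       forall t, end_cast e' (phi i t) = phi j (end_cast e t)) :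
  (exists f : I -> X -> Y,
     (forall i, induces (phi i) (f i)) /\ (forall i j, coarse_close (f i) (f j)))
  <->
  (exists F : starFunctor R k X Y,
     [/\ functor_full F, functor_faithful F
       & forall i, exists e : functor_obj F (CX i) = CY i,
           forall t, end_cast e (functor_mor F (CX i) (CX i) t) = phi i t]).
Proof.
split=> [[f [find fclose]]|[F [full faith Fphi]]].
  (* One member represents the common closeness class; [spreads_close] moves every unitary to it. *)
  have [i0] := hI; have [ef _] := find i0.
  have hspread i : exists (U : CX i -> CY i) (V : CY i -> CX i),
      [/\ unitary_pair U V, forall t, phi i t = U \o t \o V :> (CY i -> CY i)
        & spreads (U := U) (f i0)].
    have [U [V [UV phiE fU]]] := induces_spreads (hphi i) hX hY (hCX i) (find i).
    by exists U, V; split => //; exact: spreads_close (fclose i i0) fU.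
  exists (conj_functor hY hphi hfam ef hspread); split.
  - exact: conj_functor_full.
  - exact: conj_functor_faithful.
  - exact: conj_functor_family.
have /choice [f find] : forall i, exists f, induces (phi i) f.
  by move=> i; exact: (star_iso_induces (hphi i) hX hY (hCX i) (hCY i)).
(* The unitaries have to land in [functor_obj F (CX i)], which equals [CY i] only propositionally,
   so the inducing data is transported along [e]. *)
have Fspread i : exists (U : CX i -> functor_obj F (CX i)) (V : functor_obj F (CX i) -> CX i),
    [/\ unitary_pair U V,
        forall t, functor_mor F (CX i) (CX i) t = U \o t \o V :> (_ -> _)
      & spreads (U := U) (f i)].
  have [e eP] := Fphi i.
  have [U [V UVf]] := induces_spreads (functor_star_isomorphism (CX i) full faith) hX hY (hCX i)
    (induces_end_cast eP (find i)).
  by exists U, V.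
exists f; split => // i j.
have [Ui [Vi [UVi Fi fi]]] := Fspread i; have [Uj [Vj [UVj Fj fj]]] := Fspread j.
have [[cfi _] _] := find i; have [[cfj _] _] := find j.
exact: (functor_spreads_close hY UVi UVj Fi Fj (hCX i) (hCX j) cfi cfj fi fj).
Qed.
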